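(* Let $0\leq\gamma\leq1$ and $1\leq p\leq\infty$, let $q$ be the exponent conjugate to $p$, and set $\alpha_c=\frac{1-\gamma}{\max(2,q)}$. Then for any function $\varphi:[0,1)\to\mathbb{R}_+$ with $\varphi(r)\to+\infty$ as $r\to1^-$, there exist a function $f\in H(\mathbb{D})$ that is $\mathcal{U}_{\beta^\gamma}$-frequently hypercyclic for $T_{\alpha_c}$ and a constant $C>0$ such that $M_p(f,r)\leq C\varphi(r)$ for all $0<r<1$ sufficiently close to $1$.
   Context: $\mathbb{D}$ is the open unit disc in $\mathbb{C}$ and $H(\mathbb{D})$ is the Fréchet space of analytic functions on $\mathbb{D}$ with the topology of uniform convergence on compact subsets. For $\alpha\in\mathbb{R}$ and $n\ge1$ put $w_n(\alpha)=(1+\frac1n)^{\alpha}$; the weighted Taylor shift $T_\alpha:H(\mathbb{D})\to H(\mathbb{D})$ is $T_\alpha\big(\sum_{k\ge0}a_kz^k\big)=\sum_{k\ge0}a_{k+1}w_{k+1}(\alpha)z^k$. For $0\le\gamma\le1$ and $E\subset\mathbb{N}$, the upper $\beta^\gamma$-density is $\overline d_{\beta^\gamma}(E)=\limsup_{n\to\infty}\frac{\sum_{1\le k\le n,\,k\in E}e^{k^\gamma}}{\sum_{k=1}^ne^{k^\gamma}}$ (for $\gamma=0$ the weights are constant and this is the upper natural density; for $\gamma=1$ it is positive if and only if $E$ is infinite). A function $f\in H(\mathbb{D})$ is $\mathcal{U}_{\beta^\gamma}$-frequently hypercyclic for $T_\alpha$ if for every non-empty open set $U\subset H(\mathbb{D})$,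 $\overline d_{\beta^\gamma}(\{n\in\mathbb{N}:T_\alpha^nf\in U\})>0$; for $\gamma=0$ this is $\mathcal{U}$-frequent hypercyclicity and for $\gamma=1$ it is hypercyclicity. For $0<r<1$, $M_p(f,r)=\big(\frac1{2\pi}\int_0^{2\pi}|f(re^{i\theta})|^p\,d\theta\big)^{1/p}$ if $1\le p<\infty$, and $M_\infty(f,r)=\sup_{0\le t\le2\pi}|f(re^{it})|$. The conjugate exponent $q$ satisfies $\frac1p+\frac1q=1$, with $q=\infty$ and $\frac1{\max(2,q)}=0$ if $p=1$, and $q=1$ if $p=\infty$. *)

(* Defs.v *)
From Stdlib Require Import Reals List ClassicalEpsilon.
From Coquelicot Require Import Coquelicot.

Open Scope R_scope.

(** * The space H(D)

    An element of H(D) is represented by a function [f : C -> C]; its values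
    outside the open unit disc are irrelevant, and every notion below depends
    only on the values inside. *)

Definition disc (z : C) : Prop := Cmod z < 1.

Definition analytic_at (f : C -> C) (z0 : C) : Prop :=
  exists (a : nat -> C) (rho : R), 0 < rho /\
    forall z : C, Cmod (z - z0)%C < rho ->
      @is_pseries C_AbsRing C_NormedModule a (z - z0)%C (f z).

Definition HD (f : C -> C) : Prop := forall z, disc z -> analytic_at f z.

Definition compact_set (K : C -> Prop) : Prop :=
  forall F : (C -> Prop) -> Prop,
    (forall O, F O -> open O) ->
    (forall z, K z -> exists O, F O /\ O z) ->
    exists l : list (C -> Prop),
      (forall O, In O l -> F O) /\ (forall z, K z -> exists O, In O l /\ O z).

(* Topology of uniform convergence on compact subsets of the disc.  Since the
   compact sets stay inside the disc, an open [U] automatically contains with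
   [f] every element of H(D) that agrees with [f] on the disc. *)
Definition HD_open (U : (C -> C) -> Prop) : Prop :=
  (forall f, U f -> HD f) /\
  (forall f, U f ->
    exists (K : C -> Prop) (eps : R),
      compact_set K /\ (forall z, K z -> disc z) /\ 0 < eps /\
      forall g, HD g -> (forall z, K z -> Cmod (g z - f z)%C < eps) -> U g).

(** * Weighted Taylor shifts *)

Definition taylor_expansion (f : C -> C) (a : nat -> C) : Prop :=
  forall z, disc z -> @is_pseries C_AbsRing C_NormedModule a z (f z).

Definition weight (alpha : R) (n : nat) : R := Rpower (1 + 1 / INR n) alpha.

(* The operator is given by its graph: [taylor_shift alpha f g] means that
   [g = T_alpha f] on the disc. *)
Definition taylor_shift (alpha : R) (f g : C -> C) : Prop :=
  exists a : nat -> C,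
    taylor_expansion f a /\
    taylor_expansion g (fun k => a (S k) * RtoC (weight alpha (S k)))%C.

Fixpoint taylor_shift_iter (alpha : R) (n : nat) (f g : C -> C) : Prop :=
  match n with
  | O => g = f
  | S m => exists h, taylor_shift alpha f h /\ taylor_shift_iter alpha m h g
  end.

(** * Upper densities and frequent hypercyclicity *)

(* Only used at positive arguments [k], so that [Rpower] is the usual power;
   in particular [k ^ 0 = 1]. *)
Definition beta_weight (gamma : R) (k : nat) : R := exp (Rpower (INR k) gamma).

Definition beta_weight_on (gamma : R) (E : nat -> Prop) (k : nat) : R :=
  if excluded_middle_informative (E k) then beta_weight gamma k else 0.

Definition upper_density (gamma : R) (E : nat -> Prop) : Rbar :=
  LimSup_seq (fun n =>
    sum_n_m (beta_weight_on gamma E) 1 n / sum_n_m (beta_weight gamma) 1 n).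

Definition U_freq_hypercyclic (gamma alpha : R) (f : C -> C) : Prop :=
  forall U : (C -> C) -> Prop, HD_open U -> (exists g, U g) ->
    Rbar_lt 0
      (upper_density gamma (fun n => exists g, taylor_shift_iter alpha n f g /\ U g)).

(** * Integral means *)

(* Stdlib has [Rpower 0 y = 1]; the mean needs [0 ^ y = 0] for [y > 0]. *)
Definition pow0 (x y : R) : R := if Req_EM_T x 0 then 0 else Rpower x y.

Definition circle_point (r t : R) : C := (r * cos t, r * sin t).

Definition integral_mean (p : Rbar) (f : C -> C) (r : R) : Rbar :=
  match p with
  | Finite p =>
      Finite (pow0 (1 / (2 * PI) *
                    RInt (fun t => pow0 (Cmod (f (circle_point r t))) p) 0 (2 * PI))
                   (1 / p))
  | p_infty =>
      Lub_Rbar (fun y => exists t, 0 <= t <= 2 * PI /\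
                                   y = Cmod (f (circle_point r t)))
  | m_infty => 0 (* never used: exponents are at least 1 *)
  end.

(** * Exponents *)

(* [Rbar_inv p_infty = 0]. *)
Definition conjugate_exponents (p q : Rbar) : Prop :=
  Rbar_le 1 p /\ Rbar_le 1 q /\ Rbar_plus (Rbar_inv p) (Rbar_inv q) = 1.

Definition Rbar_max (x y : Rbar) : Rbar := if Rbar_le_dec x y then y else x.

Definition alpha_crit (gamma : R) (q : Rbar) : R :=
  (1 - gamma) * real (Rbar_inv (Rbar_max 2 q)).

(* Main.v *)
From Stdlib Require Import Reals ZArith List Cantor Lra Lia ClassicalEpsilon
  FunctionalExtensionality.
From Coquelicot Require Import Coquelicot.
Require Import Defs.

Open Scope R_scope.

(** The function is a superposition of blocks, polynomials placed at rapidly increasing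
    degrees [N], each of which serves one target from a countable dense family.  A block
    for the target polynomial [q] is, up to bounded factors,
    [z ^ N * N ^ (- alpha) * P z * K (z ^ d)], where [P] is [q] with coefficients divided
    by the weights that [T_alpha] will multiply them with, and [K] is a polynomial of
    length comparable to [L] with bounded coefficients, a fixed proportion of which are
    equal to [1].  If the coefficient of index [i] of [K] is [1], then [T_alpha] applied
    [N + i * d] times maps the block to a function close to [q] on a given smaller disc:
    earlier blocks are gone, the later copies of [q] in the same block start at degree
    [d], and the later blocks start at a still much higher degree.

    The theorem is a balance between the number of hits and the size of [K].  The weights
    [exp (k ^ gamma)] put a positive proportion of their sum up to [N] on a window of
    length [N ^ (1 - gamma)] at [N] (beta_sum_window), and so the block produces positive
    upper density if [L] is comparable to [N ^ (1 - gamma)].  There are such kernels whose mean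
    of order [p] is only [L ^ sigma] up to a constant, with [sigma = 1 / max (2, q)]:
    for [p >= 2] the Rudin-Shapiro polynomials, which are of size [sqrt L] uniformly
    (kernel_family_sup), and for [p < 2] kernels of de la Vallee Poussin type
    (kernel_family_low).  At the critical exponent [alpha = (1 - gamma) * sigma] the
    factor [N ^ (- alpha)] exactly compensates [L ^ sigma], so the mean of a block is at
    most [c * r ^ N], with [c] depending on the target only (good_block_exists).

    As [N] is still free, the blocks can be delayed.  Block number [k] is only allowed to
    contribute substantially at radii where [phi] already exceeds the sum of the first
    [k + 1] constants [c]; at smaller radii [r ^ N] makes it at most [2 ^ (- k)].  With
    Minkowski's inequality this bounds the mean of order [p] by [phi r + 3]
    (sparse_growth, sum_mean).  Upper densities are limits superior, so that it does no
    harm that the windows are far apart (sum_U_freq_hypercyclic).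

    Two facts from complex analysis are needed: the sum of a power series is analytic at
    every point of its disc (PS_reexpand), and the polynomials are dense in H(D)
    (HD_polynomial_approx).  The latter comes from Cauchy's formula on circles, which is
    obtained by contracting the circle to a point under the integral sign. *)



(** * Finite sums *)

Fixpoint Csum (u : nat -> C) (n : nat) : C :=
  match n with O => RtoC 0 | S k => (Csum u k + u k)%C end.

Fixpoint Rsum (u : nat -> R) (n : nat) : R :=
  match n with O => 0 | S k => Rsum u k + u k end.

Lemma Rsum_le u v n : (forall i, (i < n)%nat -> u i <= v i) -> Rsum u n <= Rsum v n.
Proof.
  induction n as [|n IH]; intros H; simpl; [lra|].
  apply Rplus_le_compat; [apply IH; intros; apply H; lia | apply H; lia].
Qed.

Lemma Rsum_ext u v n : (forall i, (i < n)%nat -> u i = v i) -> Rsum u n = Rsum v n.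
Proof.
  intros H; apply Rle_antisym; apply Rsum_le; intros i Hi; rewrite (H i Hi); lra.
Qed.

Lemma Rsum_plus u v n : Rsum (fun i => u i + v i) n = Rsum u n + Rsum v n.
Proof. induction n as [|n IH]; simpl; [|rewrite IH]; lra. Qed.

Lemma Rsum_scal c u n : Rsum (fun i => c * u i) n = c * Rsum u n.
Proof. induction n as [|n IH]; simpl; [|rewrite IH]; lra. Qed.

Lemma Rsum_const c n : Rsum (fun _ => c) n = INR n * c.
Proof. induction n as [|n IH]; [simpl; lra|]. simpl Rsum; rewrite IH, S_INR; lra. Qed.

Lemma Rsum_nonneg u n : (forall i, (i < n)%nat -> 0 <= u i) -> 0 <= Rsum u n.
Proof.
  intros H; replace 0 with (Rsum (fun _ => 0) n); [now apply Rsum_le|].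
  rewrite Rsum_const; lra.
Qed.

Lemma Rsum_add u n m : Rsum u (n + m) = Rsum u n + Rsum (fun i => u (n + i)%nat) m.
Proof.
  induction m as [|m IH]; [rewrite Nat.add_0_r; simpl; lra|].
  rewrite Nat.add_succ_r; simpl; rewrite IH; lra.
Qed.

Lemma Rsum_mono u n m :
  (forall i, 0 <= u i) -> (n <= m)%nat -> Rsum u n <= Rsum u m.
Proof.
  intros H Hnm; replace m with (n + (m - n))%nat by lia; rewrite Rsum_add.
  pose proof (Rsum_nonneg (fun i => u (n + i)%nat) (m - n) (fun i _ => H _)); lra.
Qed.

Lemma Rsum_term u n k :
  (forall i, 0 <= u i) -> (k < n)%nat -> u k <= Rsum u n.
Proof.
  intros H Hk. apply Rle_trans with (Rsum u (S k)); [|apply Rsum_mono; [auto|lia]].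
  simpl; pose proof (Rsum_nonneg u k (fun i _ => H i)); lra.
Qed.

Lemma Rsum_geom q n : 0 <= q < 1 -> Rsum (fun i => q ^ i) n <= / (1 - q).
Proof.
  intros Hq.
  assert (H : Rsum (fun i => q ^ i) n * (1 - q) = 1 - q ^ n).
  { induction n as [|n IH]; simpl; [lra|]. rewrite Rmult_plus_distr_r, IH; ring. }
  apply (Rmult_le_reg_r (1 - q)); [lra|]. rewrite H, Rinv_l by lra.
  pose proof (pow_le q n (proj1 Hq)); lra.
Qed.

Lemma Csum_ext u v n : (forall i, (i < n)%nat -> u i = v i) -> Csum u n = Csum v n.
Proof.
  induction n as [|n IH]; intros H; simpl; [auto|].
  rewrite IH by (intros; apply H; lia); rewrite H by lia; auto.
Qed.

Lemma Csum_zero n : Csum (fun _ => RtoC 0) n = RtoC 0.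
Proof. induction n as [|n IH]; simpl; [auto|rewrite IH; ring]. Qed.

Lemma Csum_plus u v n : Csum (fun i => u i + v i)%C n = (Csum u n + Csum v n)%C.
Proof. induction n as [|n IH]; simpl; [|rewrite IH]; ring. Qed.

Lemma Csum_scal c u n : Csum (fun i => c * u i)%C n = (c * Csum u n)%C.
Proof. induction n as [|n IH]; simpl; [|rewrite IH]; ring. Qed.

Lemma Csum_minus u v n : Csum (fun i => u i - v i)%C n = (Csum u n - Csum v n)%C.
Proof. induction n as [|n IH]; simpl; [|rewrite IH]; ring. Qed.

Lemma Csum_add u n m : Csum u (n + m) = (Csum u n + Csum (fun i => u (n + i)%nat) m)%C.
Proof.
  induction m as [|m IH]; [rewrite Nat.add_0_r; simpl; ring|].
  rewrite Nat.add_succ_r; simpl; rewrite IH; ring.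
Qed.

Lemma Csum_grouped u n d :
  Csum u (n * d) = Csum (fun i => Csum (fun j => u (i * d + j)%nat) d) n.
Proof.
  induction n as [|n IH]; [reflexivity|].
  rewrite Nat.mul_succ_l, Csum_add, IH; reflexivity.
Qed.

Lemma Csum_switch (u : nat -> nat -> C) n m :
  Csum (fun i => Csum (u i) m) n = Csum (fun j => Csum (fun i => u i j) n) m.
Proof.
  induction n as [|n IH]; simpl; [now rewrite Csum_zero|].
  rewrite IH, <- Csum_plus; reflexivity.
Qed.

Lemma Csum_stable u n m :
  (n <= m)%nat -> (forall i, (n <= i)%nat -> u i = RtoC 0) -> Csum u m = Csum u n.
Proof.
  intros Hnm H; replace m with (n + (m - n))%nat by lia; rewrite Csum_add.
  rewrite (Csum_ext (fun i => u (n + i)%nat) (fun _ => RtoC 0)) by (intros; apply H; lia).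
  rewrite Csum_zero; ring.
Qed.

Lemma Cmod_Csum u n : Cmod (Csum u n) <= Rsum (fun i => Cmod (u i)) n.
Proof.
  induction n as [|n IH]; simpl; [rewrite Cmod_0; lra|].
  eapply Rle_trans; [apply Cmod_triangle|lra].
Qed.

Lemma Cmod_minus_sym a b : Cmod (a - b)%C = Cmod (b - a)%C.
Proof. rewrite <- Cmod_opp; f_equal; ring. Qed.

Lemma Cmod_minus_le a b : Cmod (a - b)%C <= Cmod a + Cmod b.
Proof. unfold Cminus; rewrite <- (Cmod_opp b); apply Cmod_triangle. Qed.

Lemma Cmod_triangle_minus a b c : Cmod (a - c)%C <= Cmod (a - b)%C + Cmod (b - c)%C.
Proof. replace (a - c)%C with ((a - b) + (b - c))%C by ring; apply Cmod_triangle. Qed.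

Lemma Cmod_small_eq a b : (forall eps, 0 < eps -> Cmod (a - b)%C <= eps) -> a = b.
Proof.
  intros H.
  assert (E : Cmod (a - b)%C = 0).
  { destruct (Cmod_ge_0 (a - b)%C) as [P|P]; [|auto].
    specialize (H (Cmod (a - b)%C / 2)); lra. }
  apply Cmod_eq_0 in E. replace a with (a - b + b)%C by ring. rewrite E; ring.
Qed.

(** * Convergent series of complex numbers *)

Definition has_sum (u : nat -> C) (l : C) : Prop :=
  forall eps, 0 < eps ->
    exists N, forall n, (N <= n)%nat -> Cmod (Csum u n - l)%C <= eps.

(** [sum_n u n] has [n + 1] terms. *)
Lemma sum_n_Csum (u : nat -> C) n : @sum_n C_AbelianMonoid u n = Csum u (S n).
Proof.
  induction n as [|n IH]; [rewrite sum_O; simpl; ring|].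
  rewrite sum_Sn, IH; reflexivity.
Qed.

Lemma has_sum_is_series (u : nat -> C) l :
  has_sum u l <-> @is_series C_AbsRing C_NormedModule u l.
Proof.
  split; intros H.
  - apply filterlim_locally_ball_norm. intros eps.
    destruct (H (eps / 2)) as [N HN]; [destruct eps; simpl; lra|].
    exists N; intros n Hn. unfold ball_norm.
    change (Cmod (@sum_n C_AbelianMonoid u n - l)%C < eps).
    rewrite sum_n_Csum.
    specialize (HN (S n)). destruct eps as [e He]; simpl in *.
    assert (Cmod (Csum u n + u n - l)%C <= e / 2) by (apply HN; lia). lra.
  - intros eps Heps.
    apply (proj1 (filterlim_locally_ball_norm _ _)) with (eps := mkposreal eps Heps) in H.
    destruct H as [N HN]. exists (S N); intros [|n] Hn; [lia|].
    specialize (HN n ltac:(lia)). unfold ball_norm in HN.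
    change (Cmod (@sum_n C_AbelianMonoid u n - l)%C < eps) in HN.
    rewrite sum_n_Csum in HN. lra.
Qed.

Lemma has_sum_unique u l l' : has_sum u l -> has_sum u l' -> l = l'.
Proof.
  intros H H'. apply Cmod_small_eq; intros eps Heps.
  destruct (H (eps / 2)) as [N HN]; [lra|]. destruct (H' (eps / 2)) as [N' HN']; [lra|].
  specialize (HN (max N N') ltac:(lia)). specialize (HN' (max N N') ltac:(lia)).
  pose proof (Cmod_triangle_minus l (Csum u (max N N')) l') as T.
  rewrite Cmod_minus_sym in HN. lra.
Qed.

Lemma has_sum_ext u v l : (forall n, u n = v n) -> has_sum u l -> has_sum v l.
Proof. intros H; rewrite (functional_extensionality u v H); auto. Qed.

Lemma has_sum_plus u v l l' :
  has_sum u l -> has_sum v l' -> has_sum (fun n => u n + v n)%C (l + l')%C.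
Proof.
  intros H H' eps Heps.
  destruct (H (eps / 2)) as [N HN]; [lra|]. destruct (H' (eps / 2)) as [N' HN']; [lra|].
  exists (max N N'); intros n Hn.
  specialize (HN n ltac:(lia)). specialize (HN' n ltac:(lia)).
  rewrite Csum_plus.
  replace (Csum u n + Csum v n - (l + l'))%C with ((Csum u n - l) + (Csum v n - l'))%C by ring.
  eapply Rle_trans; [apply Cmod_triangle|lra].
Qed.

Lemma has_sum_scal c u l : has_sum u l -> has_sum (fun n => c * u n)%C (c * l)%C.
Proof.
  intros H eps Heps. pose proof (Cmod_ge_0 c) as Hc.
  destruct (H (eps / (Cmod c + 1))) as [N HN]; [apply Rdiv_lt_0_compat; lra|].
  exists N; intros n Hn. specialize (HN n Hn). rewrite Csum_scal.
  replace (c * Csum u n - c * l)%C with (c * (Csum u n - l))%C by ring.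
  rewrite Cmod_mult.
  apply Rle_trans with ((Cmod c + 1) * (eps / (Cmod c + 1))); [|right; field; lra].
  apply Rmult_le_compat; [auto|apply Cmod_ge_0|lra|auto].
Qed.

Lemma has_sum_minus u v l l' :
  has_sum u l -> has_sum v l' -> has_sum (fun n => u n - v n)%C (l - l')%C.
Proof.
  intros H H'. replace (l - l')%C with (l + (- (1)) * l')%C by ring.
  apply has_sum_ext with (fun n => u n + (- (1)) * v n)%C; [intros; ring|].
  now apply has_sum_plus, has_sum_scal.
Qed.

Lemma has_sum_finite u N :
  (forall n, (N <= n)%nat -> u n = RtoC 0) -> has_sum u (Csum u N).
Proof.
  intros H eps Heps. exists N; intros n Hn. rewrite (Csum_stable u N n Hn H).
  replace (Csum u N - Csum u N)%C with (RtoC 0) by ring. rewrite Cmod_0; lra.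
Qed.

Lemma has_sum_Csum (u : nat -> nat -> C) (l : nat -> C) K :
  (forall k, (k < K)%nat -> has_sum (u k) (l k)) ->
  has_sum (fun n => Csum (fun k => u k n) K) (Csum l K).
Proof.
  induction K as [|K IH]; intros H; simpl.
  - apply (has_sum_finite (fun _ => RtoC 0) 0); auto.
  - apply has_sum_plus; [apply IH; intros; apply H; lia|apply H; lia].
Qed.

(** A series is estimated through its partial sums, so that no separate theory of
    absolutely convergent series is called for. *)
Lemma has_sum_bound u l B :
  has_sum u l -> (forall n, Rsum (fun i => Cmod (u i)) n <= B) -> Cmod l <= B.
Proof.
  intros H HB. apply le_epsilon; intros eps Heps.
  destruct (H eps Heps) as [N HN]. specialize (HN N (le_n _)).
  replace l with (Csum u N - (Csum u N - l))%C by ring.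
  eapply Rle_trans; [apply Cmod_minus_le|].
  pose proof (Cmod_Csum u N); specialize (HB N); lra.
Qed.

Lemma Rsum_tail_geom (u : nat -> R) M q N n :
  0 <= q < 1 -> 0 <= M -> (forall i, (i < N)%nat -> u i <= 0) ->
  (forall i, (N <= i)%nat -> u i <= M * q ^ i) ->
  Rsum u n <= M * q ^ N / (1 - q).
Proof.
  intros Hq HM H0 H.
  assert (0 <= M * q ^ N) by (apply Rmult_le_pos; [auto|apply pow_le; lra]).
  assert (Hneg : forall k, (k <= N)%nat -> Rsum u k <= 0).
  { intros k Hk. apply Rle_trans with (Rsum (fun _ => 0) k).
    - apply Rsum_le; intros; apply H0; lia.
    - rewrite Rsum_const; lra. }
  destruct (Nat.le_gt_cases n N) as [Hn|Hn].
  - apply Rle_trans with 0; [now apply Hneg|]. apply Rmult_le_pos; [auto|].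
    left; apply Rinv_0_lt_compat; lra.
  - replace n with (N + (n - N))%nat by lia. rewrite Rsum_add.
    pose proof (Hneg N (le_n _)).
    apply Rle_trans with (0 + Rsum (fun i => M * q ^ N * q ^ i) (n - N)).
    + apply Rplus_le_compat; [auto|]. apply Rsum_le; intros i _.
      rewrite Rmult_assoc, <- pow_add. apply H; lia.
    + rewrite Rsum_scal, Rplus_0_l. unfold Rdiv.
      apply Rmult_le_compat_l; [auto|now apply Rsum_geom].
Qed.

Lemma has_sum_geom_bound u l M q N :
  0 <= q < 1 -> 0 <= M -> has_sum u l ->
  (forall n, (n < N)%nat -> u n = RtoC 0) ->
  (forall n, (N <= n)%nat -> Cmod (u n) <= M * q ^ n) -> Cmod l <= M * q ^ N / (1 - q).
Proof.
  intros Hq HM Hl H0 H. apply (has_sum_bound u l); [auto|]. intros n.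
  apply Rsum_tail_geom; auto. intros i Hi; rewrite H0, Cmod_0 by auto; lra.
Qed.

(** All series below are dominated by geometric ones; completeness of the complex
    numbers enters only here. *)
Lemma ex_has_sum_geom u M q :
  0 <= q < 1 -> (forall n, Cmod (u n) <= M * q ^ n) -> exists l, has_sum u l.
Proof.
  intros Hq H.
  destruct (@ex_series_le C_AbsRing C_CompleteNormedModule u (fun n => M * q ^ n)) as [l Hl].
  - exact H.
  - apply (ex_series_scal M (fun n => q ^ n)). apply ex_series_geom. rewrite Rabs_pos_eq; lra.
  - exists l. now apply has_sum_is_series.
Qed.

Lemma has_sum_terms_bounded u l : has_sum u l -> exists M, 0 <= M /\ forall n, Cmod (u n) <= M.
Proof.
  intros H. destruct (H 1 Rlt_0_1) as [N HN].
  exists (2 + Rsum (fun i => Cmod (u i)) N).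
  assert (P := Rsum_nonneg (fun i => Cmod (u i)) N (fun i _ => Cmod_ge_0 _)).
  split; [lra|]. intros n. destruct (Nat.le_gt_cases N n) as [Hn|Hn].
  - pose proof (HN n Hn) as H1. pose proof (HN (S n) ltac:(lia)) as H2. simpl in H2.
    replace (u n) with ((Csum u n + u n - l) - (Csum u n - l))%C by ring.
    eapply Rle_trans; [apply Cmod_minus_le|lra].
  - pose proof (Rsum_term (fun i => Cmod (u i)) N n (fun i => Cmod_ge_0 _) Hn); simpl in *; lra.
Qed.

Lemma functional_choice {A B : Type} (P : A -> B -> Prop) :
  (forall x, exists y, P x y) -> exists g, forall x, P x (g x).
Proof.
  intros H. exists (fun x => proj1_sig (constructive_indefinite_description _ (H x))).
  intros x. apply proj2_sig.
Qed.

(** * Power series *)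

Definition PS (a : nat -> C) (z : C) : C :=
  epsilon (inhabits (RtoC 0)) (fun l => has_sum (fun n => a n * z ^ n)%C l).

(** Abel's condition: it makes the power series converge, with a geometric rate, at
    every [z] with [Cmod z < s].  It replaces the radius of convergence throughout. *)
Definition bounded_at (a : nat -> C) (s : R) : Prop :=
  exists M, 0 <= M /\ forall n, Cmod (a n) * s ^ n <= M.

Lemma Cpow_pow_n (z : C) n : @pow_n C_Ring z n = (z ^ n)%C.
Proof. induction n as [|n IH]; [reflexivity|]. simpl; rewrite IH; reflexivity. Qed.

Lemma has_sum_is_pseries a z l :
  has_sum (fun n => a n * z ^ n)%C l <-> @is_pseries C_AbsRing C_NormedModule a z l.
Proof.
  rewrite has_sum_is_series.
  assert (E : forall n, (a n * z ^ n)%C = @scal C_AbsRing C_NormedModule (pow_n z n) (a n)).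
  { intros n. change (a n * z ^ n = pow_n z n * a n)%C.
    rewrite <- Cpow_pow_n. apply Cmult_comm. }
  split; apply is_series_ext; intros n; [|symmetry]; apply E.
Qed.

Lemma PS_has_sum_ex a z l : has_sum (fun n => a n * z ^ n)%C l -> has_sum (fun n => a n * z ^ n)%C (PS a z).
Proof. intros H. unfold PS. apply epsilon_spec. now exists l. Qed.

Lemma PS_unique a z l : has_sum (fun n => a n * z ^ n)%C l -> PS a z = l.
Proof. intros H. eapply has_sum_unique; [|exact H]. now apply PS_has_sum_ex with l. Qed.

Lemma Cmod_term a s M n (z : C) r :
  0 < s -> Cmod (a n) * s ^ n <= M -> Cmod z <= r ->
  Cmod (a n * z ^ n)%C <= M * (r / s) ^ n.
Proof.
  intros Hs H Hr. rewrite Cmod_mult, Cmod_pow.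
  replace ((r / s) ^ n) with (r ^ n * / s ^ n).
  2:{ unfold Rdiv; rewrite Rpow_mult_distr, pow_inv; auto. }
  assert (0 < s ^ n) by (now apply pow_lt).
  assert (Cmod z ^ n <= r ^ n) by (apply pow_incr; split; [apply Cmod_ge_0|auto]).
  apply Rle_trans with (Cmod (a n) * r ^ n).
  - apply Rmult_le_compat_l; [apply Cmod_ge_0|auto].
  - replace (Cmod (a n) * r ^ n) with (Cmod (a n) * s ^ n * (r ^ n * / s ^ n)) by (field; lra).
    apply Rmult_le_compat_r; [|auto]. apply Rmult_le_pos.
    + apply pow_le. apply Rle_trans with (Cmod z); [apply Cmod_ge_0|auto].
    + left; now apply Rinv_0_lt_compat.
Qed.

Lemma ratio_range (z : C) r s : Cmod z <= r -> r < s -> 0 <= r / s < 1.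
Proof.
  intros Hr Hs. pose proof (Cmod_ge_0 z). split.
  - apply Rmult_le_pos; [lra|]. left; apply Rinv_0_lt_compat; lra.
  - apply (Rmult_lt_reg_r s); [lra|]. unfold Rdiv; rewrite Rmult_assoc, Rinv_l; lra.
Qed.

Lemma PS_has_sum a s z : bounded_at a s -> Cmod z < s -> has_sum (fun n => a n * z ^ n)%C (PS a z).
Proof.
  intros (M & HM & H) Hz. pose proof (Cmod_ge_0 z).
  destruct (ex_has_sum_geom (fun n => a n * z ^ n)%C M (Cmod z / s)) as [l Hl].
  - apply ratio_range with z; lra.
  - intros n; apply Cmod_term; [lra|auto|lra].
  - now apply PS_has_sum_ex with l.
Qed.

Lemma is_pseries_bounded_at a (z : C) l :
  @is_pseries C_AbsRing C_NormedModule a z l -> bounded_at a (Cmod z).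
Proof.
  intros H. apply has_sum_is_pseries, has_sum_terms_bounded in H as (M & HM & H).
  exists M; split; [auto|]. intros n. rewrite <- Cmod_pow, <- Cmod_mult. apply H.
Qed.

(** ** Re-expansion *)

(** The coefficient of [h ^ k] in [(z + h) ^ n], by Pascal's rule: no binomial
    coefficient and no truncated subtraction [n - k] occurs. *)
Fixpoint binom_coef (z : C) (n k : nat) : C :=
  match n, k with
  | O, O => RtoC 1
  | O, S _ => RtoC 0
  | S n', O => (z * binom_coef z n' O)%C
  | S n', S k' => (z * binom_coef z n' k + binom_coef z n' k')%C
  end.

Lemma binom_coef_1 z n : binom_coef z (S n) 1 = (INR (S n) * z ^ n)%C.
Proof.
  assert (H0 : forall m, binom_coef z m 0 = (z ^ m)%C).
  { induction m as [|m IH]; simpl; [auto|rewrite IH; auto]. }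
  induction n as [|n IH]; [simpl; ring|].
  change (binom_coef z (S (S n)) 1) with (z * binom_coef z (S n) 1 + binom_coef z (S n) 0)%C.
  rewrite IH, H0, (S_INR (S n)), RtoC_plus. simpl Cpow. ring.
Qed.

Lemma binom_coef_partial z h n N :
  Csum (fun k => binom_coef z (S n) k * h ^ k)%C (S N) =
  (z * Csum (fun k => binom_coef z n k * h ^ k) (S N)
   + h * Csum (fun k => binom_coef z n k * h ^ k) N)%C.
Proof.
  induction N as [|N IH]; [simpl; ring|].
  change (Csum (fun k => binom_coef z (S n) k * h ^ k)%C (S (S N))) with
    (Csum (fun k => binom_coef z (S n) k * h ^ k)%C (S N)
       + binom_coef z (S n) (S N) * h ^ (S N))%C.
  rewrite IH. simpl. ring.
Qed.

Lemma binom_coef_sum z h n N :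
  (n < N)%nat -> Csum (fun k => binom_coef z n k * h ^ k)%C N = ((z + h) ^ n)%C.
Proof.
  revert N; induction n as [|n IH]; intros [|N] HN; try lia.
  - rewrite (Csum_stable _ 1 (S N)); [simpl; ring|lia|].
    intros [|i] Hi; [lia|]. simpl; ring.
  - rewrite binom_coef_partial, !IH by lia. simpl; ring.
Qed.

(** The absolute values of the coefficients are at most those of
    [(Cmod z + eta) ^ n], whose terms are all positive. *)
Lemma binom_coef_abs z eta n N :
  0 <= eta -> Rsum (fun k => Cmod (binom_coef z n k) * eta ^ k) N <= (Cmod z + eta) ^ n.
Proof.
  intros Heta. pose proof (Cmod_ge_0 z) as Hz.
  revert N; induction n as [|n IH]; intros N.
  - destruct N as [|N]; [simpl; lra|].
    change (S N) with (1 + N)%nat. rewrite Rsum_add.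
    rewrite (Rsum_ext (fun i => Cmod (binom_coef z 0 (1 + i)) * eta ^ (1 + i)) (fun _ => 0)).
    + rewrite Rsum_const. cbn [Rsum binom_coef pow]. rewrite Cmod_1. lra.
    + intros i _. cbn [Nat.add binom_coef]. rewrite Cmod_0. ring.
  - assert (Hp : forall k, 0 <= Cmod (binom_coef z n k) * eta ^ k).
    { intros; apply Rmult_le_pos; [apply Cmod_ge_0|now apply pow_le]. }
    assert (Hrec : forall N, Rsum (fun k => Cmod (binom_coef z (S n) k) * eta ^ k) (S N) <=
      Cmod z * Rsum (fun k => Cmod (binom_coef z n k) * eta ^ k) (S N)
      + eta * Rsum (fun k => Cmod (binom_coef z n k) * eta ^ k) N).
    { clear N; induction N as [|N IHN].
      - simpl. rewrite Cmod_mult. lra.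
      - simpl Rsum in *.
        assert (Cmod (z * binom_coef z n (S N) + binom_coef z n N) * (eta * eta ^ N) <=
           (Cmod z * Cmod (binom_coef z n (S N)) + Cmod (binom_coef z n N)) * (eta * eta ^ N)).
        { apply Rmult_le_compat_r; [apply Rmult_le_pos; [auto|now apply pow_le]|].
          rewrite <- Cmod_mult. apply Cmod_triangle. }
        simpl in *. lra. }
    apply Rle_trans with (Rsum (fun k => Cmod (binom_coef z (S n) k) * eta ^ k) (S N)).
    + apply Rsum_mono; [|lia]. intros; apply Rmult_le_pos; [apply Cmod_ge_0|now apply pow_le].
    + eapply Rle_trans; [apply Hrec|]. simpl pow.
      rewrite Rmult_plus_distr_r. apply Rplus_le_compat; apply Rmult_le_compat_l; auto.
Qed.

(** Rearranging the double series [a n * binom_coef z n k * h ^ k] needs no Fubini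
    theorem: the partial sum in [k < N] of the new series is a finite combination of
    series in [n], and it agrees with [a n * (z + h) ^ n] for [n < N].  What remains is
    a geometric tail.  The coefficients [c] are kept as explicit sums because [c 1]
    has to be recognized as the derivative. *)
Lemma PS_reexpand a s z eta :
  bounded_at a s -> 0 < eta -> Cmod z + eta < s ->
  exists c : nat -> C,
    (forall k, has_sum (fun n => a n * binom_coef z n k)%C (c k)) /\
    bounded_at c eta /\
    (forall h, Cmod h <= eta -> has_sum (fun k => c k * h ^ k)%C (PS a (z + h)%C)).
Proof.
  intros (M & HM & H) Heta Hs. pose proof (Cmod_ge_0 z) as Hz.
  set (q := (Cmod z + eta) / s).
  assert (Hq : 0 <= q < 1) by (apply ratio_range with z; lra).
  assert (Hterm : forall n x, 0 <= x <= (Cmod z + eta) ^ n -> Cmod (a n) * x <= M * q ^ n).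
  { intros n x Hx. apply Rle_trans with (Cmod (a n) * (Cmod z + eta) ^ n).
    - apply Rmult_le_compat_l; [apply Cmod_ge_0|lra].
    - replace (Cmod z + eta) with (Cmod (RtoC (Cmod z + eta))) at 1
        by (rewrite Cmod_R, Rabs_pos_eq; lra).
      rewrite <- Cmod_pow, <- Cmod_mult. apply Cmod_term; [lra|auto|].
      rewrite Cmod_R, Rabs_pos_eq; lra. }
  assert (Hb : forall n k, Cmod (binom_coef z n k) * eta ^ k <= (Cmod z + eta) ^ n).
  { intros n k. eapply Rle_trans; [|apply (binom_coef_abs z eta n (S k)); lra].
    apply (Rsum_term (fun k => Cmod (binom_coef z n k) * eta ^ k)); [|lia].
    intros; apply Rmult_le_pos; [apply Cmod_ge_0|apply pow_le; lra]. }
  assert (Hck : forall k n, Cmod (a n * binom_coef z n k)%C <= M / eta ^ k * q ^ n).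
  { intros k n. assert (0 < eta ^ k) by (now apply pow_lt).
    apply (Rmult_le_reg_r (eta ^ k)); [auto|].
    rewrite Cmod_mult, Rmult_assoc.
    replace (M / eta ^ k * q ^ n * eta ^ k) with (M * q ^ n) by (field; lra).
    apply Hterm. split; [|auto].
    apply Rmult_le_pos; [apply Cmod_ge_0|lra]. }
  destruct (functional_choice (fun k l => has_sum (fun n => a n * binom_coef z n k)%C l)) as [c Hc].
  { intros k. apply ex_has_sum_geom with (M / eta ^ k) q; auto. }
  exists c; split; [auto|split].
  - exists (M / (1 - q)); split.
    + apply Rmult_le_pos; [auto|left; apply Rinv_0_lt_compat; lra].
    + intros k. assert (0 < eta ^ k) by (now apply pow_lt).
      assert (HB : Cmod (c k) <= M / eta ^ k * q ^ 0 / (1 - q)).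
      { apply has_sum_geom_bound with (fun n => a n * binom_coef z n k)%C; auto.
        - apply Rmult_le_pos; [auto|left; now apply Rinv_0_lt_compat].
        - intros; lia. }
      replace (M / (1 - q)) with (M / eta ^ k * q ^ 0 / (1 - q) * eta ^ k)
        by (simpl; field; lra).
      apply Rmult_le_compat_r; lra.
  - intros h Hh eps Heps.
    destruct (pow_lt_1_zero q) with (y := eps * (1 - q) / (2 * M + 1)) as [N HN].
    { rewrite Rabs_pos_eq; lra. }
    { apply Rdiv_lt_0_compat; [apply Rmult_lt_0_compat; lra|lra]. }
    exists N; intros n Hn. rewrite Cmod_minus_sym.
    apply Rle_trans with (2 * M * q ^ n / (1 - q)).
    + apply has_sum_geom_bound with
        (fun m => a m * (z + h) ^ m - Csum (fun k => h ^ k * (a m * binom_coef z m k)) n)%C;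
        auto; [lra| | |].
      * apply has_sum_minus.
        -- apply PS_has_sum with s; [exists M; auto|].
           eapply Rle_lt_trans; [apply Cmod_triangle|lra].
        -- rewrite (Csum_ext (fun k => c k * h ^ k)%C (fun k => h ^ k * c k)%C)
             by (intros; ring).
           apply has_sum_Csum. intros k _. now apply has_sum_scal.
      * intros m Hm.
        rewrite (Csum_ext _ (fun k => a m * (binom_coef z m k * h ^ k))%C) by (intros; ring).
        rewrite Csum_scal, binom_coef_sum by auto. ring.
      * intros m Hm.
        rewrite (Csum_ext _ (fun k => a m * (binom_coef z m k * h ^ k))%C) by (intros; ring).
        rewrite Csum_scal. eapply Rle_trans; [apply Cmod_minus_le|].
        rewrite !Cmod_mult.
        replace (2 * M * q ^ m) with (M * q ^ m + M * q ^ m) by ring.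
        apply Rplus_le_compat; apply Hterm; (split; [apply Cmod_ge_0|]).
        -- rewrite Cmod_pow. apply pow_incr. split; [apply Cmod_ge_0|].
           eapply Rle_trans; [apply Cmod_triangle|lra].
        -- eapply Rle_trans; [apply Cmod_Csum|].
           eapply Rle_trans; [|apply (binom_coef_abs z eta m n); lra].
           apply Rsum_le; intros i _. rewrite Cmod_mult, Cmod_pow.
           apply Rmult_le_compat_l; [apply Cmod_ge_0|].
           apply pow_incr; split; [apply Cmod_ge_0|auto].
    + specialize (HN n Hn). rewrite Rabs_pos_eq in HN by (apply pow_le; lra).
      apply (Rmult_le_reg_r (1 - q)); [lra|].
      unfold Rdiv at 1; rewrite Rmult_assoc, Rinv_l, Rmult_1_r by lra.
      apply Rle_trans with ((2 * M + 1) * q ^ n).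
      * apply Rmult_le_compat_r; [apply pow_le; lra|lra].
      * replace (eps * (1 - q)) with ((2 * M + 1) * (eps * (1 - q) / (2 * M + 1)))
          by (field; lra).
        apply Rmult_le_compat_l; lra.
Qed.

Lemma PS_analytic_at a s z : bounded_at a s -> Cmod z < s -> analytic_at (PS a) z.
Proof.
  intros Ha Hz.
  destruct (PS_reexpand a s z ((s - Cmod z) / 2)) as (c & _ & _ & Hc); [auto|lra|lra|].
  exists c, ((s - Cmod z) / 2); split; [lra|]. intros w Hw.
  apply has_sum_is_pseries. replace (PS a w) with (PS a (z + (w - z))%C) by (f_equal; ring).
  apply Hc; lra.
Qed.

Lemma PS_quadratic c eta :
  bounded_at c eta -> 0 < eta -> exists M, 0 <= M /\
   forall h l, Cmod h <= eta / 2 -> has_sum (fun k => c k * h ^ k)%C l ->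
     Cmod (l - c 0%nat - c 1%nat * h)%C <= M * Cmod h ^ 2.
Proof.
  intros (M & HM & H) Heta. exists (2 * M / eta ^ 2).
  assert (0 < eta ^ 2) by (now apply pow_lt).
  split; [apply Rmult_le_pos; [lra|left; now apply Rinv_0_lt_compat]|].
  intros h l Hh Hl. pose proof (Cmod_ge_0 h) as Hh0.
  assert (Hq : 0 <= Cmod h / eta < 1) by (apply ratio_range with h; lra).
  apply Rle_trans with (M * (Cmod h / eta) ^ 2 / (1 - Cmod h / eta)).
  - apply has_sum_geom_bound with
      (fun k => c k * h ^ k - (if Nat.ltb k 2 then c k * h ^ k else RtoC 0))%C; auto.
    + replace (l - c 0%nat - c 1%nat * h)%C with
        (l - Csum (fun k => if Nat.ltb k 2 then c k * h ^ k else RtoC 0)%C 2)%C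
        by (simpl; ring).
      apply has_sum_minus; [auto|]. apply has_sum_finite.
      intros n Hn. destruct (Nat.ltb_spec n 2); [lia|auto].
    + intros n Hn. destruct (Nat.ltb_spec n 2); [ring|lia].
    + intros n Hn. destruct (Nat.ltb_spec n 2); [lia|].
      replace (c n * h ^ n - 0)%C with (c n * h ^ n)%C by ring.
      apply Cmod_term; [lra|auto|lra].
  - assert (Cmod h / eta <= / 2).
    { apply (Rmult_le_reg_r eta); [lra|]. unfold Rdiv; rewrite Rmult_assoc, Rinv_l; lra. }
    replace (2 * M / eta ^ 2 * Cmod h ^ 2) with (M * (Cmod h / eta) ^ 2 * 2) by (field; lra).
    unfold Rdiv at 1. apply Rmult_le_compat_l.
    + apply Rmult_le_pos; [auto|apply pow_le; lra].
    + rewrite <- (Rinv_inv 2). apply Rinv_le_contravar; lra.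
Qed.


(** * Complex derivatives *)

Lemma has_sum_shift u l : has_sum u l -> u 0%nat = RtoC 0 -> has_sum (fun n => u (S n)) l.
Proof.
  intros H H0 eps Heps. destruct (H eps Heps) as [N HN].
  exists N; intros n Hn. specialize (HN (1 + n)%nat ltac:(lia)).
  rewrite Csum_add in HN. simpl Csum in HN at 1. rewrite H0 in HN.
  replace (Csum (fun k => u (S k)) n) with (0 + 0 + Csum (fun k => u (S k)) n)%C by ring.
  exact HN.
Qed.

(** Each of the [n + 1] copies of [q ^ n] is at most a term of the geometric sum. *)
Lemma linear_geom_bound q n : 0 <= q < 1 -> INR (S n) * q ^ n <= / (1 - q).
Proof.
  intros Hq. eapply Rle_trans; [|apply (Rsum_geom q (S n) Hq)].
  rewrite <- Rsum_const. apply Rsum_le; intros i Hi.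
  replace n with (i + (n - i))%nat by lia. rewrite pow_add.
  rewrite <- (Rmult_1_r (q ^ i)) at 2. apply Rmult_le_compat_l; [now apply pow_le|].
  rewrite <- (pow1 (n - i)). apply pow_incr; lra.
Qed.

Lemma bounded_at_linear a s t :
  bounded_at a s -> 0 < t < s -> bounded_at (fun n => INR (S n) * a n)%C t.
Proof.
  intros (M & HM & H) Ht.
  assert (Hq : 0 <= t / s < 1).
  { split; [apply Rmult_le_pos; [lra|left; apply Rinv_0_lt_compat; lra]|].
    apply (Rmult_lt_reg_r s); [lra|]. unfold Rdiv; rewrite Rmult_assoc, Rinv_l; lra. }
  exists (M * / (1 - t / s)). split.
  { apply Rmult_le_pos; [auto|left; apply Rinv_0_lt_compat; lra]. }
  intros n. rewrite Cmod_mult, Cmod_R, Rabs_pos_eq by apply pos_INR.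
  assert (0 < s ^ n) by (apply pow_lt; lra).
  replace (INR (S n) * Cmod (a n) * t ^ n)
    with ((Cmod (a n) * s ^ n) * (INR (S n) * (t / s) ^ n)).
  2:{ unfold Rdiv. rewrite Rpow_mult_distr, pow_inv. field; lra. }
  apply Rmult_le_compat; [|apply Rmult_le_pos; [apply pos_INR|apply pow_le; lra]|auto|].
  - apply Rmult_le_pos; [apply Cmod_ge_0|lra].
  - now apply linear_geom_bound.
Qed.

Lemma bounded_at_shift a s : 0 < s -> bounded_at a s -> bounded_at (fun n => a (S n)) s.
Proof.
  intros Hs (M & HM & H). exists (M / s). split.
  { apply Rmult_le_pos; [auto|left; now apply Rinv_0_lt_compat]. }
  intros n. apply (Rmult_le_reg_r s); [auto|].
  replace (M / s * s) with M by (field; lra).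
  specialize (H (S n)). simpl in H. lra.
Qed.

Definition cderiv (f : C -> C) (z l : C) : Prop :=
  forall eps, 0 < eps -> exists eta, 0 < eta /\
    forall h, Cmod h < eta -> Cmod (f (z + h) - f z - l * h)%C <= eps * Cmod h.

Definition ccontinuous (f : C -> C) (z : C) : Prop :=
  forall eps, 0 < eps -> exists eta, 0 < eta /\
    forall h, Cmod h < eta -> Cmod (f (z + h) - f z)%C <= eps.

Lemma cderiv_ccontinuous f z l : cderiv f z l -> ccontinuous f z.
Proof.
  intros H eps Heps. destruct (H 1 Rlt_0_1) as (eta & Heta & Hf).
  pose proof (Cmod_ge_0 l) as Hl.
  assert (0 < eps / (Cmod l + 1)) by (apply Rdiv_lt_0_compat; lra).
  exists (Rmin eta (eps / (Cmod l + 1))). split; [now apply Rmin_pos|].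
  intros h Hh. pose proof (Rmin_l eta (eps / (Cmod l + 1))).
  pose proof (Rmin_r eta (eps / (Cmod l + 1))).
  specialize (Hf h ltac:(lra)).
  replace (f (z + h) - f z)%C with ((f (z + h) - f z - l * h) + l * h)%C by ring.
  eapply Rle_trans; [apply Cmod_triangle|]. rewrite Cmod_mult.
  apply Rle_trans with ((Cmod l + 1) * Cmod h); [lra|].
  apply Rle_trans with ((Cmod l + 1) * (eps / (Cmod l + 1))); [|right; field; lra].
  apply Rmult_le_compat_l; lra.
Qed.

Lemma cderiv_unique f z l l' : cderiv f z l -> cderiv f z l' -> l = l'.
Proof.
  intros H H'. apply Cmod_small_eq; intros eps Heps.
  destruct (H (eps / 2)) as (e1 & He1 & H1); [lra|].
  destruct (H' (eps / 2)) as (e2 & He2 & H2); [lra|].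
  pose proof (Rmin_pos e1 e2 He1 He2). pose proof (Rmin_l e1 e2). pose proof (Rmin_r e1 e2).
  set (h := RtoC (Rmin e1 e2 / 2)).
  assert (Eh : Cmod h = Rmin e1 e2 / 2) by (unfold h; rewrite Cmod_R, Rabs_pos_eq; lra).
  specialize (H1 h ltac:(lra)). specialize (H2 h ltac:(lra)).
  apply (Rmult_le_reg_r (Cmod h)); [lra|]. rewrite <- Cmod_mult.
  replace ((l - l') * h)%C with ((f (z + h) - f z - l' * h) - (f (z + h) - f z - l * h))%C by ring.
  eapply Rle_trans; [apply Cmod_minus_le|lra].
Qed.

Lemma PS_cderiv a s z :
  0 < s -> bounded_at a s -> Cmod z < s ->
  cderiv (PS a) z (PS (fun n => INR (S n) * a (S n))%C z).
Proof.
  intros Hs Ha Hz.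
  destruct (PS_reexpand a s z ((s - Cmod z) / 2)) as (c & Hc & Hcb & Hcs); [auto|lra|lra|].
  set (eta := (s - Cmod z) / 2) in *. assert (Heta : 0 < eta) by (unfold eta; lra).
  assert (E0 : c 0%nat = PS a z).
  { assert (H0 : has_sum (fun k => c k * 0 ^ k)%C (Csum (fun k => c k * 0 ^ k)%C 1)).
    { apply has_sum_finite. intros [|n] Hn; [lia|]. simpl; ring. }
    specialize (Hcs (RtoC 0) ltac:(rewrite Cmod_0; lra)).
    replace (z + 0)%C with z in Hcs by ring.
    rewrite (has_sum_unique _ _ _ Hcs H0). simpl; ring. }
  assert (E1 : c 1%nat = PS (fun n => INR (S n) * a (S n))%C z).
  { symmetry. apply PS_unique. specialize (Hc 1%nat).
    apply has_sum_shift in Hc; [|simpl; ring].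
    eapply has_sum_ext; [|exact Hc]. intros n; cbv beta. rewrite binom_coef_1. ring. }
  destruct (PS_quadratic c eta Hcb Heta) as (M & HM & HQ).
  intros eps Heps. exists (Rmin (eta / 2) (eps / (M + 1))).
  assert (0 < eps / (M + 1)) by (apply Rdiv_lt_0_compat; lra).
  split; [apply Rmin_pos; lra|]. intros h Hh.
  pose proof (Rmin_l (eta / 2) (eps / (M + 1))). pose proof (Rmin_r (eta / 2) (eps / (M + 1))).
  rewrite <- E0, <- E1. pose proof (Cmod_ge_0 h).
  eapply Rle_trans; [apply HQ; [lra|apply Hcs; lra]|].
  replace (M * Cmod h ^ 2) with (M * Cmod h * Cmod h) by ring.
  apply Rmult_le_compat_r; [auto|].
  apply Rle_trans with ((M + 1) * (eps / (M + 1))); [|right; field; lra].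
  apply Rmult_le_compat; lra.
Qed.

Lemma PS_ccontinuous a s z : 0 < s -> bounded_at a s -> Cmod z < s -> ccontinuous (PS a) z.
Proof. intros Hs Ha Hz. eapply cderiv_ccontinuous, PS_cderiv; eauto. Qed.

Lemma analytic_at_PS f z0 :
  analytic_at f z0 -> exists a s, 0 < s /\ bounded_at a s /\
    forall h, Cmod h < s -> f (z0 + h)%C = PS a h.
Proof.
  intros (a & rho & Hrho & H). exists a, (rho / 2).
  split; [lra|split].
  - set (h := RtoC (rho / 2)).
    assert (Eh : Cmod h = rho / 2) by (unfold h; rewrite Cmod_R, Rabs_pos_eq; lra).
    rewrite <- Eh.
    specialize (H (z0 + h)%C). replace (z0 + h - z0)%C with h in H by ring.
    eapply is_pseries_bounded_at, H. lra.
  - intros h Hh. specialize (H (z0 + h)%C).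
    replace (z0 + h - z0)%C with h in H by ring.
    symmetry. apply PS_unique, has_sum_is_pseries, H. lra.
Qed.

(** The derivative is continuous because near each point it is again a power series,
    the one with coefficients [(n + 1) * a (n + 1)]. *)
Lemma HD_derivative f :
  HD f -> exists D, forall z, disc z -> cderiv f z (D z) /\ ccontinuous D z.
Proof.
  intros Hf. unfold disc.
  assert (Hloc : forall z, disc z -> exists a s, 0 < s /\ bounded_at a s /\
    (forall h, Cmod h < s -> f (z + h)%C = PS a h) /\
    (forall h, Cmod h < s -> cderiv f (z + h) (PS (fun n => INR (S n) * a (S n))%C h))).
  { intros z Hz. destruct (analytic_at_PS f z (Hf z Hz)) as (a & s & Hs & Ha & E).
    exists a, s. repeat split; auto. intros h Hh eps Heps.
    destruct (PS_cderiv a s h Hs Ha Hh eps Heps) as (eta & Heta & H).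
    exists (Rmin eta (s - Cmod h)). split; [apply Rmin_pos; lra|].
    intros k Hk. pose proof (Rmin_l eta (s - Cmod h)). pose proof (Rmin_r eta (s - Cmod h)).
    replace (z + h + k)%C with (z + (h + k))%C by ring.
    rewrite !E; [apply H; lra|auto|]. eapply Rle_lt_trans; [apply Cmod_triangle|lra]. }
  set (D := fun z => epsilon (inhabits (RtoC 0)) (cderiv f z)).
  assert (HD' : forall z l, cderiv f z l -> D z = l).
  { intros z l H. apply (cderiv_unique f z); [|auto]. unfold D. apply epsilon_spec. eauto. }
  exists D. intros z Hz. destruct (Hloc z Hz) as (a & s & Hs & Ha & E & H).
  assert (H0 := H (RtoC 0) ltac:(rewrite Cmod_0; lra)).
  replace (z + 0)%C with z in H0 by ring.
  split; [rewrite (HD' _ _ H0); auto|].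
  intros eps Heps.
  assert (Ha' : bounded_at (fun n => INR (S n) * a (S n))%C (s / 2)).
  { apply (bounded_at_linear (fun n => a (S n)) s); [now apply bounded_at_shift|lra]. }
  destruct (PS_ccontinuous _ (s / 2) (RtoC 0) ltac:(lra) Ha'
    ltac:(rewrite Cmod_0; lra) eps Heps) as (eta & Heta & Hc).
  exists (Rmin eta s). split; [now apply Rmin_pos|]. intros h Hh.
  pose proof (Rmin_l eta s). pose proof (Rmin_r eta s).
  rewrite (HD' _ _ H0), (HD' _ _ (H h ltac:(lra))).
  specialize (Hc h ltac:(lra)). replace (0 + h)%C with h in Hc by ring. exact Hc.
Qed.

(** ** Derivatives along curves *)

(** The chain rule is proved for complex velocities; real and imaginary parts are taken
    at the very end. *)
Definition curve_deriv (g : R -> C) (t : R) (v : C) : Prop :=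
  forall eps, 0 < eps -> exists eta, 0 < eta /\
    forall h, Rabs h < eta -> Cmod (g (t + h)%R - g t - v * h)%C <= eps * Rabs h.

Lemma is_derive_eps (g : R -> R) t l :
  is_derive g t l <->
  forall eps, 0 < eps -> exists eta, 0 < eta /\
    forall h, Rabs h < eta -> Rabs (g (t + h) - g t - l * h) <= eps * Rabs h.
Proof.
  rewrite is_derive_Reals. split; intros H eps Heps.
  - destruct (H eps Heps) as [[eta He] Hd]. exists eta; split; [auto|]. intros h Hh.
    destruct (Req_dec h 0) as [->|Hh0].
    + rewrite Rplus_0_r, Rabs_R0. replace (g t - g t - l * 0) with 0 by ring.
      rewrite Rabs_R0; lra.
    + specialize (Hd h Hh0 Hh).
      replace (g (t + h) - g t - l * h) with (((g (t + h) - g t) / h - l) * h) by (field; auto).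
      rewrite Rabs_mult. apply Rmult_le_compat_r; [apply Rabs_pos|lra].
  - destruct (H (eps / 2)) as (eta & He & Hd); [lra|]. exists (mkposreal eta He).
    intros h Hh0 Hh. specialize (Hd h Hh).
    assert (0 < Rabs h) by (now apply Rabs_pos_lt).
    apply Rle_lt_trans with (eps / 2); [|lra].
    apply (Rmult_le_reg_r (Rabs h)); [auto|]. rewrite <- Rabs_mult.
    replace (((g (t + h) - g t) / h - l) * h) with (g (t + h) - g t - l * h) by (field; auto).
    auto.
Qed.

Lemma im_le_Cmod (c : C) : Rabs (Im c) <= Cmod c.
Proof. eapply Rle_trans; [apply Rmax_r|apply Rmax_Cmod]. Qed.

Lemma Cmod_le_parts (c : C) : Cmod c <= Rabs (Re c) + Rabs (Im c).
Proof.
  replace c with (RtoC (Re c) + RtoC (Im c) * Ci)%C at 1.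
  - eapply Rle_trans; [apply Cmod_triangle|]. rewrite Cmod_mult, Cmod_Ci, !Cmod_R. lra.
  - destruct c as [x y]. unfold Ci, RtoC, Cmult, Cplus; simpl. f_equal; ring.
Qed.

Lemma curve_deriv_Re g t v : curve_deriv g t v -> is_derive (fun x => Re (g x)) t (Re v).
Proof.
  intros H. apply is_derive_eps. intros eps Heps.
  destruct (H eps Heps) as (eta & He & Hd). exists eta; split; [auto|]. intros h Hh.
  eapply Rle_trans; [|apply Hd, Hh]. eapply Rle_trans; [|apply re_le_Cmod].
  right; f_equal. unfold Re, Im, Cminus, Cplus, Copp, Cmult, RtoC; simpl. ring.
Qed.

Lemma curve_deriv_Im g t v : curve_deriv g t v -> is_derive (fun x => Im (g x)) t (Im v).
Proof.
  intros H. apply is_derive_eps. intros eps Heps.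
  destruct (H eps Heps) as (eta & He & Hd). exists eta; split; [auto|]. intros h Hh.
  eapply Rle_trans; [|apply Hd, Hh]. eapply Rle_trans; [|apply im_le_Cmod].
  right; f_equal. unfold Re, Im, Cminus, Cplus, Copp, Cmult, RtoC; simpl. ring.
Qed.

Lemma curve_deriv_parts g t v :
  is_derive (fun x => Re (g x)) t (Re v) -> is_derive (fun x => Im (g x)) t (Im v) ->
  curve_deriv g t v.
Proof.
  rewrite !is_derive_eps. intros H H' eps Heps.
  destruct (H (eps / 2)) as (e1 & He1 & H1); [lra|].
  destruct (H' (eps / 2)) as (e2 & He2 & H2); [lra|].
  exists (Rmin e1 e2). split; [now apply Rmin_pos|]. intros h Hh.
  pose proof (Rmin_l e1 e2). pose proof (Rmin_r e1 e2).
  specialize (H1 h ltac:(lra)). specialize (H2 h ltac:(lra)).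
  eapply Rle_trans; [apply Cmod_le_parts|].
  replace (Re (g (t + h)%R - g t - v * h)%C) with (Re (g (t + h)) - Re (g t) - Re v * h)
    by (unfold Re, Im, Cminus, Cplus, Copp, Cmult, RtoC; simpl; ring).
  replace (Im (g (t + h)%R - g t - v * h)%C) with (Im (g (t + h)) - Im (g t) - Im v * h)
    by (unfold Re, Im, Cminus, Cplus, Copp, Cmult, RtoC; simpl; ring).
  lra.
Qed.

Lemma curve_deriv_comp f g t v l :
  curve_deriv g t v -> cderiv f (g t) l -> curve_deriv (fun x => f (g x)) t (l * v)%C.
Proof.
  intros Hg Hf eps Heps.
  pose proof (Cmod_ge_0 l) as Hl. pose proof (Cmod_ge_0 v) as Hv.
  set (e1 := eps / (2 * (Cmod v + 1))). set (e2 := Rmin 1 (eps / (2 * (Cmod l + 1)))).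
  assert (He1 : 0 < e1) by (apply Rdiv_lt_0_compat; lra).
  assert (He2' : 0 < eps / (2 * (Cmod l + 1))) by (apply Rdiv_lt_0_compat; lra).
  assert (He2 : 0 < e2) by (apply Rmin_pos; lra).
  destruct (Hf e1 He1) as (d1 & Hd1 & H1). destruct (Hg e2 He2) as (d2 & Hd2 & H2).
  assert (Hd3 : 0 < d1 / (Cmod v + 1)) by (apply Rdiv_lt_0_compat; lra).
  exists (Rmin d2 (d1 / (Cmod v + 1))). split; [now apply Rmin_pos|]. intros h Hh.
  pose proof (Rmin_l d2 (d1 / (Cmod v + 1))). pose proof (Rmin_r d2 (d1 / (Cmod v + 1))).
  specialize (H2 h ltac:(lra)). set (k := (g (t + h)%R - g t)%C) in *.
  pose proof (Rabs_pos h) as Hh0.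
  assert (Hk : Cmod k <= (Cmod v + 1) * Rabs h).
  { replace k with ((k - v * h) + v * h)%C by ring.
    eapply Rle_trans; [apply Cmod_triangle|]. rewrite Cmod_mult, Cmod_R.
    assert (e2 * Rabs h <= 1 * Rabs h) by (apply Rmult_le_compat_r; [auto|apply Rmin_l]). lra. }
  assert (Hk1 : Cmod k < d1).
  { eapply Rle_lt_trans; [exact Hk|].
    apply Rlt_le_trans with ((Cmod v + 1) * (d1 / (Cmod v + 1))); [|right; field; lra].
    apply Rmult_lt_compat_l; lra. }
  specialize (H1 k Hk1). replace (g t + k)%C with (g (t + h)) in H1 by (unfold k; ring).
  replace (f (g (t + h)%R) - f (g t) - l * v * h)%C with
    ((f (g (t + h)%R) - f (g t) - l * k) + l * (k - v * h))%C by ring.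
  eapply Rle_trans; [apply Cmod_triangle|]. rewrite Cmod_mult.
  assert (A1 : e1 * Cmod k <= eps / 2 * Rabs h).
  { apply Rle_trans with (e1 * ((Cmod v + 1) * Rabs h)).
    - apply Rmult_le_compat_l; lra.
    - right. unfold e1. field. lra. }
  assert (A2 : Cmod l * Cmod (k - v * h)%C <= eps / 2 * Rabs h).
  { apply Rle_trans with ((Cmod l + 1) * (eps / (2 * (Cmod l + 1)) * Rabs h)).
    - apply Rmult_le_compat; [lra|apply Cmod_ge_0|lra|].
      eapply Rle_trans; [exact H2|]. apply Rmult_le_compat_r; [auto|apply Rmin_r].
    - right. field. lra. }
  lra.
Qed.

(** * Integrals of complex functions of the angle *)

Definition ccont (F : R -> C) : Prop :=
  forall t, continuous (fun x => Re (F x)) t /\ continuous (fun x => Im (F x)) t.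

Definition CInt (F : R -> C) : C :=
  (RInt (fun t => Re (F t)) 0 (2 * PI), RInt (fun t => Im (F t)) 0 (2 * PI)).

Lemma ccont_const c : ccont (fun _ => c).
Proof. split; apply continuous_const. Qed.

Lemma ccont_plus F G : ccont F -> ccont G -> ccont (fun t => F t + G t)%C.
Proof.
  intros HF HG t. destruct (HF t), (HG t).
  split; simpl; apply (continuous_plus (V := R_NormedModule)); auto.
Qed.

Lemma ccont_mult F G : ccont F -> ccont G -> ccont (fun t => F t * G t)%C.
Proof.
  intros HF HG t. destruct (HF t), (HG t).
  split; simpl.
  - apply (continuous_minus (V := R_NormedModule));
      apply (continuous_mult (K := R_AbsRing)); auto.
  - apply (continuous_plus (V := R_NormedModule));
      apply (continuous_mult (K := R_AbsRing)); auto.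
Qed.

Lemma ccont_inv F : ccont F -> (forall t, F t <> RtoC 0) -> ccont (fun t => / F t)%C.
Proof.
  intros HF H0 t. destruct (HF t) as [H1 H2].
  assert (Hn : Re (F t) ^ 2 + Im (F t) ^ 2 <> 0).
  { rewrite <- Cmod2_alt. intros E. apply (H0 t), Cmod_eq_0.
    now apply Rsqr_0_uniq; rewrite Rsqr_pow2. }
  assert (Hd : continuous (fun x => / (Re (F x) ^ 2 + Im (F x) ^ 2)) t).
  { apply continuous_Rinv_comp; [|auto].
    apply (continuous_plus (V := R_NormedModule)); simpl;
      apply (continuous_mult (K := R_AbsRing)); auto;
      apply (continuous_mult (K := R_AbsRing)); auto; apply continuous_const. }
  split; simpl; unfold Rdiv; apply (continuous_mult (K := R_AbsRing)); auto.
  now apply (continuous_opp (V := R_NormedModule)).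
Qed.

Lemma ccont_Csum (F : nat -> R -> C) n :
  (forall k, ccont (F k)) -> ccont (fun t => Csum (fun k => F k t) n).
Proof.
  intros H. induction n as [|n IH]; simpl; [apply ccont_const|now apply ccont_plus].
Qed.

Lemma ccont_Cmod F : ccont F -> forall t, continuous (fun x => Cmod (F x)) t.
Proof.
  intros HF t. destruct (HF t) as [H1 H2]. unfold Cmod. apply continuous_sqrt_comp.
  apply (continuous_plus (V := R_NormedModule)); simpl;
    apply (continuous_mult (K := R_AbsRing)); auto;
    apply (continuous_mult (K := R_AbsRing)); auto; apply continuous_const.
Qed.

Lemma ex_RInt_cont (g : R -> R) a b : (forall t, continuous g t) -> ex_RInt g a b.
Proof. intros H. apply (ex_RInt_continuous (V := R_CompleteNormedModule)); auto. Qed.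

Lemma CInt_ext F G : (forall t, F t = G t) -> CInt F = CInt G.
Proof. intros H. now rewrite (functional_extensionality F G H). Qed.

Lemma CInt_plus F G :
  ccont F -> ccont G -> CInt (fun t => F t + G t)%C = (CInt F + CInt G)%C.
Proof.
  intros HF HG. unfold CInt, Cplus; simpl. f_equal;
    apply (RInt_plus (V := R_CompleteNormedModule)); apply ex_RInt_cont; intros t;
    first [exact (proj1 (HF t)) | exact (proj1 (HG t))
          | exact (proj2 (HF t)) | exact (proj2 (HG t))].
Qed.

Lemma CInt_scal c F : ccont F -> CInt (fun t => c * F t)%C = (c * CInt F)%C.
Proof.
  intros HF. unfold CInt, Cmult; simpl.
  assert (H1 : ex_RInt (fun t => Re (F t)) 0 (2 * PI)) by (apply ex_RInt_cont; apply HF).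
  assert (H2 : ex_RInt (fun t => Im (F t)) 0 (2 * PI)) by (apply ex_RInt_cont; apply HF).
  assert (H3 : forall k, RInt (fun t => k * Re (F t)) 0 (2 * PI)
                         = k * RInt (fun t => Re (F t)) 0 (2 * PI))
    by (intros k; now apply (RInt_scal (V := R_CompleteNormedModule))).
  assert (H4 : forall k, RInt (fun t => k * Im (F t)) 0 (2 * PI)
                         = k * RInt (fun t => Im (F t)) 0 (2 * PI))
    by (intros k; now apply (RInt_scal (V := R_CompleteNormedModule))).
  rewrite <- !H3, <- !H4. f_equal.
  - apply (RInt_minus (V := R_CompleteNormedModule));
      now apply (ex_RInt_scal (V := R_CompleteNormedModule)).
  - apply (RInt_plus (V := R_CompleteNormedModule));
      now apply (ex_RInt_scal (V := R_CompleteNormedModule)).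
Qed.

Lemma CInt_Csum (F : nat -> R -> C) n :
  (forall k, ccont (F k)) ->
  CInt (fun t => Csum (fun k => F k t) n) = Csum (fun k => CInt (F k)) n.
Proof.
  intros H. induction n as [|n IH]; simpl.
  - unfold CInt; simpl. rewrite !RInt_const.
    unfold RtoC; f_equal; apply Rmult_0_r.
  - rewrite CInt_plus, IH by (auto using ccont_Csum). reflexivity.
Qed.

Lemma RInt_abs_bound (g : R -> R) B :
  (forall t, continuous g t) -> (forall t, 0 <= t <= 2 * PI -> Rabs (g t) <= B) ->
  Rabs (RInt g 0 (2 * PI)) <= 2 * PI * B.
Proof.
  intros Hg HB. pose proof PI_RGT_0.
  eapply Rle_trans; [apply (abs_RInt_le_const g 0 (2 * PI) B)|].
  - lra.
  - now apply ex_RInt_cont.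
  - auto.
  - lra.
Qed.

(** The constant is twice the optimal one: real and imaginary parts are bounded
    separately. *)
Lemma CInt_bound F B :
  ccont F -> (forall t, 0 <= t <= 2 * PI -> Cmod (F t) <= B) -> Cmod (CInt F) <= 4 * PI * B.
Proof.
  intros HF HB. eapply Rle_trans; [apply Cmod_le_parts|]. unfold CInt; simpl.
  pose proof (RInt_abs_bound (fun t => Re (F t)) B (fun t => proj1 (HF t))
    (fun t Ht => Rle_trans _ _ _ (re_le_Cmod _) (HB t Ht))).
  pose proof (RInt_abs_bound (fun t => Im (F t)) B (fun t => proj2 (HF t))
    (fun t Ht => Rle_trans _ _ _ (im_le_Cmod _) (HB t Ht))).
  lra.
Qed.


(** * Cauchy's formula and polynomial approximation *)

Lemma Cmod_circle_point r t : 0 <= r -> Cmod (circle_point r t) = r.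
Proof.
  intros Hr. unfold Cmod, circle_point; simpl.
  replace (r * cos t * (r * cos t * 1) + r * sin t * (r * sin t * 1))
    with (r * r * ((sin t) * (sin t) + (cos t) * (cos t))) by ring.
  pose proof (sin2_cos2 t) as E. unfold Rsqr in E. rewrite E, Rmult_1_r.
  now apply sqrt_square.
Qed.

Lemma circle_point_mult r t s u :
  (circle_point r t * circle_point s u)%C = circle_point (r * s) (t + u).
Proof.
  unfold circle_point, Cmult; simpl. rewrite cos_plus, sin_plus. f_equal; ring.
Qed.

Lemma circle_point_0 r : circle_point r 0 = RtoC r.
Proof. unfold circle_point, RtoC. rewrite cos_0, sin_0. f_equal; ring. Qed.

Lemma circle_point_pow r t n : (circle_point r t ^ n)%C = circle_point (r ^ n) (INR n * t).
Proof.
  induction n as [|n IH].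
  - simpl. rewrite Rmult_0_l, circle_point_0. reflexivity.
  - rewrite S_INR. simpl Cpow. rewrite IH, circle_point_mult. simpl. f_equal. ring.
Qed.

Lemma circle_point_deriv r t : curve_deriv (circle_point r) t (Ci * circle_point r t)%C.
Proof.
  apply curve_deriv_parts; unfold circle_point; simpl; auto_derive; auto; ring.
Qed.

Lemma HD_circle_ccont f r : HD f -> 0 < r < 1 -> ccont (fun t => f (circle_point r t)).
Proof.
  intros Hf Hr. destruct (HD_derivative f Hf) as [D HD']. intros t.
  assert (Hd : disc (circle_point r t)) by (unfold disc; rewrite Cmod_circle_point; lra).
  pose proof (curve_deriv_comp f _ t _ _ (circle_point_deriv r t) (proj1 (HD' _ Hd))) as Hc.
  split; apply (@ex_derive_continuous R_AbsRing R_NormedModule).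
  - eexists. apply (curve_deriv_Re _ _ _ Hc).
  - eexists. apply (curve_deriv_Im _ _ _ Hc).
Qed.

Lemma ccont_circle_comp r k : ccont (fun t => circle_point r (k * t)).
Proof.
  intros t; split; simpl; apply (@ex_derive_continuous R_AbsRing R_NormedModule);
    auto_derive; auto.
Qed.

Lemma ccont_circle r : ccont (circle_point r).
Proof.
  intros t; split; simpl; apply (@ex_derive_continuous R_AbsRing R_NormedModule);
    auto_derive; auto.
Qed.

Lemma sin_INR_2PI n : sin (INR n * (2 * PI)) = 0.
Proof.
  induction n as [|n IH]; [simpl; rewrite Rmult_0_l; apply sin_0|].
  rewrite S_INR, Rmult_plus_distr_r, Rmult_1_l. rewrite sin_plus, sin_2PI, cos_2PI, IH; ring.
Qed.

Lemma cos_INR_2PI n : cos (INR n * (2 * PI)) = 1.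
Proof.
  induction n as [|n IH]; [simpl; rewrite Rmult_0_l; apply cos_0|].
  rewrite S_INR, Rmult_plus_distr_r, Rmult_1_l, cos_plus, sin_2PI, cos_2PI, IH; ring.
Qed.

Lemma RInt_cos_INR n : (0 < n)%nat -> is_RInt (fun t => cos (INR n * t)) 0 (2 * PI) 0.
Proof.
  intros Hn. assert (0 < INR n) by (now apply lt_0_INR).
  replace 0 with (minus (sin (INR n * (2 * PI)) / INR n) (sin (INR n * 0) / INR n)) at 2.
  - apply (is_RInt_derive (fun t => sin (INR n * t) / INR n)).
    + intros x _. auto_derive; [auto|field; lra].
    + intros x _. apply (@ex_derive_continuous R_AbsRing R_NormedModule). auto_derive; auto.
  - unfold minus, plus, opp; simpl. rewrite sin_INR_2PI, Rmult_0_r, sin_0. field; lra.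
Qed.

Lemma RInt_sin_INR n : (0 < n)%nat -> is_RInt (fun t => sin (INR n * t)) 0 (2 * PI) 0.
Proof.
  intros Hn. assert (0 < INR n) by (now apply lt_0_INR).
  replace 0 with (minus (- cos (INR n * (2 * PI)) / INR n) (- cos (INR n * 0) / INR n)) at 2.
  - apply (is_RInt_derive (fun t => - cos (INR n * t) / INR n)).
    + intros x _. auto_derive; [auto|field; lra].
    + intros x _. apply (@ex_derive_continuous R_AbsRing R_NormedModule). auto_derive; auto.
  - unfold minus, plus, opp; simpl. rewrite cos_INR_2PI, Rmult_0_r, cos_0. field; lra.
Qed.

Lemma CInt_circle_neg s n :
  (0 < n)%nat -> CInt (fun t => circle_point s (- INR n * t)) = RtoC 0.
Proof.
  intros Hn. unfold CInt, circle_point, RtoC; simpl. f_equal; apply is_RInt_unique.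
  - apply is_RInt_ext with (fun t => scal s (cos (INR n * t))).
    + intros x _. change (s * cos (INR n * x) = s * cos (- INR n * x)).
      replace (- INR n * x) with (- (INR n * x)) by ring. rewrite cos_neg. reflexivity.
    + replace 0 with (scal s 0) at 2 by (unfold scal; simpl; unfold mult; simpl; ring).
      apply (is_RInt_scal (V := R_NormedModule)). now apply RInt_cos_INR.
  - apply is_RInt_ext with (fun t => scal (- s) (sin (INR n * t))).
    + intros x _. change (- s * sin (INR n * x) = s * sin (- INR n * x)).
      replace (- INR n * x) with (- (INR n * x)) by ring. rewrite sin_neg. ring.
    + replace 0 with (scal (- s) 0) at 2 by (unfold scal; simpl; unfold mult; simpl; ring).
      apply (is_RInt_scal (V := R_NormedModule)). now apply RInt_sin_INR.
Qed.

(** ** The homotopy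

    For [w] inside the circle of radius [r], the integral over the circle of
    [f (w + l * (zeta - w)) * kappa], with the Cauchy kernel
    [kappa = zeta / (zeta - w)], is independent of [l] in [[0, 1]].  At [l = 1] it
    is the Cauchy integral of [f]; at [l = 0] it is [f w] times the integral of
    [kappa].  The parameter may run slightly outside [[0, 1]], where the points
    [gam l t] still lie in the disc, so that two-sided derivatives make sense at the
    ends. *)

Section Cauchy.

Variables (f D : C -> C) (r : R) (w : C).
Hypothesis HD0 : forall z, disc z -> cderiv f z (D z) /\ ccontinuous D z.
Hypothesis Hr : 0 < r < 1.
Hypothesis Hw : Cmod w < r.

Let zeta (t : R) : C := circle_point r t.
Let kappa (t : R) : C := (zeta t / (zeta t - w))%C.
Let gam (l t : R) : C := (w + l * (zeta t - w))%C.

Lemma zeta_mod t : Cmod (zeta t) = r.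
Proof. apply Cmod_circle_point; lra. Qed.

Lemma zeta_minus_lower t : r - Cmod w <= Cmod (zeta t - w)%C.
Proof.
  pose proof (Cmod_triangle (zeta t - w)%C w) as T.
  replace (zeta t - w + w)%C with (zeta t) in T by ring. rewrite zeta_mod in T. lra.
Qed.

Lemma zeta_minus_neq t : (zeta t - w)%C <> RtoC 0.
Proof. intros E. pose proof (zeta_minus_lower t) as L. rewrite E, Cmod_0 in L. lra. Qed.

Lemma zeta_minus_upper t : Cmod (zeta t - w)%C <= 2.
Proof. eapply Rle_trans; [apply Cmod_minus_le|]. rewrite zeta_mod. lra. Qed.

Lemma kappa_bound t : Cmod (kappa t) <= r / (r - Cmod w).
Proof.
  unfold kappa. rewrite Cmod_div by apply zeta_minus_neq. rewrite zeta_mod.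
  apply Rmult_le_compat_l; [lra|]. apply Rinv_le_contravar; [lra|apply zeta_minus_lower].
Qed.

Lemma kappa_ccont : ccont kappa.
Proof.
  unfold kappa, Cdiv. apply ccont_mult; [apply ccont_circle|].
  apply ccont_inv; [|apply zeta_minus_neq].
  unfold Cminus. apply ccont_plus; [apply ccont_circle|apply ccont_const].
Qed.

Lemma gam_disc l t : - ((1 - r) / 4) < l < 1 + (1 - r) / 4 -> disc (gam l t).
Proof.
  intros Hl. unfold disc, gam. pose proof (Cmod_ge_0 w).
  assert (Hin : forall m, 0 <= m <= 1 -> Cmod (w + m * (zeta t - w))%C <= r).
  { intros m Hm. replace (w + m * (zeta t - w))%C with ((1 - m)%R * w + m * zeta t)%C
      by (rewrite RtoC_minus; ring).
    eapply Rle_trans; [apply Cmod_triangle|].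
    rewrite !Cmod_mult, !Cmod_R, zeta_mod, !Rabs_pos_eq by lra.
    assert ((1 - m) * Cmod w <= (1 - m) * r) by (apply Rmult_le_compat_l; lra). lra. }
  set (m := Rmax 0 (Rmin 1 l)).
  assert (Hm : 0 <= m <= 1 /\ Rabs (l - m) < (1 - r) / 4).
  { unfold m, Rmax, Rmin. repeat destruct Rle_dec; split; try lra;
      apply Rabs_def1; lra. }
  replace (w + l * (zeta t - w))%C with
    ((w + m * (zeta t - w)) + (l - m)%R * (zeta t - w))%C by (rewrite RtoC_minus; ring).
  eapply Rle_lt_trans; [apply Cmod_triangle|]. rewrite Cmod_mult, Cmod_R.
  pose proof (Hin m (proj1 Hm)). pose proof (zeta_minus_upper t).
  pose proof (Cmod_ge_0 (zeta t - w)%C). pose proof (Rabs_pos (l - m)). nra.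
Qed.

Lemma homotopy_deriv_l l t :
  - ((1 - r) / 4) < l < 1 + (1 - r) / 4 ->
  curve_deriv (fun x => f (gam x t) * kappa t)%C l (D (gam l t) * zeta t)%C.
Proof.
  intros Hl.
  assert (H1 : curve_deriv (fun x => gam x t) l (zeta t - w)%C).
  { intros eps Heps. exists 1; split; [lra|]. intros h _. unfold gam.
    rewrite RtoC_plus.
    replace (w + (l + h) * (zeta t - w) - (w + l * (zeta t - w)) - (zeta t - w) * h)%C
      with (RtoC 0) by ring.
    rewrite Cmod_0. apply Rmult_le_pos; [lra|apply Rabs_pos]. }
  pose proof (curve_deriv_comp f _ l _ _ H1 (proj1 (HD0 _ (gam_disc l t Hl)))) as H2.
  assert (H3 : cderiv (fun z => z * kappa t)%C (f (gam l t)) (kappa t)).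
  { intros eps Heps. exists 1; split; [lra|]. intros h _.
    replace ((f (gam l t) + h) * kappa t - f (gam l t) * kappa t - kappa t * h)%C
      with (RtoC 0) by ring.
    rewrite Cmod_0. apply Rmult_le_pos; [lra|apply Cmod_ge_0]. }
  pose proof (curve_deriv_comp _ _ l _ _ H2 H3) as H4. simpl in H4.
  replace (D (gam l t) * zeta t)%C with (kappa t * (D (gam l t) * (zeta t - w)))%C; [exact H4|].
  unfold kappa. field. apply zeta_minus_neq.
Qed.

Lemma homotopy_deriv_t l t :
  - ((1 - r) / 4) < l < 1 + (1 - r) / 4 ->
  curve_deriv (fun x => f (gam l x)) t (l * Ci * (D (gam l t) * zeta t))%C.
Proof.
  intros Hl.
  assert (H3 : cderiv (fun z => w + l * (z - w))%C (zeta t) l).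
  { intros eps Heps. exists 1; split; [lra|]. intros h _.
    replace (w + l * (zeta t + h - w) - (w + l * (zeta t - w)) - l * h)%C
      with (RtoC 0) by ring.
    rewrite Cmod_0. apply Rmult_le_pos; [lra|apply Cmod_ge_0]. }
  pose proof (curve_deriv_comp _ _ t _ _ (circle_point_deriv r t) H3) as H4.
  pose proof (curve_deriv_comp f _ t _ _ H4 (proj1 (HD0 _ (gam_disc l t Hl)))) as H5.
  replace (l * Ci * (D (gam l t) * zeta t))%C with (D (gam l t) * (l * (Ci * zeta t)))%C by ring.
  exact H5.
Qed.

Lemma Dzeta_continuity l t :
  - ((1 - r) / 4) < l < 1 + (1 - r) / 4 ->
  forall eps, 0 < eps -> exists eta, 0 < eta /\ forall u v,
    Rabs (u - l) < eta -> Rabs (v - t) < eta ->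
    Cmod (D (gam u v) * zeta v - D (gam l t) * zeta t)%C <= eps.
Proof.
  intros Hl eps Heps.
  destruct (proj2 (HD0 _ (gam_disc l t Hl)) (eps / 2)) as (e1 & He1 & H1); [lra|].
  set (d := Cmod (D (gam l t))). assert (Hd : 0 <= d) by apply Cmod_ge_0.
  assert (Hz : forall v, Cmod (zeta v - zeta t)%C <= 2 * Rabs (v - t)).
  { intros v. eapply Rle_trans; [apply Cmod_le_parts|].
    unfold zeta, circle_point; simpl.
    assert (Hc : forall g g' : R -> R, (forall x, is_derive g x (g' x)) ->
       (forall x, Rabs (g' x) <= 1) -> Rabs (r * g v + - (r * g t)) <= Rabs (v - t)).
    { intros g g' Hg Hg'. replace (r * g v + - (r * g t)) with (r * (g v - g t)) by ring.
      destruct (MVT_gen g t v g') as (c & _ & E).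
      - intros x _; apply Hg.
      - intros x _. apply derivable_continuous_pt. exists (g' x).
        now apply is_derive_Reals.
      - rewrite E, !Rabs_mult. rewrite (Rabs_pos_eq r) by lra.
        pose proof (Hg' c). pose proof (Rabs_pos (g' c)). pose proof (Rabs_pos (v - t)).
        assert (r * Rabs (g' c) <= 1 * 1) by (apply Rmult_le_compat; lra).
        rewrite <- Rmult_assoc, <- (Rmult_1_l (Rabs (v - t))) at 1.
        rewrite Rmult_1_l. rewrite <- (Rmult_1_l (Rabs (v - t))) at 2.
        apply Rmult_le_compat_r; lra. }
    assert (A : Rabs (r * cos v + - (r * cos t)) <= Rabs (v - t)).
    { apply (Hc cos (fun x => - sin x)).
      - intros x. auto_derive; auto; ring.
      - intros x. rewrite Rabs_Ropp. apply Rabs_le. pose proof (SIN_bound x). lra. }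
    assert (B : Rabs (r * sin v + - (r * sin t)) <= Rabs (v - t)).
    { apply (Hc sin cos).
      - intros x. auto_derive; auto; ring.
      - intros x. apply Rabs_le. pose proof (COS_bound x). lra. }
    lra. }
  set (eta := Rmin (Rmin 1 (e1 / 7)) (eps / (4 * (d + 1)))).
  assert (Hp : 0 < eps / (4 * (d + 1))) by (apply Rdiv_lt_0_compat; lra).
  assert (Heta : 0 < eta) by (unfold eta; repeat apply Rmin_pos; lra).
  assert (M1 : eta <= 1 /\ eta <= e1 / 7 /\ eta <= eps / (4 * (d + 1))).
  { unfold eta. pose proof (Rmin_l (Rmin 1 (e1 / 7)) (eps / (4 * (d + 1)))).
    pose proof (Rmin_r (Rmin 1 (e1 / 7)) (eps / (4 * (d + 1)))).
    pose proof (Rmin_l 1 (e1 / 7)). pose proof (Rmin_r 1 (e1 / 7)). lra. }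
  exists eta; split; [auto|]. intros u v Hu Hv.
  assert (Hg : Cmod (gam u v - gam l t)%C < e1).
  { replace (gam u v - gam l t)%C with
      ((u - l)%R * (zeta v - w) + l * (zeta v - zeta t))%C
      by (unfold gam; rewrite RtoC_minus; ring).
    eapply Rle_lt_trans; [apply Cmod_triangle|]. rewrite !Cmod_mult, !Cmod_R.
    pose proof (zeta_minus_upper v). specialize (Hz v).
    assert (Rabs l <= 2) by (apply Rabs_le; lra).
    pose proof (Cmod_ge_0 (zeta v - w)%C). pose proof (Cmod_ge_0 (zeta v - zeta t)%C).
    pose proof (Rabs_pos (u - l)). pose proof (Rabs_pos (v - t)). pose proof (Rabs_pos l).
    assert (Rabs (u - l) * Cmod (zeta v - w)%C <= Rabs (u - l) * 2)
      by (apply Rmult_le_compat_l; auto).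
    assert (Rabs l * Cmod (zeta v - zeta t)%C <= 2 * (2 * Rabs (v - t)))
      by (apply Rmult_le_compat; auto).
    lra. }
  specialize (H1 _ Hg). replace (gam l t + (gam u v - gam l t))%C with (gam u v) in H1 by ring.
  replace (D (gam u v) * zeta v - D (gam l t) * zeta t)%C with
    ((D (gam u v) - D (gam l t)) * zeta v + D (gam l t) * (zeta v - zeta t))%C by ring.
  eapply Rle_trans; [apply Cmod_triangle|]. rewrite !Cmod_mult, zeta_mod. fold d.
  pose proof (Cmod_ge_0 (D (gam u v) - D (gam l t))%C).
  assert (Cmod (D (gam u v) - D (gam l t))%C * r <= eps / 2) by nra.
  assert (d * Cmod (zeta v - zeta t)%C <= eps / 2).
  { apply Rle_trans with ((d + 1) * (2 * (eps / (4 * (d + 1))))); [|right; field; lra].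
    apply Rmult_le_compat; [auto|apply Cmod_ge_0|lra|].
    specialize (Hz v). lra. }
  lra.
Qed.

Lemma homotopy_ccont l :
  - ((1 - r) / 4) < l < 1 + (1 - r) / 4 -> ccont (fun t => f (gam l t)).
Proof.
  intros Hl t. split; apply (@ex_derive_continuous R_AbsRing R_NormedModule).
  - eexists. apply curve_deriv_Re, homotopy_deriv_t, Hl.
  - eexists. apply curve_deriv_Im, homotopy_deriv_t, Hl.
Qed.

Lemma Dzeta_ccont l :
  - ((1 - r) / 4) < l < 1 + (1 - r) / 4 -> ccont (fun t => D (gam l t) * zeta t)%C.
Proof.
  intros Hl t.
  split; apply continuity_pt_filterlim, continuity_pt_locally; intros eps;
    destruct (Dzeta_continuity l t Hl (eps / 2)) as (eta & Heta & H);
    try (destruct eps; simpl; lra); exists (mkposreal eta Heta); intros v Hv;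
    specialize (H l v ltac:(rewrite Rminus_diag_eq, Rabs_R0; auto) Hv);
    destruct eps as [eps Heps]; simpl in *; (eapply Rle_lt_trans; [|eapply Rle_lt_trans; [exact H|lra]]).
  - eapply Rle_trans; [|apply re_le_Cmod]. right; f_equal.
  - eapply Rle_trans; [|apply im_le_Cmod]. right; f_equal.
Qed.

(** Up to the factor [l * Ci] the integrand is the derivative in [t] of
    [f (gam l t)], which is periodic.  The factor vanishes at [l = 0], but the mean
    value theorem only asks for interior points. *)
Lemma Dzeta_integral l : 0 < l < 1 -> CInt (fun t => D (gam l t) * zeta t)%C = RtoC 0.
Proof.
  intros Hl0. assert (Hl : - ((1 - r) / 4) < l < 1 + (1 - r) / 4) by lra.
  assert (E : (l * Ci * CInt (fun t => D (gam l t) * zeta t) = 0)%C).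
  { rewrite <- CInt_scal by (now apply Dzeta_ccont).
    assert (Hc := ccont_mult _ _ (ccont_const (l * Ci)%C) (Dzeta_ccont l Hl)).
    assert (Hper : gam l (2 * PI) = gam l 0).
    { unfold gam, zeta. f_equal. f_equal. f_equal. unfold circle_point.
      now rewrite cos_2PI, sin_2PI, cos_0, sin_0. }
    unfold CInt, RtoC. f_equal; apply is_RInt_unique.
    - replace 0 with (minus (Re (f (gam l (2 * PI)))) (Re (f (gam l 0)))) at 2
        by (rewrite Hper; apply Rminus_diag_eq; auto).
      apply (is_RInt_derive (fun t => Re (f (gam l t)))).
      + intros x _. now apply curve_deriv_Re, homotopy_deriv_t.
      + intros x _. apply (proj1 (Hc x)).
    - replace 0 with (minus (Im (f (gam l (2 * PI)))) (Im (f (gam l 0)))) at 2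
        by (rewrite Hper; apply Rminus_diag_eq; auto).
      apply (is_RInt_derive (fun t => Im (f (gam l t)))).
      + intros x _. now apply curve_deriv_Im, homotopy_deriv_t.
      + intros x _. apply (proj2 (Hc x)). }
  assert (Hn : (l * Ci)%C <> RtoC 0).
  { intros E'. apply (f_equal Cmod) in E'. rewrite Cmod_mult, Cmod_Ci, Cmod_R, Cmod_0 in E'.
    rewrite Rabs_pos_eq in E'; lra. }
  replace (CInt (fun t => D (gam l t) * zeta t)%C) with
    (/ (l * Ci) * (l * Ci * CInt (fun t => D (gam l t) * zeta t)))%C; [rewrite E; ring|].
  field. split; [|].
  - intros E'. apply Hn. rewrite E'. ring.
  - intros E'. apply Hn. rewrite E'. ring.
Qed.

(** The derivative is taken under the integral sign one real component at a time: [pr]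
    stands for [Re] and for [Im]. *)
Lemma homotopy_component (pr : C -> R) :
  (forall g t v, curve_deriv g t v -> is_derive (fun x => pr (g x)) t (pr v)) ->
  (forall z, Rabs (pr z) <= Cmod z) -> (forall a b, pr (a - b)%C = pr a - pr b) ->
  (forall F, ccont F -> forall t, continuous (fun x => pr (F x)) t) ->
  (forall F, CInt F = RtoC 0 -> RInt (fun t => pr (F t)) 0 (2 * PI) = 0) ->
  RInt (fun t => pr (f (zeta t) * kappa t)%C) 0 (2 * PI)
  = RInt (fun t => pr (f w * kappa t)%C) 0 (2 * PI).
Proof.
  intros Hder Hle Hmin Hcont Hint.
  set (g := fun l t => pr (f (gam l t) * kappa t)%C).
  set (g' := fun l t => pr (D (gam l t) * zeta t)%C).
  assert (Hg : forall l t, - ((1 - r) / 4) < l < 1 + (1 - r) / 4 ->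
     is_derive (fun x => g x t) l (g' l t)).
  { intros l t Hl. apply (Hder (fun x => f (gam x t) * kappa t)%C). now apply homotopy_deriv_l. }
  assert (Hloc : forall l, 0 <= l <= 1 ->
     locally l (fun x => - ((1 - r) / 4) < x < 1 + (1 - r) / 4)).
  { intros l Hl. assert (P : 0 < (1 - r) / 4) by lra. exists (mkposreal _ P).
    intros x Hx. apply Rabs_lt_between' in Hx. simpl in Hx. lra. }
  set (H := fun l => RInt (g l) 0 (2 * PI)).
  assert (HH : forall l, 0 <= l <= 1 -> is_derive H l (RInt (g' l) 0 (2 * PI))).
  { intros l Hl.
    assert (Hl' : - ((1 - r) / 4) < l < 1 + (1 - r) / 4) by lra.
    rewrite (RInt_ext (g' l) (fun t => Derive (fun u => g u t) l)).
    2:{ intros t _. symmetry. apply is_derive_unique. now apply Hg. }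
    apply is_derive_RInt_param.
    - eapply filter_imp; [|apply (Hloc l Hl)]. intros x Hx t _. eexists. now apply Hg.
    - intros t _. apply continuity_2d_pt_ext_loc with g'.
      + destruct (Hloc l Hl) as [eta He]. exists eta. intros u v Hu Hv.
        symmetry. apply is_derive_unique, Hg, He, Hu.
      + intros eps.
        destruct (Dzeta_continuity l t Hl' (eps / 2)) as (eta & Heta & Hd);
          [destruct eps; simpl; lra|].
        exists (mkposreal eta Heta). intros u v Hu Hv. specialize (Hd u v Hu Hv).
        unfold g'. rewrite <- Hmin. eapply Rle_lt_trans; [apply Hle|].
        destruct eps; simpl in *; lra.
    - eapply filter_imp; [|apply (Hloc l Hl)]. intros x Hx.
      apply ex_RInt_cont. apply (Hcont (fun t => f (gam x t) * kappa t)%C).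
      apply ccont_mult; [now apply homotopy_ccont|apply kappa_ccont]. }
  destruct (MVT_cor2 H (fun l => RInt (g' l) 0 (2 * PI)) 0 1 Rlt_0_1) as (c & E & Hc).
  { intros c Hc. apply is_derive_Reals. now apply HH. }
  assert (E0 : RInt (g' c) 0 (2 * PI) = 0).
  { apply (Hint (fun t => D (gam c t) * zeta t)%C). now apply Dzeta_integral. }
  rewrite E0 in E.
  assert (E1 : H 1 = RInt (fun t => pr (f (zeta t) * kappa t)%C) 0 (2 * PI)).
  { apply RInt_ext. intros t _. unfold g, gam. do 3 f_equal. ring. }
  assert (E2 : H 0 = RInt (fun t => pr (f w * kappa t)%C) 0 (2 * PI)).
  { apply RInt_ext. intros t _. unfold g, gam. do 3 f_equal. ring. }
  rewrite <- E1, <- E2. lra.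
Qed.

Lemma homotopy_invariance :
  CInt (fun t => f (zeta t) * kappa t)%C = (f w * CInt kappa)%C.
Proof.
  rewrite <- CInt_scal by apply kappa_ccont. unfold CInt. f_equal.
  - apply (homotopy_component Re).
    + apply curve_deriv_Re.
    + apply re_le_Cmod.
    + reflexivity.
    + intros F HF t. apply (HF t).
    + intros F HF. apply (f_equal Re) in HF. exact HF.
  - apply (homotopy_component Im).
    + apply curve_deriv_Im.
    + apply im_le_Cmod.
    + reflexivity.
    + intros F HF t. apply (HF t).
    + intros F HF. apply (f_equal Im) in HF. exact HF.
Qed.

(* [zeta t ^ (- n)], written in polar form *)
Let e (n : nat) (t : R) : C := circle_point (/ r ^ n) (- INR n * t).

Lemma kappa_expand t N :
  kappa t = (Csum (fun n => w ^ n * e n t) N + w ^ N * (e N t * kappa t))%C.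
Proof.
  induction N as [|N IH].
  - unfold e. simpl. rewrite Ropp_0, Rmult_0_l, circle_point_0, Rinv_1. ring.
  - rewrite IH at 1. simpl Csum.
    assert (E1 : e (S N) t = (e N t * e 1 t)%C).
    { unfold e. rewrite circle_point_mult, S_INR. simpl INR. f_equal; [|ring].
      simpl; field. split; [lra|apply pow_nonzero; lra]. }
    assert (E2 : kappa t = (1 + w * e 1 t * kappa t)%C).
    { assert (E3 : (e 1 t * zeta t = 1)%C).
      { unfold e, zeta. rewrite circle_point_mult. simpl INR.
        replace (- (1) * t + t) with 0 by ring. rewrite circle_point_0. f_equal.
        simpl; field; lra. }
      assert (E4 : (kappa t * (zeta t - w) = zeta t)%C)
        by (unfold kappa; field; apply zeta_minus_neq).
      replace (kappa t) with (e 1 t * zeta t * kappa t)%C at 1 by (rewrite E3; ring).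
      replace (e 1 t * zeta t * kappa t)%C with
        (e 1 t * (kappa t * (zeta t - w)) + w * e 1 t * kappa t)%C by ring.
      rewrite E4, E3. reflexivity. }
    rewrite E2 at 1. rewrite E1. simpl Cpow. ring.
Qed.

Lemma e_ccont n : ccont (e n).
Proof. apply ccont_circle_comp. Qed.

(** Integrating the geometric expansion against [G] produces a polynomial in [w].
    Taking [G = 1] evaluates the integral of [kappa]; taking for [G] the boundary
    values of [f] produces the Taylor polynomials. *)
Lemma Cauchy_expand (G : R -> C) B N :
  ccont G -> (forall t, 0 <= t <= 2 * PI -> Cmod (G t) <= B) ->
  Cmod (CInt (fun t => G t * kappa t) - Csum (fun n => CInt (fun t => G t * e n t) * w ^ n) N)%C
  <= 4 * PI * (B * (r / (r - Cmod w))) * (Cmod w / r) ^ N.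
Proof.
  intros HG HB.
  assert (HGe : forall n, ccont (fun t => G t * e n t)%C)
    by (intros n; apply ccont_mult; [auto|apply e_ccont]).
  assert (HGk : forall n, ccont (fun t => G t * e n t * kappa t)%C)
    by (intros n; apply ccont_mult; [auto|apply kappa_ccont]).
  rewrite (CInt_ext (fun t => G t * kappa t)%C
    (fun t => Csum (fun n => w ^ n * (G t * e n t)) N + w ^ N * (G t * e N t * kappa t))%C).
  2:{ intros t. rewrite (kappa_expand t N) at 1.
      rewrite (Csum_ext (fun n => w ^ n * (G t * e n t))%C
                        (fun n => G t * (w ^ n * e n t))%C) by (intros; ring).
      rewrite Csum_scal. ring. }
  rewrite CInt_plus.
  2:{ apply (ccont_Csum (fun n t => w ^ n * (G t * e n t))%C). intros n.
      apply ccont_mult; [apply ccont_const|auto]. }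
  2:{ apply ccont_mult; [apply ccont_const|auto]. }
  rewrite (CInt_Csum (fun n t => w ^ n * (G t * e n t))%C)
    by (intros n; apply ccont_mult; [apply ccont_const|auto]).
  rewrite (Csum_ext _ (fun n => CInt (fun t => G t * e n t)%C * w ^ n)%C).
  2:{ intros n _. rewrite CInt_scal by auto. ring. }
  rewrite CInt_scal by auto.
  match goal with |- Cmod (?a + ?b - ?a)%C <= _ => replace (a + b - a)%C with b by ring end.
  rewrite Cmod_mult, Cmod_pow.
  assert (HB' : Cmod (CInt (fun t => G t * e N t * kappa t)%C)
     <= 4 * PI * (B * / r ^ N * (r / (r - Cmod w)))).
  { apply CInt_bound; [auto|]. intros t Ht. rewrite !Cmod_mult.
    assert (P : 0 < / r ^ N) by (apply Rinv_0_lt_compat, pow_lt; lra).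
    unfold e at 1. rewrite Cmod_circle_point by lra.
    apply Rmult_le_compat; [apply Rmult_le_pos; [apply Cmod_ge_0|lra]|apply Cmod_ge_0| |
       apply kappa_bound].
    apply Rmult_le_compat_r; [lra|auto]. }
  apply Rle_trans with (Cmod w ^ N * (4 * PI * (B * / r ^ N * (r / (r - Cmod w))))).
  - apply Rmult_le_compat_l; [apply pow_le, Cmod_ge_0|auto].
  - right. unfold Rdiv at 3. rewrite Rpow_mult_distr, pow_inv. field.
    split; [apply pow_nonzero; lra|lra].
Qed.

Lemma CInt_kappa : CInt kappa = RtoC (2 * PI).
Proof.
  apply Cmod_small_eq. intros eps Heps. pose proof (Cmod_ge_0 w). pose proof PI_RGT_0.
  assert (Hq : 0 <= Cmod w / r < 1) by (apply ratio_range with w; lra).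
  set (K := 4 * PI * (1 * (r / (r - Cmod w)))).
  assert (HK : 0 < K).
  { unfold K. assert (0 < r / (r - Cmod w)) by (apply Rdiv_lt_0_compat; lra).
    rewrite Rmult_1_l; apply Rmult_lt_0_compat; [lra|auto]. }
  destruct (pow_lt_1_zero (Cmod w / r)) with (y := eps / K) as [N HN].
  { rewrite Rabs_pos_eq; lra. }
  { now apply Rdiv_lt_0_compat. }
  specialize (HN (S N) ltac:(lia)). rewrite Rabs_pos_eq in HN by (apply pow_le; lra).
  pose proof (Cauchy_expand (fun _ => RtoC 1) 1 (S N) (ccont_const _)
    (fun _ _ => Req_le _ _ Cmod_1)) as HC. fold K in HC. cbv beta in HC.
  rewrite (CInt_ext (fun t => 1 * kappa t)%C kappa) in HC by (intros; ring).
  assert (E : Csum (fun n => CInt (fun t => 1 * e n t)%C * w ^ n)%C (S N) = RtoC (2 * PI)).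
  { change (S N) with (1 + N)%nat. rewrite Csum_add.
    rewrite (Csum_ext (fun i => CInt (fun t => 1 * e (1 + i) t)%C * w ^ (1 + i))%C
                      (fun _ => RtoC 0)).
    - rewrite Csum_zero. simpl.
      rewrite (CInt_ext (fun t => 1 * e 0 t)%C (fun _ => RtoC 1)).
      + unfold CInt; simpl. rewrite !RInt_const.
        unfold scal; simpl; unfold mult; simpl. unfold RtoC, Cplus, Cmult; simpl. f_equal; ring.
      + intros t. unfold e. simpl. rewrite Ropp_0, Rmult_0_l, circle_point_0, Rinv_1. ring.
    - intros i _. rewrite (CInt_ext _ (e (1 + i))) by (intros; ring).
      unfold e. rewrite CInt_circle_neg by lia. ring. }
  rewrite E in HC. eapply Rle_trans; [exact HC|].
  apply Rle_trans with (K * (eps / K)); [|right; field; lra].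
  apply Rmult_le_compat_l; lra.
Qed.

Lemma Cauchy_taylor B N :
  (forall t, 0 <= t <= 2 * PI -> Cmod (f (zeta t)) <= B) ->
  Cmod (f w - Csum (fun n => / (2 * PI) * CInt (fun t => f (zeta t) * e n t) * w ^ n) N)%C
  <= 2 * B * (r / (r - Cmod w)) * (Cmod w / r) ^ N.
Proof.
  intros HB. pose proof PI_RGT_0.
  assert (Hc : ccont (fun t => f (zeta t))).
  { assert (Hl : - ((1 - r) / 4) < 1 < 1 + (1 - r) / 4) by lra.
    rewrite (functional_extensionality (fun t => f (zeta t)) (fun t => f (gam 1 t))).
    - now apply homotopy_ccont.
    - intros t. unfold gam. f_equal. ring. }
  pose proof (Cauchy_expand (fun t => f (zeta t)) B N Hc HB) as HC. cbv beta in HC.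
  rewrite homotopy_invariance, CInt_kappa in HC.
  assert (Hpi : RtoC (2 * PI) <> RtoC 0) by (intros E; apply RtoC_inj in E; lra).
  rewrite (Csum_ext _ (fun n => / RtoC (2 * PI) * (CInt (fun t => f (zeta t) * e n t) * w ^ n))%C).
  2:{ intros n _. rewrite RtoC_mult. ring. }
  rewrite Csum_scal.
  set (S := Csum (fun n => CInt (fun t => f (zeta t) * e n t)%C * w ^ n)%C N) in *.
  replace (f w - / RtoC (2 * PI) * S)%C with (/ RtoC (2 * PI) * (f w * RtoC (2 * PI) - S))%C
    by (field; auto).
  rewrite Cmod_mult, Cmod_inv, Cmod_R, Rabs_pos_eq by (auto; lra).
  apply (Rmult_le_reg_l (2 * PI)); [lra|].
  rewrite <- Rmult_assoc, Rinv_r, Rmult_1_l by lra.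
  eapply Rle_trans; [exact HC|]. right; ring.
Qed.

End Cauchy.

(** Polynomials are dense.  Only one circle, halfway between [rho] and [1], is used: the
    approximating polynomials may depend on it, so no global Taylor series of [f] has
    to be constructed. *)
Lemma HD_polynomial_approx f rho eps :
  HD f -> 0 <= rho < 1 -> 0 < eps ->
  exists (c : nat -> C) (N : nat),
    forall w, Cmod w <= rho -> Cmod (f w - Csum (fun n => c n * w ^ n) N)%C <= eps.
Proof.
  intros Hf Hrho Heps. destruct (HD_derivative f Hf) as [D HD'].
  set (r := (1 + rho) / 2). assert (Hr : 0 < r < 1 /\ rho < r) by (unfold r; lra).
  assert (HB : exists B, 0 <= B /\ forall t, 0 <= t <= 2 * PI -> Cmod (f (circle_point r t)) <= B).
  { pose proof PI_RGT_0.
    destruct (continuity_ab_maj (fun t => Cmod (f (circle_point r t))) 0 (2 * PI))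
      as (tm & Hm & _); [lra| |].
    - intros t _. apply continuity_pt_filterlim.
      apply (ccont_Cmod (fun t => f (circle_point r t))). apply HD_circle_ccont; [auto|lra].
    - exists (Cmod (f (circle_point r tm))). split; [apply Cmod_ge_0|exact Hm]. }
  destruct HB as (B & HB0 & HB).
  assert (Hq : 0 <= rho / r < 1).
  { apply ratio_range with (RtoC rho); [rewrite Cmod_R, Rabs_pos_eq; lra|lra]. }
  set (K := 2 * B * (r / (r - rho))).
  assert (HK : 0 <= K).
  { unfold K. assert (0 < r / (r - rho)) by (apply Rdiv_lt_0_compat; lra). nra. }
  destruct (pow_lt_1_zero (rho / r)) with (y := eps / (K + 1)) as [N HN].
  { rewrite Rabs_pos_eq; lra. }
  { apply Rdiv_lt_0_compat; lra. }
  specialize (HN N (le_n _)). rewrite Rabs_pos_eq in HN by (apply pow_le; lra).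
  eexists; exists N. intros w Hw.
  eapply Rle_trans; [apply (Cauchy_taylor f D r w HD' ltac:(lra) ltac:(lra) B N HB)|].
  pose proof (Cmod_ge_0 w).
  apply Rle_trans with ((K + 1) * (eps / (K + 1))); [|right; field; lra].
  apply Rle_trans with (K * (rho / r) ^ N).
  - assert (Hr1 : 0 < r - rho) by lra. unfold K. apply Rmult_le_compat.
    + apply Rmult_le_pos; [lra|]. left; apply Rdiv_lt_0_compat; lra.
    + apply pow_le. apply Rmult_le_pos; [auto|left; apply Rinv_0_lt_compat; lra].
    + apply Rmult_le_compat_l; [lra|]. apply Rmult_le_compat_l; [lra|].
      apply Rinv_le_contravar; lra.
    + apply pow_incr. split.
      * apply Rmult_le_pos; [auto|left; apply Rinv_0_lt_compat; lra].
      * apply Rmult_le_compat_r; [left; apply Rinv_0_lt_compat; lra|auto].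
  - apply Rmult_le_compat; [auto|apply pow_le; lra|lra|lra].
Qed.


(** * Coefficient sequences and the iterated shift *)

(** The coefficient sequences of the elements of H(D). *)
Definition disc_coef (a : nat -> C) : Prop := forall s, 0 < s < 1 -> bounded_at a s.

Lemma disc_coef_has_sum a z : disc_coef a -> disc z -> has_sum (fun n => a n * z ^ n)%C (PS a z).
Proof.
  unfold disc. intros Ha Hz. pose proof (Cmod_ge_0 z).
  apply PS_has_sum with ((1 + Cmod z) / 2); [apply Ha|]; lra.
Qed.

Lemma HD_PS a : disc_coef a -> HD (PS a).
Proof.
  unfold HD, disc. intros Ha z Hz. pose proof (Cmod_ge_0 z).
  apply PS_analytic_at with ((1 + Cmod z) / 2); [apply Ha|]; lra.
Qed.

Lemma taylor_expansion_PS a : disc_coef a -> taylor_expansion (PS a) a.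
Proof. intros Ha z Hz. apply has_sum_is_pseries. now apply disc_coef_has_sum. Qed.

Lemma Rpower_le_base x al : 1 <= x -> 0 <= al <= 1 -> 1 <= Rpower x al <= x.
Proof.
  intros Hx Hal. split.
  - rewrite <- (Rpower_O x) by lra. now apply Rle_Rpower.
  - rewrite <- (Rpower_1 x) at 2 by lra. now apply Rle_Rpower.
Qed.

Definition shift_coef (al : R) (a : nat -> C) (k : nat) : C :=
  (a (S k) * RtoC (weight al (S k)))%C.

Fixpoint iter_shift_coef (al : R) (n : nat) (a : nat -> C) : nat -> C :=
  match n with O => a | S m => iter_shift_coef al m (shift_coef al a) end.

Lemma weight_range al n : 0 <= al <= 1 -> 1 <= weight al (S n) <= 2.
Proof.
  intros Hal. unfold weight.
  assert (0 < 1 / INR (S n) <= 1).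
  { assert (1 <= INR (S n)) by (rewrite S_INR; pose proof (pos_INR n); lra).
    split; [apply Rdiv_lt_0_compat; lra|].
    apply (Rmult_le_reg_r (INR (S n))); [lra|]. unfold Rdiv; rewrite Rmult_assoc, Rinv_l; lra. }
  pose proof (Rpower_le_base (1 + 1 / INR (S n)) al ltac:(lra) Hal). lra.
Qed.

Lemma disc_coef_shift al a : 0 <= al <= 1 -> disc_coef a -> disc_coef (shift_coef al a).
Proof.
  intros Hal Ha s Hs.
  destruct (bounded_at_shift a s (proj1 Hs) (Ha s Hs)) as (M & HM & H).
  exists (2 * M); split; [lra|]. intros n. unfold shift_coef.
  pose proof (weight_range al n Hal).
  rewrite Cmod_mult, Cmod_R, Rabs_pos_eq by lra. specialize (H n).
  replace (Cmod (a (S n)) * weight al (S n) * s ^ n)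
    with (weight al (S n) * (Cmod (a (S n)) * s ^ n)) by ring.
  apply Rmult_le_compat; try lra.
  apply Rmult_le_pos; [apply Cmod_ge_0|apply pow_le; lra].
Qed.

Lemma disc_coef_iter al n a : 0 <= al <= 1 -> disc_coef a -> disc_coef (iter_shift_coef al n a).
Proof.
  intros Hal. revert a. induction n as [|n IH]; intros a Ha; simpl; [auto|].
  now apply IH, disc_coef_shift.
Qed.

Lemma taylor_shift_iter_PS al n a :
  0 <= al <= 1 -> disc_coef a ->
  taylor_shift_iter al n (PS a) (PS (iter_shift_coef al n a)).
Proof.
  intros Hal. revert a. induction n as [|n IH]; intros a Ha; simpl; [auto|].
  exists (PS (shift_coef al a)). split; [|now apply IH, disc_coef_shift].
  exists a. split; [now apply taylor_expansion_PS|].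
  now apply (taylor_expansion_PS (shift_coef al a)), disc_coef_shift.
Qed.

(** The weights telescope, since [weight al j] is the power [al] of [(j + 1) / j]. *)
Lemma iter_shift_coef_eq al n a k :
  iter_shift_coef al n a k =
  (a (n + k)%nat * RtoC (Rpower (INR (n + k + 1) / INR (k + 1)) al))%C.
Proof.
  revert a. induction n as [|n IH]; intros a; simpl iter_shift_coef.
  - simpl. unfold Rdiv. rewrite Rinv_r by (rewrite plus_INR; simpl; pose proof (pos_INR k); lra).
    unfold Rpower. rewrite ln_1, Rmult_0_r, exp_0. ring.
  - rewrite IH. unfold shift_coef, weight.
    rewrite <- Cmult_assoc, <- RtoC_mult.
    pose proof (pos_INR n). pose proof (pos_INR k).
    rewrite Rpower_mult_distr.
    + change (S n + k)%nat with (S (n + k)). do 3 f_equal.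
      rewrite !plus_INR, !S_INR, !plus_INR. simpl. field. lra.
    + rewrite S_INR, plus_INR. assert (0 < 1 / (INR n + INR k + 1)); [|lra].
      apply Rdiv_lt_0_compat; lra.
    + rewrite !plus_INR. simpl. apply Rdiv_lt_0_compat; lra.
Qed.

(** * A countable family of targets *)

(** Reading a natural number as a sequence, by iterating Cantor's pairing; any finite
    sequence of natural numbers is a beginning of one of these. *)
Fixpoint nat_coord (i y : nat) : nat :=
  match i with
  | O => fst (of_nat y)
  | S j => nat_coord j (snd (of_nat y))
  end.

Lemma nat_coord_surj (v : nat -> nat) D : exists y, forall i, (i < D)%nat -> nat_coord i y = v i.
Proof.
  revert v. induction D as [|D IH]; intros v; [exists O; intros; lia|].
  destruct (IH (fun i => v (S i))) as [y Hy].
  exists (to_nat (v O, y)). intros [|i] Hi; cbn [nat_coord]; rewrite cancel_of_to; cbn [fst snd]; [auto|].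
  apply Hy; lia.
Qed.

(** The four parts of two differences and a common denominator, shifted by one so that
    it is never zero. *)
Definition gaussian (n : nat) : C :=
  let x := fun i => INR (nat_coord i n) in
  ((x 0%nat - x 1%nat) / (x 4%nat + 1), (x 2%nat - x 3%nat) / (x 4%nat + 1)).

Lemma Z_nat_diff (z : Z) : INR (Z.to_nat z) - INR (Z.to_nat (- z)) = IZR z.
Proof.
  rewrite !INR_IZR_INZ, <- minus_IZR. f_equal. lia.
Qed.

Lemma inv_INR_small eps : 0 < eps -> exists N, forall n, (N <= n)%nat -> / (INR n + 1) <= eps.
Proof.
  intros Heps. destruct (INR_unbounded (/ eps)) as [N HN]. exists N. intros n Hn.
  apply le_INR in Hn. rewrite <- (Rinv_inv eps).
  apply Rinv_le_contravar; [now apply Rinv_0_lt_compat|lra].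
Qed.

Lemma gaussian_dense z eps : 0 < eps -> exists n, Cmod (gaussian n - z)%C <= eps.
Proof.
  intros Heps. destruct (inv_INR_small (eps / 2)) as [e He]; [lra|]. specialize (He e (le_n _)).
  destruct z as [x y]. pose proof (pos_INR e) as Hpe.
  set (kx := Int_part (x * (INR e + 1))). set (ky := Int_part (y * (INR e + 1))).
  destruct (base_Int_part (x * (INR e + 1))) as [X1 X2]. fold kx in X1, X2.
  destruct (base_Int_part (y * (INR e + 1))) as [Y1 Y2]. fold ky in Y1, Y2.
  destruct (nat_coord_surj (fun i => match i with
    | 0 => Z.to_nat kx | 1 => Z.to_nat (- kx) | 2 => Z.to_nat ky
    | 3 => Z.to_nat (- ky) | _ => e end)%nat 5) as [n Hn].
  exists n. unfold gaussian. rewrite !Hn by lia. rewrite !Z_nat_diff.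
  assert (Hk : forall k u, IZR k <= u * (INR e + 1) -> IZR k - u * (INR e + 1) > -1 ->
     Rabs (IZR k / (INR e + 1) - u) <= eps / 2).
  { intros k u U1 U2. eapply Rle_trans; [|exact He].
    replace (IZR k / (INR e + 1) - u) with ((IZR k - u * (INR e + 1)) * / (INR e + 1))
      by (field; lra).
    assert (0 < / (INR e + 1)) by (apply Rinv_0_lt_compat; lra).
    rewrite Rabs_mult, (Rabs_pos_eq (/ _)) by lra.
    rewrite <- (Rmult_1_l (/ (INR e + 1))) at 2. apply Rmult_le_compat_r; [lra|].
    apply Rabs_le; lra. }
  eapply Rle_trans; [apply Cmod_le_parts|]. simpl.
  pose proof (Hk kx x X1 X2). pose proof (Hk ky y Y1 Y2). unfold Rminus in *. lra.
Qed.

(** A target is a polynomial with rational coefficients together with a radius and a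
    tolerance; [m] codes the length, the coefficients and the precision.  A function is
    hypercyclic as soon as its orbit comes near every target. *)
Definition target_len (m : nat) : nat := nat_coord 0 m.
Definition target_coef (m i : nat) : C :=
  if Nat.ltb i (target_len m) then gaussian (nat_coord i (nat_coord 1 m)) else RtoC 0.
Definition target_eps (m : nat) : R := / (INR (nat_coord 2 m) + 1).
Definition target_rad (m : nat) : R := 1 - / (INR (nat_coord 2 m) + 1 + 1).
Definition near_target (m : nat) (g : C -> C) : Prop :=
  forall z, Cmod z <= target_rad m -> 
    Cmod (g z - Csum (fun i => target_coef m i * z ^ i) (target_len m))%C <= target_eps m.

Lemma target_eps_pos m : 0 < target_eps m.
Proof. apply Rinv_0_lt_compat. pose proof (pos_INR (nat_coord 2 m)). lra. Qed.

Lemma target_rad_range m : 0 < target_rad m < 1.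
Proof.
  unfold target_rad. pose proof (pos_INR (nat_coord 2 m)).
  assert (0 < / (INR (nat_coord 2 m) + 1 + 1)) by (apply Rinv_0_lt_compat; lra).
  assert (/ (INR (nat_coord 2 m) + 1 + 1) < / 1) by (apply Rinv_lt_contravar; lra).
  rewrite Rinv_1 in *. lra.
Qed.

Lemma open_Cmod_lt R0 : open (fun z : C => Cmod z < R0).
Proof.
  intros z Hz. assert (P : 0 < (R0 - Cmod z) / 2) by lra.
  exists (mkposreal _ P). intros y0 Hy. set (y := y0 : C) in *.
  apply C_NormedModule_mixin_compat2 in Hy. simpl in Hy.
  change (Cmod (y - z)%C < sqrt 2 * ((R0 - Cmod z) / 2)) in Hy.
  assert (sqrt 2 <= 2).
  { rewrite <- (sqrt_square 2) at 2 by lra. apply sqrt_le_1; lra. }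
  pose proof (Cmod_triangle (y - z)%C z) as T. replace (y - z + z)%C with (y : C) in T by (simpl; ring).
  assert (sqrt 2 * ((R0 - Cmod z) / 2) <= 2 * ((R0 - Cmod z) / 2))
    by (apply Rmult_le_compat_r; lra).
  lra.
Qed.

(** The smaller concentric open discs cover [K], and a finite subcover has a largest
    member. *)
Lemma compact_in_disc K :
  compact_set K -> (forall z, K z -> disc z) -> exists rho, 0 <= rho < 1 /\ forall z, K z -> Cmod z <= rho.
Proof.
  intros HK Hd.
  destruct (HK (fun O => exists r, r < 1 /\ O = (fun z => Cmod z < r))) as (l & Hl & Hcov).
  - intros O (r & _ & ->). apply open_Cmod_lt.
  - intros z Hz. specialize (Hd z Hz). unfold disc in Hd.
    exists (fun y => Cmod y < (1 + Cmod z) / 2). split; [eexists; split; [|reflexivity]; lra|lra].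
  - assert (Hb : exists rho, 0 <= rho < 1 /\ forall O z, In O l -> O z -> Cmod z <= rho).
    { clear Hcov. induction l as [|O l IH]; [exists 0; split; [lra|intros; easy]|].
      destruct IH as (rho & Hrho & H); [intros; apply Hl; now right|].
      destruct (Hl O (or_introl eq_refl)) as (r & Hr & ->).
      exists (Rmax rho r). split; [split; [apply Rle_trans with rho; [lra|apply Rmax_l]|
        now apply Rmax_lub_lt]|].
      intros P z [<-|HP] Hz; [apply Rle_trans with r; [lra|apply Rmax_r]|].
      apply Rle_trans with rho; [now apply (H P)|apply Rmax_l]. }
    destruct Hb as (rho & Hrho & H). exists rho; split; [auto|]. intros z Hz.
    destruct (Hcov z Hz) as (O & HO & HOz). now apply (H O).
Qed.

(** Density of the targets.  The tolerance [eps] of a basic neighbourhood is shared, in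
    quarters, between the polynomial approximation, the rounding of its coefficients
    and the tolerance of the target. *)
Lemma targets_cover U :
  HD_open U -> (exists g, U g) -> exists m, forall g, HD g -> near_target m g -> U g.
Proof.
  intros [HU HUo] [g0 Hg0].
  destruct (HUo g0 Hg0) as (K & eps & HK & HKd & Heps & HKU).
  destruct (compact_in_disc K HK HKd) as (rho & Hrho & HKrho).
  destruct (HD_polynomial_approx g0 rho (eps / 4) (HU g0 Hg0) Hrho) as (c & N & Hc); [lra|].
  pose proof (pos_INR N) as HN.
  assert (Hd : 0 < eps / (4 * (INR N + 1))) by (apply Rdiv_lt_0_compat; lra).
  destruct (functional_choice (fun i n => Cmod (gaussian n - c i)%C <= eps / (4 * (INR N + 1))))
    as [v Hv]; [intros i; now apply gaussian_dense|].
  destruct (inv_INR_small (Rmin (eps / 4) (1 - rho))) as [l Hl]; [apply Rmin_pos; lra|].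
  pose proof (Rmin_l (eps / 4) (1 - rho)). pose proof (Rmin_r (eps / 4) (1 - rho)).
  destruct (nat_coord_surj v N) as [y Hy].
  destruct (nat_coord_surj (fun i => match i with 0 => N | 1 => y | _ => l end)%nat 3) as [m Hm].
  exists m. intros g Hg Hnear. apply HKU; [auto|]. intros z Hz.
  specialize (HKrho z Hz). specialize (Hc z HKrho).
  assert (Hz1 : Cmod z <= target_rad m).
  { unfold target_rad. rewrite Hm by lia. specialize (Hl (S l) ltac:(lia)).
    rewrite S_INR in Hl. lra. }
  specialize (Hnear z Hz1).
  assert (He : target_eps m <= eps / 4).
  { unfold target_eps. rewrite Hm by lia. specialize (Hl l (le_n _)). lra. }
  assert (Hlen : target_len m = N) by (unfold target_len; now rewrite Hm by lia).
  set (P := Csum (fun n => c n * z ^ n)%C N) in *.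
  set (Q := Csum (fun i => target_coef m i * z ^ i)%C (target_len m)) in *.
  assert (HPQ : Cmod (Q - P)%C <= eps / 4).
  { unfold Q, P. rewrite Hlen, <- Csum_minus. eapply Rle_trans; [apply Cmod_Csum|].
    apply Rle_trans with (Rsum (fun _ => eps / (4 * (INR N + 1))) N).
    - apply Rsum_le. intros i Hi. unfold target_coef.
      rewrite Hlen, (proj2 (Nat.ltb_lt i N) Hi), (Hm 1%nat), Hy by lia.
      replace (gaussian (v i) * z ^ i - c i * z ^ i)%C with ((gaussian (v i) - c i) * z ^ i)%C by ring.
      rewrite Cmod_mult, Cmod_pow, <- (Rmult_1_r (eps / _)).
      pose proof (Cmod_ge_0 z).
      apply Rmult_le_compat; [apply Cmod_ge_0|now apply pow_le|apply Hv|].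
      rewrite <- (pow1 i). apply pow_incr; lra.
    - rewrite Rsum_const. apply Rle_trans with ((INR N + 1) * (eps / (4 * (INR N + 1)))).
      + apply Rmult_le_compat_r; lra.
      + right; field; lra. }
  pose proof (Cmod_triangle_minus (g z) Q P). pose proof (Cmod_triangle_minus (g z) P (g0 z)).
  rewrite Cmod_minus_sym in Hc. lra.
Qed.


(** * Integral means *)

Lemma Rpower_pos x y : 0 < Rpower x y.
Proof. apply exp_pos. Qed.

Lemma Rpower_one_base y : Rpower 1 y = 1.
Proof. unfold Rpower. now rewrite ln_1, Rmult_0_r, exp_0. Qed.

Lemma pow0_nonneg x p : 0 <= pow0 x p.
Proof. unfold pow0. destruct Req_EM_T; [lra|left; apply Rpower_pos]. Qed.

Lemma pow0_pos x p : 0 < x -> pow0 x p = Rpower x p.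
Proof. intros Hx. unfold pow0. destruct Req_EM_T; [lra|auto]. Qed.

Lemma pow0_0 p : pow0 0 p = 0.
Proof. unfold pow0. destruct Req_EM_T; [auto|lra]. Qed.

Lemma pow0_mult c x p : 0 < c -> 0 <= x -> pow0 (c * x) p = Rpower c p * pow0 x p.
Proof.
  intros Hc [Hx|<-]; [|rewrite Rmult_0_r, pow0_0; ring].
  rewrite !pow0_pos by (auto; now apply Rmult_lt_0_compat). now rewrite Rpower_mult_distr.
Qed.

Lemma pow0_le x y p : 0 <= x <= y -> 0 <= p -> pow0 x p <= pow0 y p.
Proof.
  intros [[Hx|<-] Hxy] Hp; [|rewrite pow0_0; apply pow0_nonneg].
  rewrite !pow0_pos by lra. apply Rle_Rpower_l; lra.
Qed.

(** Bernoulli's inequality for real exponents, from [ln x <= x - 1] at [x = v / u] and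
    [x = / u], where [v] is the left-hand side. *)
Lemma Rpower_bernoulli u p : 0 < u -> 1 <= p -> 1 + p * (u - 1) <= Rpower u p.
Proof.
  intros Hu Hp. destruct (Rle_lt_dec (1 + p * (u - 1)) 0) as [Hv|Hv].
  { pose proof (Rpower_pos u p). lra. }
  set (v := 1 + p * (u - 1)) in *.
  assert (Hln : forall x, 0 < x -> ln x <= x - 1).
  { intros x Hx. pose proof (exp_ineq1_le (ln x)) as E. rewrite exp_ln in E; lra. }
  assert (Hiu : 0 < / u) by (now apply Rinv_0_lt_compat).
  pose proof (Hln (v * / u) ltac:(now apply Rmult_lt_0_compat)) as L1.
  pose proof (Hln (/ u) Hiu) as L2.
  rewrite ln_mult, ln_Rinv in L1 by auto. rewrite ln_Rinv in L2 by auto.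
  assert (L3 : (p - 1) * (- ln u) <= (p - 1) * (/ u - 1)) by (apply Rmult_le_compat_l; lra).
  assert (E : v * / u - 1 + (p - 1) * (/ u - 1) = 0) by (unfold v; field; lra).
  assert (ln v <= p * ln u) by lra.
  unfold Rpower. rewrite <- (exp_ln v) at 1 by auto.
  destruct H as [H|H]; [left; now apply exp_increasing|right; now rewrite H].
Qed.

Lemma Rpower_bernoulli_concave u g : 0 < u -> 0 <= g <= 1 -> Rpower u g <= 1 + g * (u - 1).
Proof.
  intros Hu [[Hg|<-] Hg1]; [|unfold Rpower; rewrite Rmult_0_l, exp_0; lra].
  assert (Hi : 1 <= / g) by (rewrite <- Rinv_1; apply Rinv_le_contravar; lra).
  pose proof (Rpower_bernoulli (Rpower u g) (/ g) (Rpower_pos _ _) Hi) as B.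
  rewrite Rpower_mult, Rinv_r, Rpower_1 in B by lra.
  apply (Rmult_le_compat_l g) in B; [|lra].
  replace (g * (1 + / g * (Rpower u g - 1))) with (g + (Rpower u g - 1)) in B by (field; lra).
  lra.
Qed.

(** The graph lies above its tangent at the intermediate point [s], by Bernoulli's
    inequality. *)
Lemma pow0_convex x y lam p :
  0 <= x -> 0 <= y -> 0 < lam < 1 -> 1 <= p ->
  pow0 (lam * x + (1 - lam) * y) p <= lam * pow0 x p + (1 - lam) * pow0 y p.
Proof.
  intros Hx Hy Hl Hp. set (s := lam * x + (1 - lam) * y).
  assert (0 <= lam * x) by (apply Rmult_le_pos; lra).
  assert (0 <= (1 - lam) * y) by (apply Rmult_le_pos; lra).
  assert (Hs : 0 <= s) by (unfold s; lra).
  pose proof (pow0_nonneg x p). pose proof (pow0_nonneg y p).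
  destruct Hs as [Hs|Hs].
  2:{ rewrite <- Hs, pow0_0.
      apply Rplus_le_le_0_compat; apply Rmult_le_pos; lra. }
  assert (T : forall z, 0 <= z -> Rpower s p * (1 + p * (z / s - 1)) <= pow0 z p).
  { intros z [Hz|<-].
    - rewrite pow0_pos by auto.
      assert (0 < z / s) by (now apply Rdiv_lt_0_compat).
      replace z with (s * (z / s)) at 2 by (field; lra).
      rewrite <- Rpower_mult_distr by auto.
      apply Rmult_le_compat_l; [left; apply Rpower_pos|]. now apply Rpower_bernoulli.
    - rewrite pow0_0. pose proof (Rpower_pos s p). unfold Rdiv. rewrite Rmult_0_l.
      assert (0 <= Rpower s p * (p - 1)) by (apply Rmult_le_pos; lra). lra. }
  pose proof (T x Hx) as Tx. pose proof (T y Hy) as Ty.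
  apply (Rmult_le_compat_l lam) in Tx; [|lra].
  apply (Rmult_le_compat_l (1 - lam)) in Ty; [|lra].
  rewrite (pow0_pos s) by auto.
  replace (Rpower s p) with (lam * (Rpower s p * (1 + p * (x / s - 1)))
     + (1 - lam) * (Rpower s p * (1 + p * (y / s - 1)))); [lra|].
  replace (lam * (Rpower s p * (1 + p * (x / s - 1)))
     + (1 - lam) * (Rpower s p * (1 + p * (y / s - 1)))) with
    (Rpower s p * (1 + p * ((lam * x + (1 - lam) * y) / s - 1))) by (field; lra).
  fold s. field. lra.
Qed.

Lemma pow0_continuous (X : R -> R) p t :
  1 <= p -> (forall t, 0 <= X t) -> continuous X t -> continuous (fun t => pow0 (X t) p) t.
Proof.
  intros Hp HX Hc.
  pose proof (proj2 (continuity_pt_filterlim X t) Hc) as Hc'.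
  pose proof (proj1 (continuity_pt_locally X t) Hc') as Hl.
  destruct (HX t) as [Ht|Ht].
  - apply continuous_ext_loc with (fun t => exp (p * ln (X t))).
    + assert (P : 0 < X t / 2) by lra. specialize (Hl (mkposreal _ P)).
      eapply filter_imp; [|exact Hl]. intros u Hu. simpl in Hu.
      apply Rabs_def2 in Hu. rewrite pow0_pos by lra. reflexivity.
    + apply continuous_exp_comp. apply (continuous_mult (K := R_AbsRing)).
      * apply continuous_const.
      * apply continuous_comp; [auto|]. now apply continuous_ln.
  - apply continuity_pt_filterlim, continuity_pt_locally. intros eps.
    assert (P : 0 < Rmin 1 eps) by (apply Rmin_pos; [lra|destruct eps; auto]).
    specialize (Hl (mkposreal _ P)). eapply filter_imp; [|exact Hl].
    intros u Hu. simpl in Hu. rewrite <- Ht in *. rewrite pow0_0.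
    rewrite Rminus_0_r in *. pose proof (HX u).
    rewrite Rabs_pos_eq in * by (auto; apply pow0_nonneg).
    pose proof (Rmin_l 1 eps). pose proof (Rmin_r 1 eps).
    apply Rle_lt_trans with (X u); [|lra].
    destruct (HX u) as [Hu0|Hu0]; [|rewrite <- Hu0, pow0_0; lra].
    rewrite pow0_pos by auto.
    replace p with (1 + (p - 1)) by ring. rewrite Rpower_plus, Rpower_1 by auto.
    rewrite <- (Rmult_1_r (X u)) at 3. apply Rmult_le_compat_l; [lra|].
    assert (Rpower (X u) (p - 1) <= Rpower 1 (p - 1)) by (apply Rle_Rpower_l; lra).
    rewrite Rpower_one_base in *. lra.
Qed.

(** The normalized [L^p] norm of [X] over a period is at most [B].  The root is not
    taken, and [B] is positive so that [X / B] makes sense in Minkowski's inequality. *)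
Definition mean_le (p : Rbar) (X : R -> R) (B : R) : Prop :=
  (forall t, continuous X t) /\ (forall t, 0 <= X t) /\ 0 < B /\
  match p with
  | Finite p => RInt (fun t => pow0 (X t) p) 0 (2 * PI) <= 2 * PI * Rpower B p
  | _ => forall t, X t <= B
  end.

Lemma pow0_ex_RInt X p :
  1 <= p -> (forall t, 0 <= X t) -> (forall t, continuous X t) ->
  ex_RInt (fun t => pow0 (X t) p) 0 (2 * PI).
Proof. intros Hp H0 Hc. apply ex_RInt_cont. intros t. now apply pow0_continuous. Qed.

Lemma mean_le_sup p X B :
  Rbar_le 1 p -> (forall t, continuous X t) -> 0 < B -> (forall t, 0 <= X t <= B) ->
  mean_le p X B.
Proof.
  intros Hp Hc HB HX. assert (H0 : forall t, 0 <= X t) by (intros; apply HX).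
  split; [auto|]. split; [auto|]. split; [auto|].
  destruct p as [p| |]; [|intros; apply HX|intros; apply HX].
  simpl in Hp. pose proof PI_RGT_0.
  apply Rle_trans with (RInt (fun _ => Rpower B p) 0 (2 * PI)).
  - apply RInt_le; [lra|now apply pow0_ex_RInt|apply ex_RInt_const|].
    intros t _. rewrite <- pow0_pos by auto. apply pow0_le; [auto|lra].
  - rewrite RInt_const. unfold scal; simpl; unfold mult; simpl. lra.
Qed.

Lemma mean_le_scal p X B c : Rbar_le 1 p ->
  0 < c -> mean_le p X B -> mean_le p (fun t => c * X t) (c * B).
Proof.
  intros Hp Hc (H1 & H2 & HB & H3).
  split; [|split; [|split]].
  - intros t. apply (continuous_mult (K := R_AbsRing)); [apply continuous_const|auto].
  - intros t. apply Rmult_le_pos; [lra|auto].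
  - now apply Rmult_lt_0_compat.
  - destruct p as [p| |]; try (intros t; apply Rmult_le_compat_l; [lra|auto]).
    rewrite (RInt_ext _ (fun t => Rpower c p * pow0 (X t) p)) by (intros; now apply pow0_mult).
    rewrite (RInt_scal (V := R_CompleteNormedModule) (fun t => pow0 (X t) p))
      by (now apply pow0_ex_RInt).
    unfold scal; simpl; unfold mult; simpl. rewrite <- Rpower_mult_distr by auto.
    pose proof (Rpower_pos c p).
    replace (2 * PI * (Rpower c p * Rpower B p)) with (Rpower c p * (2 * PI * Rpower B p)) by ring.
    apply Rmult_le_compat_l; lra.
Qed.

Lemma mean_le_mono p X Y B B' : Rbar_le 1 p ->
  (forall t, continuous Y t) -> (forall t, 0 <= Y t <= X t) -> B <= B' ->
  mean_le p X B -> mean_le p Y B'.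
Proof.
  intros Hp Hc HY HBB (H1 & H2 & HB & H3).
  assert (H0 : forall t, 0 <= Y t) by (intros; apply HY).
  split; [auto|]. split; [auto|]. split; [lra|]. pose proof PI_RGT_0.
  destruct p as [p| |]; try (intros t; specialize (HY t); specialize (H3 t); lra).
  simpl in Hp.
  apply Rle_trans with (RInt (fun t => pow0 (X t) p) 0 (2 * PI)).
  - apply RInt_le; [lra|now apply pow0_ex_RInt|now apply pow0_ex_RInt|].
    intros t _. apply pow0_le; [auto|lra].
  - eapply Rle_trans; [exact H3|]. apply Rmult_le_compat_l; [lra|].
    apply Rle_Rpower_l; lra.
Qed.

(** Minkowski's inequality: after normalization, [X + Y] is [A + B] times a convex
    combination of [X / A] and [Y / B]. *)
Lemma mean_le_plus p X Y A B : Rbar_le 1 p ->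
  mean_le p X A -> mean_le p Y B -> mean_le p (fun t => X t + Y t) (A + B).
Proof.
  intros Hp (X1 & X2 & HA & X3) (Y1 & Y2 & HB & Y3).
  split; [|split; [|split]].
  - intros t. now apply (continuous_plus (V := R_NormedModule)).
  - intros t. now apply Rplus_le_le_0_compat.
  - lra.
  - destruct p as [p| |]; try (intros t; specialize (X3 t); specialize (Y3 t); lra).
    simpl in Hp. pose proof PI_RGT_0. set (lam := A / (A + B)).
    assert (Hlam : 0 < lam < 1).
    { unfold lam. split; [apply Rdiv_lt_0_compat; lra|].
      apply (Rmult_lt_reg_r (A + B)); [lra|]. unfold Rdiv; rewrite Rmult_assoc, Rinv_l; lra. }
    set (a := Rpower (A + B) p * (lam * Rpower (/ A) p)).
    set (b := Rpower (A + B) p * ((1 - lam) * Rpower (/ B) p)).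
    assert (IA : 0 < / A) by (now apply Rinv_0_lt_compat).
    assert (IB : 0 < / B) by (now apply Rinv_0_lt_compat).
    assert (EX := pow0_ex_RInt X p Hp X2 X1). assert (EY := pow0_ex_RInt Y p Hp Y2 Y1).
    apply Rle_trans with (RInt (fun t => a * pow0 (X t) p + b * pow0 (Y t) p) 0 (2 * PI)).
    + apply RInt_le; [lra| | |].
      * apply (pow0_ex_RInt (fun t => X t + Y t)); auto.
        -- intros t. now apply Rplus_le_le_0_compat.
        -- intros t. now apply (continuous_plus (V := R_NormedModule)).
      * apply (ex_RInt_plus (V := R_NormedModule));
          now apply (ex_RInt_scal (V := R_NormedModule)).
      * intros t _. specialize (X2 t). specialize (Y2 t).
        replace (X t + Y t) with ((A + B) * (lam * (/ A * X t) + (1 - lam) * (/ B * Y t)))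
          by (unfold lam; field; lra).
        rewrite pow0_mult.
        -- replace (a * pow0 (X t) p + b * pow0 (Y t) p) with
             (Rpower (A + B) p * (lam * (Rpower (/ A) p * pow0 (X t) p)
                + (1 - lam) * (Rpower (/ B) p * pow0 (Y t) p))) by (unfold a, b; ring).
           rewrite <- (pow0_mult (/ A)), <- (pow0_mult (/ B)) by auto.
           apply Rmult_le_compat_l; [left; apply Rpower_pos|].
           apply pow0_convex; auto; apply Rmult_le_pos; lra.
        -- lra.
        -- apply Rplus_le_le_0_compat; apply Rmult_le_pos; try lra; apply Rmult_le_pos; lra.
    + rewrite (RInt_plus (V := R_CompleteNormedModule) (fun t => a * pow0 (X t) p)
        (fun t => b * pow0 (Y t) p)) by (now apply (ex_RInt_scal (V := R_NormedModule))).
      rewrite (RInt_scal (V := R_CompleteNormedModule) (fun t => pow0 (X t) p)) by auto.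
      rewrite (RInt_scal (V := R_CompleteNormedModule) (fun t => pow0 (Y t) p)) by auto.
      unfold plus, scal; simpl; unfold mult; simpl.
      assert (0 <= a). { unfold a. pose proof (Rpower_pos (A + B) p).
        pose proof (Rpower_pos (/ A) p). apply Rmult_le_pos; [lra|apply Rmult_le_pos; lra]. }
      assert (0 <= b). { unfold b. pose proof (Rpower_pos (A + B) p).
        pose proof (Rpower_pos (/ B) p). apply Rmult_le_pos; [lra|apply Rmult_le_pos; lra]. }
      apply Rle_trans with (a * (2 * PI * Rpower A p) + b * (2 * PI * Rpower B p)).
      * apply Rplus_le_compat; apply Rmult_le_compat_l; auto.
      * right. unfold a, b.
        assert (E1 : Rpower (/ A) p * Rpower A p = 1).
        { rewrite Rpower_mult_distr, Rinv_l, Rpower_one_base by lra; auto. }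
        assert (E2 : Rpower (/ B) p * Rpower B p = 1).
        { rewrite Rpower_mult_distr, Rinv_l, Rpower_one_base by lra; auto. }
        replace (Rpower (A + B) p * (lam * Rpower (/ A) p) * (2 * PI * Rpower A p)
           + Rpower (A + B) p * ((1 - lam) * Rpower (/ B) p) * (2 * PI * Rpower B p)) with
          (Rpower (A + B) p * (2 * PI) * (lam * (Rpower (/ A) p * Rpower A p)
             + (1 - lam) * (Rpower (/ B) p * Rpower B p))) by ring.
        rewrite E1, E2. ring.
Qed.

(** The additional term [1] absorbs the tail of an infinite superposition, so that
    means of infinite sums need no limit theorem. *)
Lemma mean_le_Rsum p (X : nat -> R -> R) (B : nat -> R) n : Rbar_le 1 p ->
  (forall k, (k < n)%nat -> mean_le p (X k) (B k)) ->
  mean_le p (fun t => Rsum (fun k => X k t) n + 1) (Rsum B n + 1).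
Proof.
  intros Hp. induction n as [|n IH]; intros H.
  - simpl. apply mean_le_sup; auto; intros; try apply continuous_const; lra.
  - assert (H1 := mean_le_plus _ _ _ _ _ Hp (IH ltac:(intros; apply H; lia)) (H n ltac:(lia))).
    simpl. replace (Rsum B n + B n + 1) with (Rsum B n + 1 + B n) by ring.
    replace (fun t => Rsum (fun k => X k t) n + X n t + 1)
      with (fun t => Rsum (fun k => X k t) n + 1 + X n t); [exact H1|].
    apply functional_extensionality; intros t; ring.
Qed.

Lemma integral_mean_le p f r B : Rbar_le 1 p ->
  mean_le p (fun t => Cmod (f (circle_point r t))) B -> Rbar_le (integral_mean p f r) B.
Proof.
  intros Hp (H1 & H2 & HB & H3). pose proof PI_RGT_0.
  destruct p as [p| |]; simpl in Hp; [| |easy].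
  - simpl in *. set (I := RInt _ _ _) in *.
    assert (HI : 0 <= I).
    { apply RInt_ge_0; [lra|now apply (pow0_ex_RInt (fun t => Cmod (f (circle_point r t))))|].
      intros; apply pow0_nonneg. }
    assert (P : 0 < / (2 * PI)) by (apply Rinv_0_lt_compat; lra).
    assert (Hip : 0 < / p) by (apply Rinv_0_lt_compat; lra).
    apply Rle_trans with (pow0 (Rpower B p) (1 / p)).
    + apply pow0_le; [|unfold Rdiv; lra]. unfold Rdiv. rewrite Rmult_1_l. split.
      * apply Rmult_le_pos; lra.
      * apply (Rmult_le_reg_l (2 * PI)); [lra|]. rewrite <- Rmult_assoc, Rinv_r by lra. lra.
    + rewrite pow0_pos by apply Rpower_pos. rewrite Rpower_mult.
      replace (p * (1 / p)) with 1 by (field; lra). rewrite Rpower_1; lra.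
  - simpl. apply Lub_Rbar_correct. intros y (t & _ & ->). apply H3.
Qed.

(** * Kernels *)

(** A kernel is a polynomial with at most [4 * L] coefficients bounded by [1], a fixed
    proportion of which equals [1].  The unit coefficients are the times at which a
    target will be hit, and the size of the kernel governs growth. *)
Definition kernel_poly (kap : nat -> R) (L : nat) (w : C) : C :=
  Csum (fun i => RtoC (kap i) * w ^ i)%C (4 * L).

Definition hits (kap : nat -> R) (n : nat) : R :=
  Rsum (fun i => if Req_EM_T (kap i) 1 then 1 else 0) n.

Definition circle_pow (r : R) (d : nat) (t : R) : C := (circle_point r t ^ d)%C.

Lemma circle_pow_eq r d t i :
  (circle_pow r d t ^ i)%C = circle_point ((r ^ d) ^ i) (INR i * (INR d * t)).
Proof. unfold circle_pow. rewrite !circle_point_pow. reflexivity. Qed.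

Lemma ccont_circle_pow r d i : ccont (fun t => circle_pow r d t ^ i)%C.
Proof.
  replace (fun t => circle_pow r d t ^ i)%C
    with (fun t => circle_point ((r ^ d) ^ i) (INR i * INR d * t)).
  - apply ccont_circle_comp.
  - apply functional_extensionality; intros t. rewrite circle_pow_eq. f_equal. ring.
Qed.

Lemma circle_pow_le_1 r d t : 0 < r < 1 -> Cmod (circle_pow r d t) <= 1.
Proof.
  intros Hr. unfold circle_pow. rewrite Cmod_pow, Cmod_circle_point by lra.
  rewrite <- (pow1 d). apply pow_incr; lra.
Qed.

Lemma ccont_kernel_poly kap L r d : ccont (fun t => kernel_poly kap L (circle_pow r d t)).
Proof.
  unfold kernel_poly. apply (ccont_Csum (fun i t => kap i * circle_pow r d t ^ i)%C).
  intros i. apply ccont_mult; [apply ccont_const|apply ccont_circle_pow].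
Qed.

(** ** Rudin-Shapiro polynomials *)

(** The coefficients of the pair [P + z ^ (2 ^ s) * Q], [P - z ^ (2 ^ s) * Q], built
    from the pair [P], [Q] of length [2 ^ s]. *)
Fixpoint rudin_shapiro (s : nat) : (nat -> R) * (nat -> R) :=
  match s with
  | O => (fun i => if Nat.eqb i 0 then 1 else 0, fun i => if Nat.eqb i 0 then 1 else 0)
  | S s' =>
      let P := fst (rudin_shapiro s') in
      let Q := snd (rudin_shapiro s') in
      (fun i => if Nat.ltb i (2 ^ s') then P i else Q (i - 2 ^ s')%nat,
       fun i => if Nat.ltb i (2 ^ s') then P i else - Q (i - 2 ^ s')%nat)
  end.

Lemma rudin_shapiro_coef s i :
  ((i < 2 ^ s)%nat -> (fst (rudin_shapiro s) i = 1 \/ fst (rudin_shapiro s) i = -1) /\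
                      (snd (rudin_shapiro s) i = 1 \/ snd (rudin_shapiro s) i = -1)) /\
  ((2 ^ s <= i)%nat -> fst (rudin_shapiro s) i = 0 /\ snd (rudin_shapiro s) i = 0).
Proof.
  revert i. induction s as [|s IH]; intros i.
  - destruct i as [|i]; simpl; split; intros; try lia; auto.
  - cbn [rudin_shapiro fst snd]. rewrite Nat.pow_succ_r'.
    destruct (Nat.ltb_spec i (2 ^ s)) as [Hi|Hi].
    + split; [|intros; lia]. intros _. destruct (proj1 (IH i) Hi). auto.
    + destruct (IH (i - 2 ^ s)%nat) as [A B]. split; intros H.
      * destruct A as [_ [->| ->]]; [lia| |]; split; lra.
      * destruct B as [_ ->]; [lia|]. split; lra.
Qed.

Lemma parallelogram a b :
  Cmod (a + b)%C ^ 2 + Cmod (a - b)%C ^ 2 = 2 * (Cmod a ^ 2 + Cmod b ^ 2).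
Proof.
  rewrite !Cmod2_alt. destruct a as [a1 a2], b as [b1 b2]; simpl. ring.
Qed.

Definition Rpoly (kap : nat -> R) (w : C) (n : nat) : C := Csum (fun i => RtoC (kap i) * w ^ i)%C n.

(** By the parallelogram law the sum of the squares doubles on the unit circle, and at
    most doubles inside the disc. *)
Lemma rudin_shapiro_bound s w :
  Cmod w <= 1 ->
  Cmod (Rpoly (fst (rudin_shapiro s)) w (2 ^ s)) ^ 2
  + Cmod (Rpoly (snd (rudin_shapiro s)) w (2 ^ s)) ^ 2 <= 2 * 2 ^ s.
Proof.
  intros Hw. unfold Rpoly. induction s as [|s IH].
  - cbn [Nat.pow Csum rudin_shapiro fst snd Nat.eqb Cpow].
    replace (0 + 1 * 1)%C with (RtoC 1) by ring. rewrite Cmod_1. simpl; lra.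
  - cbn [rudin_shapiro fst snd].
    replace (2 ^ S s)%nat with (2 ^ s + 2 ^ s)%nat by (simpl; lia).
    set (L := (2 ^ s)%nat) in *. rewrite !Csum_add.
    set (P := fst (rudin_shapiro s)) in *. set (Q := snd (rudin_shapiro s)) in *.
    set (a := Csum (fun i => P i * w ^ i)%C L) in *.
    set (b := Csum (fun i => Q i * w ^ i)%C L) in *.
    assert (E1 : forall g : nat -> R,
      Csum (fun i => RtoC (if Nat.ltb i L then P i else g i) * w ^ i)%C L = a).
    { intros g. apply Csum_ext. intros i Hi. now rewrite (proj2 (Nat.ltb_lt i L) Hi). }
    rewrite !E1.
    assert (E2 : Csum (fun i => RtoC (if Nat.ltb (L + i) L then P (L + i)%nat
        else Q (L + i - L)%nat) * w ^ (L + i))%C L = (w ^ L * b)%C).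
    { unfold b. rewrite <- Csum_scal. apply Csum_ext. intros i Hi.
      destruct (Nat.ltb_spec (L + i) L); [lia|].
      replace (L + i - L)%nat with i by lia. rewrite Cpow_add_r. ring. }
    assert (E3 : Csum (fun i => RtoC (if Nat.ltb (L + i) L then P (L + i)%nat
        else - Q (L + i - L)%nat) * w ^ (L + i))%C L = (- (w ^ L * b))%C).
    { replace (- (w ^ L * b))%C with ((- w ^ L) * b)%C by ring.
      unfold b. rewrite <- Csum_scal. apply Csum_ext. intros i Hi.
      destruct (Nat.ltb_spec (L + i) L); [lia|].
      replace (L + i - L)%nat with i by lia. rewrite Cpow_add_r, RtoC_opp. ring. }
    rewrite E2, E3. fold (a - w ^ L * b)%C. rewrite parallelogram.
    assert (Cmod (w ^ L * b)%C ^ 2 <= Cmod b ^ 2).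
    { apply pow_incr. split; [apply Cmod_ge_0|]. rewrite Cmod_mult, Cmod_pow.
      rewrite <- (Rmult_1_l (Cmod b)) at 2. apply Rmult_le_compat_r; [apply Cmod_ge_0|].
      rewrite <- (pow1 L). apply pow_incr. split; [apply Cmod_ge_0|auto]. }
    change (2 ^ S s) with (2 * 2 ^ s). lra.
Qed.

(** Kernels with means of order [L ^ sig], for [L = 2 ^ s].  The spacing [d] leaves room
    for the coefficients of a polynomial between two consecutive terms. *)
Definition kernel_family (p : Rbar) (sig : R) : Prop :=
  exists C0, 0 < C0 /\ forall s d, (1 <= d)%nat -> exists kap : nat -> R,
    (forall i, Rabs (kap i) <= 1) /\
    2 ^ s / 2 <= hits kap (4 * 2 ^ s) /\
    forall r, 0 < r < 1 ->
      mean_le p (fun t => Cmod (kernel_poly kap (2 ^ s) (circle_pow r d t)))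
        (C0 * Rpower (2 ^ s) sig).

Lemma kernel_poly_short kap L w :
  (forall i, (L <= i)%nat -> kap i = 0) -> kernel_poly kap L w = Rpoly kap w L.
Proof.
  intros H. unfold kernel_poly, Rpoly. apply Csum_stable; [lia|].
  intros i Hi. rewrite H by auto. ring.
Qed.

Lemma hits_sign (kap : nat -> R) n :
  (forall i, (i < n)%nat -> kap i = 1 \/ kap i = -1) ->
  hits kap n + hits (fun i => - kap i) n = INR n.
Proof.
  intros H. unfold hits. rewrite <- Rsum_plus.
  rewrite <- (Rmult_1_r (INR n)), <- Rsum_const. apply Rsum_ext. intros i Hi.
  destruct (H i Hi) as [->| ->]; repeat destruct Req_EM_T; lra.
Qed.

Lemma hits_mono kap n m : (n <= m)%nat -> hits kap n <= hits kap m.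
Proof. apply Rsum_mono. intros i. destruct Req_EM_T; lra. Qed.

(** The Rudin-Shapiro polynomials are of order [sqrt L] uniformly in the disc.  Their
    coefficients are signs; changing the sign of the polynomial if necessary, at least
    half of them are [+1]. *)
Lemma kernel_family_sup p : Rbar_le 1 p -> kernel_family p (1 / 2).
Proof.
  intros Hp. exists 2. split; [lra|]. intros s d Hd.
  set (P := fst (rudin_shapiro s)).
  assert (HP1 : forall i, (i < 2 ^ s)%nat -> P i = 1 \/ P i = -1)
    by (intros; now apply (rudin_shapiro_coef s i)).
  assert (HP0 : forall i, (2 ^ s <= i)%nat -> P i = 0)
    by (intros; now apply (rudin_shapiro_coef s i)).
  assert (HPa : forall i, Rabs (P i) <= 1).
  { intros i. destruct (Nat.lt_ge_cases i (2 ^ s)) as [Hi|Hi].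
    - destruct (HP1 i Hi) as [->| ->]; apply Rabs_le; lra.
    - rewrite HP0, Rabs_R0 by auto. lra. }
  assert (Hpos : 0 < 2 ^ s) by (apply pow_lt; lra).
  assert (HL : INR (2 ^ s) = 2 ^ s) by (rewrite pow_INR; reflexivity).
  assert (Hb : forall w, Cmod w <= 1 ->
     Cmod (Rpoly P w (2 ^ s)) <= 2 * Rpower (2 ^ s) (1 / 2)).
  { intros w Hw. pose proof (rudin_shapiro_bound s w Hw) as B. fold P in B.
    pose proof (pow2_ge_0 (Cmod (Rpoly (snd (rudin_shapiro s)) w (2 ^ s)))).
    pose proof (Rpower_pos (2 ^ s) (1 / 2)).
    apply Rsqr_incr_0_var; [|lra]. rewrite !Rsqr_pow2, Rpow_mult_distr.
    rewrite <- (Rpower_pow 2 (Rpower _ _)), Rpower_mult by auto.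
    replace (1 / 2 * INR 2) with 1 by (simpl; lra). rewrite Rpower_1 by auto. lra. }
  assert (Hgoal : forall kap : nat -> R, (forall i, Rabs (kap i) <= 1) ->
     (forall i, (2 ^ s <= i)%nat -> kap i = 0) ->
     (forall w, Cmod (Rpoly kap w (2 ^ s)) = Cmod (Rpoly P w (2 ^ s))) ->
     2 ^ s / 2 <= hits kap (2 ^ s) -> exists kap : nat -> R,
    (forall i, Rabs (kap i) <= 1) /\
    2 ^ s / 2 <= hits kap (4 * 2 ^ s) /\
    forall r, 0 < r < 1 ->
      mean_le p (fun t => Cmod (kernel_poly kap (2 ^ s) (circle_pow r d t)))
        (2 * Rpower (2 ^ s) (1 / 2))).
  { intros kap K1 K2 K3 K4. exists kap. split; [auto|]. split.
    { eapply Rle_trans; [exact K4|]. apply hits_mono. lia. }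
    intros r Hr. apply mean_le_sup; auto.
    - apply ccont_Cmod, ccont_kernel_poly.
    - pose proof (Rpower_pos (2 ^ s) (1 / 2)). lra.
    - intros t. split; [apply Cmod_ge_0|]. rewrite kernel_poly_short, K3 by auto.
      apply Hb. now apply circle_pow_le_1. }
  pose proof (hits_sign P (2 ^ s) HP1) as HS. rewrite HL in HS.
  destruct (Rle_lt_dec (2 ^ s / 2) (hits P (2 ^ s))) as [H|H].
  - now apply (Hgoal P).
  - apply (Hgoal (fun i => - P i)).
    + intros i. now rewrite Rabs_Ropp.
    + intros i Hi. rewrite HP0 by auto. ring.
    + intros w. unfold Rpoly. rewrite <- Cmod_opp. f_equal.
      replace (- Csum (fun i => RtoC (- P i) * w ^ i) (2 ^ s))%C with
        (- (1) * Csum (fun i => RtoC (- P i) * w ^ i) (2 ^ s))%C by ring.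
      rewrite <- Csum_scal. apply Csum_ext. intros i _. rewrite RtoC_opp. ring.
    + lra.
Qed.

(** ** Products of geometric sums *)

Definition geom_poly (w : C) (L : nat) : C := Csum (fun i => w ^ i)%C L.

Lemma Re_Csum u n : Re (Csum u n) = Rsum (fun i => Re (u i)) n.
Proof. induction n as [|n IH]; simpl; [auto|now rewrite <- IH]. Qed.

Lemma Im_Csum u n : Im (Csum u n) = Rsum (fun i => Im (u i)) n.
Proof. induction n as [|n IH]; simpl; [auto|now rewrite <- IH]. Qed.

Lemma Cmod2_plus a b :
  Cmod (a + b)%C ^ 2 = Cmod a ^ 2 + Cmod b ^ 2 + 2 * (Re a * Re b + Im a * Im b).
Proof. rewrite !Cmod2_alt. destruct a, b; simpl. ring. Qed.

Lemma is_RInt_cos_sum (c : nat -> R) (k : nat -> nat) n :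
  (forall i, (i < n)%nat -> (0 < k i)%nat) ->
  is_RInt (fun t => Rsum (fun i => c i * cos (INR (k i) * t)) n) 0 (2 * PI) 0.
Proof.
  induction n as [|n IH]; intros H; simpl.
  - replace 0 with (scal (2 * PI - 0) 0) at 2 by (unfold scal; simpl; unfold mult; simpl; ring).
    apply (is_RInt_const (V := R_NormedModule)).
  - replace 0 with (plus 0 (scal (c n) 0)) at 2
      by (unfold plus, scal; simpl; unfold mult; simpl; ring).
    apply (is_RInt_plus (V := R_NormedModule)); [apply IH; intros; apply H; lia|].
    apply (is_RInt_scal (V := R_NormedModule)). apply RInt_cos_INR, H. lia.
Qed.

(** Parseval's identity by induction on [L]: the cross terms between [w ^ L] and the
    lower powers are cosines of nonzero frequency. *)
Lemma geom_poly_parseval r d L :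
  0 < r < 1 -> (1 <= d)%nat ->
  exists v, is_RInt (fun t => Cmod (geom_poly (circle_pow r d t) L) ^ 2) 0 (2 * PI) v /\
            v <= 2 * PI * INR L.
Proof.
  intros Hr Hd. pose proof PI_RGT_0.
  set (q := r ^ d).
  assert (Hq : 0 <= q <= 1).
  { unfold q. split; [apply pow_le; lra|]. rewrite <- (pow1 d). apply pow_incr; lra. }
  induction L as [|L (v & Hv & Hvle)].
  - exists 0. split; [|simpl; lra]. unfold geom_poly; cbn [Csum].
    apply is_RInt_ext with (fun _ => 0); [intros; rewrite Cmod_0; simpl; ring|].
    exact (is_RInt_cos_sum (fun _ => 0) (fun _ => 1%nat) 0 ltac:(intros; lia)).
  - exists (v + ((2 * PI - 0) * (q ^ L) ^ 2 + 2 * 0)). split.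
    + apply is_RInt_ext with (fun t => plus (Cmod (geom_poly (circle_pow r d t) L) ^ 2)
        (plus ((q ^ L) ^ 2) (scal 2
           (Rsum (fun i => q ^ i * q ^ L * cos (INR ((L - i) * d) * t)) L)))).
      * intros t _. change (geom_poly (circle_pow r d t) (S L)) with
          (geom_poly (circle_pow r d t) L + circle_pow r d t ^ L)%C.
        rewrite Cmod2_plus. rewrite circle_pow_eq, Cmod_circle_point by (apply pow_le, pow_le; lra).
        fold q. unfold plus, scal; simpl; unfold mult; simpl.
        rewrite Rplus_assoc. f_equal. f_equal. f_equal.
        unfold geom_poly. rewrite Re_Csum, Im_Csum.
        rewrite (Rmult_comm (Rsum (fun i => Re _) L)), (Rmult_comm (Rsum (fun i => Im _) L)).
        rewrite <- !Rsum_scal, <- Rsum_plus. apply Rsum_ext. intros i Hi.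
        rewrite circle_pow_eq. fold q. unfold circle_point; simpl.
        rewrite mult_INR, minus_INR by lia.
        replace ((INR L - INR i) * INR d * t) with (INR L * (INR d * t) - INR i * (INR d * t)) by ring.
        rewrite cos_minus. ring.
      * apply (is_RInt_plus (V := R_NormedModule)); [auto|].
        apply (is_RInt_plus (V := R_NormedModule)).
        -- apply (is_RInt_const (V := R_NormedModule) 0 (2 * PI) ((q ^ L) ^ 2)).
        -- apply (is_RInt_scal (V := R_NormedModule)).
           apply (is_RInt_cos_sum (fun i => q ^ i * q ^ L) (fun i => (L - i) * d)%nat).
           intros i Hi. nia.
    + rewrite S_INR. assert ((q ^ L) ^ 2 <= 1).
      { rewrite <- (pow1 2). apply pow_incr. split; [now apply pow_le|].
        rewrite <- (pow1 L). now apply pow_incr. }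
      assert (2 * PI * (q ^ L) ^ 2 <= 2 * PI * 1) by (apply Rmult_le_compat_l; lra).
      lra.
Qed.

(** [L] times this is the number of ways to write [i] as [a + b] with [a < L] and
    [b < 2 * L]: the coefficients of a de la Vallee Poussin kernel, equal to [1] on the
    plateau [L <= i < 2 * L]. *)
Definition trapezoid (L i : nat) : R :=
  Rsum (fun a => if andb (Nat.leb a i) (Nat.ltb i (a + 2 * L)) then / INR L else 0) L.

Lemma trapezoid_range L i : (1 <= L)%nat -> 0 <= trapezoid L i <= 1.
Proof.
  intros HL. apply le_INR in HL. simpl in HL.
  assert (P : 0 < / INR L) by (apply Rinv_0_lt_compat; lra).
  unfold trapezoid. split.
  - apply Rsum_nonneg. intros. destruct andb; lra.
  - apply Rle_trans with (Rsum (fun _ => / INR L) L).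
    + apply Rsum_le. intros. destruct andb; lra.
    + rewrite Rsum_const, Rinv_r; lra.
Qed.

Lemma trapezoid_one L i : (1 <= L)%nat -> (L <= i < 2 * L)%nat -> trapezoid L i = 1.
Proof.
  intros HL Hi. unfold trapezoid. rewrite (Rsum_ext _ (fun _ => / INR L)).
  - apply le_INR in HL. simpl in HL. rewrite Rsum_const, Rinv_r; lra.
  - intros a Ha. rewrite (proj2 (Nat.leb_le a i)), (proj2 (Nat.ltb_lt i (a + 2 * L))) by lia.
    reflexivity.
Qed.

Lemma RtoC_Rsum u n : RtoC (Rsum u n) = Csum (fun i => RtoC (u i)) n.
Proof. induction n as [|n IH]; simpl; [auto|]. now rewrite RtoC_plus, IH. Qed.

Lemma trapezoid_poly L w :
  (1 <= L)%nat ->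
  kernel_poly (trapezoid L) L w = (/ INR L * (geom_poly w L * geom_poly w (2 * L)))%C.
Proof.
  intros HL. unfold kernel_poly, trapezoid.
  rewrite (Csum_ext _ (fun i => Csum (fun a =>
    RtoC (if andb (Nat.leb a i) (Nat.ltb i (a + 2 * L)) then / INR L else 0) * w ^ i)%C L)).
  2:{ intros i _. rewrite RtoC_Rsum, Cmult_comm, <- Csum_scal.
      apply Csum_ext. intros; ring. }
  rewrite Csum_switch.
  replace (/ INR L * (geom_poly w L * geom_poly w (2 * L)))%C
    with ((/ INR L * geom_poly w (2 * L)) * geom_poly w L)%C by ring.
  unfold geom_poly at 2. rewrite <- Csum_scal. apply Csum_ext. intros a Ha.
  replace (4 * L)%nat with (a + (2 * L + (2 * L - a)))%nat by lia.
  rewrite !Csum_add.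
  rewrite (Csum_ext _ (fun _ => RtoC 0)).
  2:{ intros i Hi. destruct (Nat.leb_spec a i); [lia|]. simpl. ring. }
  rewrite Csum_zero.
  rewrite (Csum_ext (fun i => RtoC (if andb (Nat.leb a (a + i)) (Nat.ltb (a + i) (a + 2 * L))
     then / INR L else 0) * w ^ (a + i))%C (fun i => / INR L * w ^ a * w ^ i)%C).
  2:{ intros i Hi. rewrite (proj2 (Nat.leb_le _ _)), (proj2 (Nat.ltb_lt _ _)) by lia.
      simpl andb. cbv iota. rewrite RtoC_inv, Cpow_add_r; [ring|]. apply not_0_INR; lia. }
  rewrite Csum_scal.
  rewrite (Csum_ext (fun i => RtoC (if andb (Nat.leb a (a + (2 * L + i)))
     (Nat.ltb (a + (2 * L + i)) (a + 2 * L)) then / INR L else 0) * w ^ (a + (2 * L + i)))%C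
     (fun _ => RtoC 0)).
  2:{ intros i Hi. rewrite (proj2 (Nat.ltb_ge _ _)) by lia. rewrite Bool.andb_false_r. ring. }
  rewrite Csum_zero. unfold geom_poly. change (fun i => w ^ i)%C with (Cpow w). ring.
Qed.

Lemma geom_poly_le w L : Cmod w <= 1 -> Cmod (geom_poly w L) <= INR L.
Proof.
  intros Hw. eapply Rle_trans; [apply Cmod_Csum|].
  rewrite <- (Rmult_1_r (INR L)), <- Rsum_const. apply Rsum_le. intros i _.
  rewrite Cmod_pow, <- (pow1 i). apply pow_incr. split; [apply Cmod_ge_0|auto].
Qed.

(** The kernel is the product of geometric sums of lengths [L] and [2 * L], divided by
    [L].  It is at most [2 * L], and by Parseval and the inequality of the means its
    integral mean is at most [3 / 2]; interpolating, the mean of its power [p] is of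
    order [L ^ (p - 1)]. *)
Lemma kernel_family_low (p : R) : 1 <= p <= 2 -> kernel_family p (1 - / p).
Proof.
  intros Hp. exists 4. split; [lra|]. intros s d Hd.
  set (L := (2 ^ s)%nat).
  assert (HL : INR L = 2 ^ s) by (unfold L; rewrite pow_INR; reflexivity).
  assert (HL1 : (1 <= L)%nat) by (unfold L; pose proof (Nat.pow_nonzero 2 s); lia).
  assert (HLR : 1 <= INR L) by (apply le_INR in HL1; exact HL1).
  exists (trapezoid L). split; [|split].
  - intros i. pose proof (trapezoid_range L i HL1). apply Rabs_le; lra.
  - rewrite <- HL. unfold hits.
    replace (4 * L)%nat with (L + (L + 2 * L))%nat by lia. rewrite !Rsum_add.
    assert (H0 : forall k n, 0 <= Rsum (fun i => if Req_EM_T (trapezoid L (k + i)) 1 then 1 else 0) n).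
    { intros k n. apply Rsum_nonneg. intros. destruct Req_EM_T; lra. }
    rewrite (Rsum_ext (fun i => if Req_EM_T (trapezoid L (L + i)) 1 then 1 else 0) (fun _ => 1)).
    + rewrite Rsum_const.
      assert (0 <= Rsum (fun i => if Req_EM_T (trapezoid L i) 1 then 1 else 0) L)
        by (apply (H0 0%nat)).
      assert (0 <= Rsum (fun i => if Req_EM_T (trapezoid L (L + (L + i))) 1 then 1 else 0) (2 * L)).
      { apply Rsum_nonneg. intros. destruct Req_EM_T; lra. }
      lra.
    + intros i Hi. rewrite trapezoid_one by lia. destruct Req_EM_T; lra.
  - intros r Hr. set (X := fun t => Cmod (kernel_poly (trapezoid L) L (circle_pow r d t))).
    assert (Xc : forall t, continuous X t) by (apply ccont_Cmod, ccont_kernel_poly).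
    assert (X0 : forall t, 0 <= X t) by (intros; apply Cmod_ge_0).
    rewrite <- HL.
    pose proof (Rpower_pos (INR L) (1 - / p)).
    split; [auto|]. split; [auto|]. split; [lra|]. pose proof PI_RGT_0.
    assert (PL : 0 < / INR L) by (apply Rinv_0_lt_compat; lra).
    assert (EX : forall t, X t = / INR L * (Cmod (geom_poly (circle_pow r d t) L)
                                     * Cmod (geom_poly (circle_pow r d t) (2 * L)))).
    { intros t. unfold X. rewrite trapezoid_poly by auto.
      rewrite !Cmod_mult. rewrite <- RtoC_inv, Cmod_R, Rabs_pos_eq by lra. reflexivity. }
    assert (Xsup : forall t, X t <= 2 * INR L).
    { intros t. rewrite EX. pose proof (circle_pow_le_1 r d t Hr) as Hw.
      pose proof (geom_poly_le _ L Hw). pose proof (geom_poly_le _ (2 * L) Hw) as G2.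
      rewrite mult_INR in G2. simpl INR in G2.
      apply Rle_trans with (/ INR L * (INR L * ((1 + 1) * INR L))).
      - apply Rmult_le_compat_l; [lra|]. apply Rmult_le_compat; auto; apply Cmod_ge_0.
      - right; field; lra. }
    assert (Xmean : RInt X 0 (2 * PI) <= 2 * PI * (3 / 2)).
    { destruct (geom_poly_parseval r d L Hr Hd) as (v1 & V1 & B1).
      destruct (geom_poly_parseval r d (2 * L) Hr Hd) as (v2 & V2 & B2).
      rewrite mult_INR in B2. simpl INR in B2.
      pose proof (is_RInt_plus (V := R_NormedModule) _ _ _ _ _ _ V1 V2) as V.
      apply (is_RInt_scal (V := R_NormedModule) _ _ _ (/ (2 * INR L))) in V.
      apply Rle_trans with (/ (2 * INR L) * (v1 + v2)).
      - rewrite <- (is_RInt_unique _ _ _ _ V : RInt _ _ _ = / (2 * INR L) * (v1 + v2)).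
        apply RInt_le; [lra|now apply ex_RInt_cont|eexists; exact V|].
        intros t _. unfold plus, scal; simpl; unfold mult; simpl. rewrite !Rmult_1_r.
        rewrite EX. set (x := Cmod _). set (y := Cmod _).
        rewrite Rinv_mult, (Rmult_comm (/ 2)), Rmult_assoc.
        apply Rmult_le_compat_l; [lra|]. pose proof (Rle_0_sqr (x - y)) as S. unfold Rsqr in S. lra.
      - apply (Rmult_le_reg_l (2 * INR L)); [lra|].
        rewrite <- Rmult_assoc, Rinv_r by lra. lra. }
    assert (Hpt : forall t, pow0 (X t) p <= Rpower (2 * INR L) (p - 1) * X t).
    { intros t. destruct (X0 t) as [Ht|Ht].
      - rewrite pow0_pos by auto. replace p with (p - 1 + 1) at 1 by ring.
        rewrite Rpower_plus, Rpower_1 by auto. apply Rmult_le_compat_r; [lra|].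
        apply Rle_Rpower_l; [lra|]. split; auto.
      - rewrite <- Ht, pow0_0. lra. }
    apply Rle_trans with (RInt (fun t => Rpower (2 * INR L) (p - 1) * X t) 0 (2 * PI)).
    + apply RInt_le; [lra|apply pow0_ex_RInt; [lra|auto|auto]| |auto].
      apply (ex_RInt_scal (V := R_NormedModule)). now apply ex_RInt_cont.
    + rewrite (RInt_scal (V := R_CompleteNormedModule)) by (now apply ex_RInt_cont).
      unfold scal; simpl; unfold mult; simpl.
      pose proof (Rpower_pos (2 * INR L) (p - 1)).
      apply Rle_trans with (Rpower (2 * INR L) (p - 1) * (2 * PI * (3 / 2))).
      * apply Rmult_le_compat_l; lra.
      * rewrite <- !Rpower_mult_distr by lra. rewrite Rpower_mult.
        replace ((1 - / p) * p) with (p - 1) by (field; lra).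
        pose proof (Rpower_pos (INR L) (p - 1)).
        assert (Rpower 2 (p - 1) <= 2).
        { rewrite <- (Rpower_1 2) at 2 by lra. apply Rle_Rpower; lra. }
        assert (4 <= Rpower 4 p).
        { rewrite <- (Rpower_1 4) at 1 by lra. apply Rle_Rpower; lra. }
        replace (Rpower 2 (p - 1) * Rpower (INR L) (p - 1) * (2 * PI * (3 / 2)))
          with (2 * PI * (Rpower 2 (p - 1) * (3 / 2) * Rpower (INR L) (p - 1))) by ring.
        apply Rmult_le_compat_l; [lra|]. apply Rmult_le_compat_r; lra.
Qed.

(** For [q <= 2] the exponent is [1 / 2] and sup bounds suffice; for [q > 2] it is
    [1 / q = 1 - 1 / p], with [p < 2]. *)
Lemma kernel_family_conjugate p q :
  conjugate_exponents p q -> kernel_family p (real (Rbar_inv (Rbar_max 2 q))) /\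
    0 <= real (Rbar_inv (Rbar_max 2 q)) <= 1 / 2.
Proof.
  intros (Hp & Hq & E). unfold Rbar_max.
  destruct p as [p| |]; simpl in Hp; [| |easy].
  - destruct q as [q| |]; simpl in Hq; [| |easy].
    + simpl in E. injection E as E.
      assert (Hip : 0 < / p) by (apply Rinv_0_lt_compat; lra).
      destruct (Rbar_le_dec 2 q) as [H|H]; simpl in *.
      * assert (Hiq : 0 < / q <= / 2)
          by (split; [apply Rinv_0_lt_compat; lra|apply Rinv_le_contravar; lra]).
        split; [|lra]. replace (/ q) with (1 - / p) by lra.
        apply kernel_family_low. split; [lra|].
        rewrite <- (Rinv_inv p), <- (Rinv_inv 2). apply Rinv_le_contravar; lra.
      * split; [|lra]. replace (/ 2) with (1 / 2) by lra. now apply kernel_family_sup.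
    + simpl in E. injection E as E.
      destruct (Rbar_le_dec 2 p_infty) as [H|H]; [|now contradict H].
      simpl. split; [|lra]. replace 0 with (1 - / p) by lra.
      apply kernel_family_low. replace p with 1; [lra|].
      rewrite <- (Rinv_inv p). replace (/ p) with 1 by lra. field.
  - destruct q as [q| |]; simpl in Hq; [| |easy].
    + simpl in E. injection E as E.
      assert (q = 1) by (rewrite <- (Rinv_inv q); replace (/ q) with 1 by lra; field). subst q.
      destruct (Rbar_le_dec 2 1) as [H|H]; simpl in *; [lra|].
      split; [|lra]. replace (/ 2) with (1 / 2) by lra. now apply kernel_family_sup.
    + simpl in E. injection E as E. lra.
Qed.


(** * Weighted densities *)

Definition beta_sum (w : nat -> R) (n : nat) : R := Rsum (fun k => w (S k)) n.

Lemma sum_n_m_beta_sum w n : sum_n_m w 1 n = beta_sum w n.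
Proof.
  unfold beta_sum. induction n as [|n IH]; [now rewrite sum_n_m_zero by lia|].
  rewrite sum_n_Sm by lia. rewrite IH. reflexivity.
Qed.

Lemma beta_weight_pos g k : 0 < beta_weight g k.
Proof. apply exp_pos. Qed.

Lemma exp_le x y : x <= y -> exp x <= exp y.
Proof. intros [H| ->]; [left; now apply exp_increasing|lra]. Qed.

Lemma beta_weight_mono g k n :
  0 <= g -> (1 <= k <= n)%nat -> beta_weight g k <= beta_weight g n.
Proof.
  intros Hg Hk. unfold beta_weight. apply exp_le, Rle_Rpower_l; [auto|].
  split; [apply lt_0_INR; lia|apply le_INR; lia].
Qed.

(** Induction on [n].  Since [(n + 1) ^ g - n ^ g >= g / x] with
    [x = (n + 1) ^ (1 - g)], the weights grow at least by the factor [1 + g / x] in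
    one step, and the step closes when [K * g >= 2].  For [g = 0] the weights are
    constant and [K = 1] serves. *)
Lemma beta_sum_bound g :
  0 <= g <= 1 -> exists K, 0 < K /\ forall n, (1 <= n)%nat ->
    beta_sum (beta_weight g) n <= K * Rpower (INR n) (1 - g) * beta_weight g n.
Proof.
  intros Hg.
  set (K := if Req_EM_T g 0 then 1 else 2 / g).
  assert (HK1 : 1 <= K).
  { unfold K. destruct Req_EM_T; [lra|].
    apply (Rmult_le_reg_r g); [lra|]. unfold Rdiv. rewrite Rmult_assoc, Rinv_l; lra. }
  exists K. split; [lra|]. intros n Hn.
  induction n as [|n IH]; [lia|]. unfold beta_sum in *. simpl Rsum.
  destruct (Nat.eq_dec n 0) as [->|Hn0].
  { simpl Rsum. simpl INR. rewrite Rpower_one_base.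
    pose proof (beta_weight_pos g 1).
    rewrite Rplus_0_l, Rmult_1_r. rewrite <- (Rmult_1_l (beta_weight g 1)) at 1.
    apply Rmult_le_compat_r; lra. }
  specialize (IH ltac:(lia)).
  set (u := INR (S n)). assert (Hu : 2 <= u) by (unfold u; rewrite S_INR;
    assert (1 <= INR n) by (apply (le_INR 1); lia); lra).
  assert (En : INR n = u - 1) by (unfold u; rewrite S_INR; ring).
  pose proof (beta_weight_pos g (S n)) as Hb.
  set (x := Rpower u (1 - g)).
  assert (Hx : 1 <= x).
  { unfold x. rewrite <- (Rpower_O u) at 1 by lra. apply Rle_Rpower; lra. }
  assert (Hratio : beta_weight g n <= / (1 + g / x) * beta_weight g (S n)).
  { assert (0 <= g / x) by (apply Rmult_le_pos; [lra|left; apply Rinv_0_lt_compat; lra]).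
    assert (E : Rpower (INR n) g + g / x <= Rpower u g).
    { rewrite En. replace (u - 1) with (u * (1 - / u)) by (field; lra).
      assert (0 < 1 - / u) by (assert (/ u <= / 2) by (apply Rinv_le_contravar; lra); lra).
      rewrite <- Rpower_mult_distr by lra.
      pose proof (Rpower_bernoulli_concave (1 - / u) g ltac:(lra) Hg) as B.
      assert (Ex : g / x = Rpower u g * (g * / u)).
      { unfold x. replace (Rpower u g) with (u * / Rpower u (1 - g)).
        - field. pose proof (Rpower_pos u (1 - g)). split; lra.
        - rewrite <- Rpower_Ropp. rewrite <- (Rpower_1 u) at 1 by lra.
          rewrite <- Rpower_plus. f_equal. ring. }
      rewrite Ex. pose proof (Rpower_pos u g). 
      replace (Rpower u g) with (Rpower u g * 1) at 3 by ring.
      rewrite <- Rmult_plus_distr_l. apply Rmult_le_compat_l; lra. }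
    unfold beta_weight. fold u.
    apply Rle_trans with (exp (Rpower u g - g / x)); [apply exp_le; lra|].
    unfold Rminus. rewrite exp_plus, exp_Ropp, Rmult_comm.
    apply Rmult_le_compat_r; [left; apply exp_pos|].
    apply Rinv_le_contravar; [lra|]. apply exp_ineq1_le. }
  assert (Hpow : 0 < Rpower (INR n) (1 - g)) by apply Rpower_pos.
  apply Rle_trans with (K * Rpower (INR n) (1 - g) * (/ (1 + g / x) * beta_weight g (S n))
                          + beta_weight g (S n)).
  { apply Rplus_le_compat_r. eapply Rle_trans; [exact IH|].
    apply Rmult_le_compat_l; [|auto]. apply Rmult_le_pos; lra. }
  replace (K * Rpower (INR n) (1 - g) * (/ (1 + g / x) * beta_weight g (S n))
     + beta_weight g (S n)) with
    ((K * Rpower (INR n) (1 - g) * / (1 + g / x) + 1) * beta_weight g (S n)) by ring.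
  apply Rmult_le_compat_r; [lra|].
  unfold K. destruct (Req_EM_T g 0) as [->|Hg0].
  - unfold x. replace (1 - 0) with 1 by ring. rewrite !Rpower_1 by lra.
    rewrite En. unfold Rdiv. rewrite Rmult_0_l, Rplus_0_r, Rinv_1. lra.
  - assert (Hmono : Rpower (INR n) (1 - g) <= x).
    { unfold x. apply Rle_Rpower_l; [lra|]. rewrite En. lra. }
    apply Rle_trans with (2 / g * x * / (1 + g / x) + 1).
    + apply Rplus_le_compat_r. apply Rmult_le_compat_r.
      * assert (0 <= g / x) by (apply Rmult_le_pos; [lra|left; apply Rinv_0_lt_compat; lra]).
        left; apply Rinv_0_lt_compat; lra.
      * apply Rmult_le_compat_l; [|auto]. apply Rmult_le_pos; [lra|].
        left; apply Rinv_0_lt_compat; lra.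
    + apply (Rmult_le_reg_r (g * (x + g))); [apply Rmult_lt_0_compat; lra|].
      replace ((2 / g * x * / (1 + g / x) + 1) * (g * (x + g)))
        with (2 * x * x + g * (x + g)) by (field; lra).
      replace (2 / g * x * (g * (x + g))) with (2 * x * (x + g)) by (field; lra).
      assert (g * (x + g) <= 2 * x * g); [|lra].
      assert (g * g <= g * x) by (apply Rmult_le_compat_l; lra). lra.
Qed.

(** Over a window of length [D * N ^ (1 - g)] the exponent [n ^ g] increases by at most
    [D], so a positive proportion of all the weight sits in the window. *)
Lemma beta_sum_window g D :
  0 <= g <= 1 -> 0 <= D -> exists K, 0 < K /\ forall N n, (1 <= N <= n)%nat ->
    INR n <= INR N + D * Rpower (INR N) (1 - g) ->
    beta_sum (beta_weight g) n <= K * Rpower (INR N) (1 - g) * beta_weight g N.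
Proof.
  intros Hg HD. destruct (beta_sum_bound g Hg) as (K & HK & H).
  exists (K * (1 + D) * exp D). split.
  { pose proof (exp_pos D). repeat apply Rmult_lt_0_compat; lra. }
  intros N n HN Hn. eapply Rle_trans; [apply H; lia|].
  assert (HN1 : 1 <= INR N) by (apply (le_INR 1); lia).
  assert (HNn : INR N <= INR n) by (apply le_INR; lia).
  set (P := Rpower (INR N) (1 - g)) in *.
  assert (HP : 1 <= P <= INR N) by (apply Rpower_le_base; lra).
  assert (A : Rpower (INR n) (1 - g) <= (1 + D) * P).
  { apply Rle_trans with (Rpower ((1 + D) * INR N) (1 - g)).
    - apply Rle_Rpower_l; [lra|]. split; [lra|].
      assert (D * P <= D * INR N) by (apply Rmult_le_compat_l; lra). lra.
    - rewrite <- Rpower_mult_distr by lra. apply Rmult_le_compat_r; [lra|].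
      apply Rpower_le_base; lra. }
  assert (B : beta_weight g n <= exp D * beta_weight g N).
  { unfold beta_weight. rewrite <- exp_plus. apply exp_le.
    apply Rle_trans with (Rpower (INR N * (1 + D * P / INR N)) g).
    - apply Rle_Rpower_l; [lra|]. split; [lra|].
      replace (INR N * (1 + D * P / INR N)) with (INR N + D * P) by (field; lra). auto.
    - assert (HDP : 0 <= D * P / INR N).
      { apply Rmult_le_pos; [apply Rmult_le_pos; lra|left; apply Rinv_0_lt_compat; lra]. }
      rewrite <- Rpower_mult_distr by lra.
      pose proof (Rpower_bernoulli_concave (1 + D * P / INR N) g ltac:(lra) Hg) as Bn.
      replace (1 + D * P / INR N - 1) with (D * P / INR N) in Bn by ring.
      pose proof (Rpower_pos (INR N) g) as HR.
      apply Rle_trans with (Rpower (INR N) g * (1 + g * (D * P / INR N))).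
      + apply Rmult_le_compat_l; lra.
      + assert (E : Rpower (INR N) g * P = INR N).
        { unfold P. rewrite <- Rpower_plus. replace (g + (1 - g)) with 1 by ring.
          apply Rpower_1; lra. }
        replace (Rpower (INR N) g * (1 + g * (D * P / INR N))) with
          (Rpower (INR N) g + g * D * (Rpower (INR N) g * P) / INR N) by (field; lra).
        rewrite E. replace (g * D * INR N / INR N) with (g * D) by (field; lra).
        assert (g * D <= 1 * D) by (apply Rmult_le_compat_r; lra). lra. }
  replace (K * (1 + D) * exp D * P * beta_weight g N) with
    (K * ((1 + D) * P) * (exp D * beta_weight g N)) by ring.
  pose proof (beta_weight_pos g n). pose proof (Rpower_pos (INR n) (1 - g)).
  apply Rmult_le_compat; [apply Rmult_le_pos; lra|lra| |auto].
  apply Rmult_le_compat_l; lra.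
Qed.

Lemma beta_weight_on_nonneg g E k : 0 <= beta_weight_on g E k.
Proof.
  unfold beta_weight_on. destruct excluded_middle_informative; [|lra].
  left; apply beta_weight_pos.
Qed.

(** The weights increase, so every hit in the window counts at least as much as its
    first point. *)
Lemma beta_sum_hits g (E : nat -> Prop) kap N d i :
  0 <= g -> (1 <= N)%nat -> (1 <= d)%nat ->
  (forall j, (j < i)%nat -> kap j = 1 -> E (N + j * d)%nat) ->
  beta_weight g N * hits kap i <= beta_sum (beta_weight_on g E) (N - 1 + i * d).
Proof.
  intros Hg HN Hd. unfold beta_sum, hits.
  induction i as [|i IH]; intros H; simpl Rsum.
  - rewrite Rmult_0_r. apply Rsum_nonneg. intros; apply beta_weight_on_nonneg.
  - specialize (IH ltac:(intros; apply H; [lia|auto])).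
    apply Rle_trans with (Rsum (fun k => beta_weight_on g E (S k)) (S (N - 1 + i * d))).
    + simpl Rsum. rewrite Rmult_plus_distr_l. apply Rplus_le_compat; [exact IH|].
      pose proof (beta_weight_on_nonneg g E (S (N - 1 + i * d))).
      destruct (Req_EM_T (kap i) 1) as [Hk|Hk]; [|lra].
      replace (S (N - 1 + i * d)) with (N + i * d)%nat by lia.
      unfold beta_weight_on. destruct excluded_middle_informative as [_|Hn].
      * rewrite Rmult_1_r. apply beta_weight_mono; [auto|lia].
      * destruct Hn. apply H; [lia|auto].
    + apply Rsum_mono; [intros; apply beta_weight_on_nonneg|]. simpl; lia.
Qed.

Lemma upper_density_pos g E del :
  0 < del ->
  (forall n0, exists n, (n0 <= n)%nat /\ (1 <= n)%nat /\
     del * beta_sum (beta_weight g) n <= beta_sum (beta_weight_on g E) n) ->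
  Rbar_lt 0 (upper_density g E).
Proof.
  intros Hdel H. unfold upper_density.
  set (u := fun n => _).
  assert (Hu : forall n0, exists n, (n0 <= n)%nat /\ del <= u n).
  { intros n0. destruct (H n0) as (n & Hn & Hn1 & Hle). exists n. split; [auto|].
    unfold u. rewrite !sum_n_m_beta_sum.
    assert (0 < beta_sum (beta_weight g) n).
    { unfold beta_sum. destruct n as [|n]; [lia|]. simpl.
      pose proof (Rsum_nonneg (fun k => beta_weight g (S k)) n
        (fun k _ => Rlt_le _ _ (beta_weight_pos g (S k)))).
      pose proof (beta_weight_pos g (S n)). lra. }
    apply (Rmult_le_reg_r (beta_sum (beta_weight g) n)); [auto|].
    unfold Rdiv. rewrite Rmult_assoc, Rinv_l; lra. }
  destruct (ex_LimSup_seq u) as [l Hl]. rewrite (is_LimSup_seq_unique u l Hl).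
  destruct l as [l| |]; simpl in *; [|auto|].
  - destruct (Rlt_le_dec 0 l) as [|Hl0]; [auto|exfalso].
    assert (P : 0 < del / 2) by lra.
    destruct (Hl (mkposreal _ P)) as [_ [N HN]]. simpl in HN.
    destruct (Hu N) as (n & Hn & Hun). specialize (HN n Hn). lra.
  - destruct (Hl 0) as [N HN]. destruct (Hu N) as (n & Hn & Hun). specialize (HN n Hn). lra.
Qed.


(** * Blocks *)

(** The product of the weights that carry the coefficient of index [n + j] to index [j]
    under [n] shifts. *)
Definition shift_factor (al : R) (n j : nat) : R :=
  Rpower (INR (n + j + 1) / INR (j + 1)) al.

(** Around each unit coefficient of the kernel, spread out by [d] and moved to [N], sits
    a copy of the polynomial [q], divided by the weights that the shift will multiply
    it with.  The factor [N ^ (- al)] replaces the exact [(n + j + 1) ^ (- al)], which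
    would spoil the factorization of the block; the windows are so short, relatively to
    [N], that the difference does not matter. *)
Definition block (al : R) (q : nat -> C) (kap : nat -> R) (N L d n : nat) : C :=
  if andb (Nat.leb N n) (Nat.ltb n (N + 4 * L * d)) then
    (kap ((n - N) / d)%nat * (RtoC (Rpower (INR N) (- al) * Rpower (INR ((n - N) mod d + 1)) al)
                          * q ((n - N) mod d)%nat))%C
  else RtoC 0.

Lemma block_outside al q kap N L d n :
  (n < N \/ N + 4 * L * d <= n)%nat -> block al q kap N L d n = RtoC 0.
Proof.
  intros H. unfold block.
  destruct (Nat.leb_spec N n); destruct (Nat.ltb_spec n (N + 4 * L * d)); simpl; auto; lia.
Qed.

Lemma block_inside al q kap N L d i j :
  (i < 4 * L)%nat -> (j < d)%nat ->
  block al q kap N L d (N + (i * d + j)) =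
  (kap i * (RtoC (Rpower (INR N) (- al) * Rpower (INR (j + 1)) al) * q j))%C.
Proof.
  intros Hi Hj. unfold block.
  assert (Hlt : (i * d + j < 4 * L * d)%nat) by nia.
  rewrite (proj2 (Nat.leb_le _ _)), (proj2 (Nat.ltb_lt _ _)) by lia.
  cbn [andb]. replace (N + (i * d + j) - N)%nat with (i * d + j)%nat by lia.
  rewrite Nat.div_add_l, Nat.div_small, Nat.add_0_r by lia.
  rewrite (Nat.add_comm (i * d) j), Nat.Div0.mod_add, Nat.mod_small by lia. reflexivity.
Qed.

Lemma block_le al q kap N L d A n :
  0 <= al <= 1 -> (1 <= N)%nat -> (1 <= d)%nat -> (forall i, Rabs (kap i) <= 1) ->
  (forall j, INR (j + 1) * Cmod (q j) <= A) ->
  Cmod (block al q kap N L d n) <= Rpower (INR N) (- al) * A.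
Proof.
  intros Hal HN Hd Hkap HA.
  assert (HA0 : 0 <= A).
  { eapply Rle_trans; [|apply (HA 0%nat)]. apply Rmult_le_pos; [apply pos_INR|apply Cmod_ge_0]. }
  pose proof (Rpower_pos (INR N) (- al)) as HP.
  unfold block. destruct andb; [|rewrite Cmod_0; apply Rmult_le_pos; lra].
  set (j := ((n - N) mod d)%nat). pose proof (Rpower_pos (INR (j + 1)) al).
  rewrite !Cmod_mult, !Cmod_R, (Rabs_pos_eq (_ * _)) by (apply Rmult_le_pos; lra).
  rewrite <- (Rmult_1_l (Rpower _ _ * A)).
  assert (HR : Rpower (INR (j + 1)) al <= INR (j + 1)).
  { apply Rpower_le_base; [|lra]. apply (le_INR 1); lia. }
  apply Rmult_le_compat; [apply Rabs_pos| |apply Hkap|].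
  - apply Rmult_le_pos; [apply Rmult_le_pos; lra|apply Cmod_ge_0].
  - rewrite Rmult_assoc. apply Rmult_le_compat_l; [lra|].
    eapply Rle_trans; [|apply (HA j)]. apply Rmult_le_compat_r; [apply Cmod_ge_0|auto].
Qed.

(** The factorization into a power of [z], a kernel in [z ^ d] and a fixed polynomial is
    what gives the block the mean of the kernel. *)
Lemma block_PS al q kap N L d z :
  (1 <= d)%nat ->
  PS (block al q kap N L d) z =
  (z ^ N * (RtoC (Rpower (INR N) (- al)) *
     (kernel_poly kap L (z ^ d) *
      Csum (fun j => RtoC (Rpower (INR (j + 1)) al) * q j * z ^ j) d)))%C.
Proof.
  intros Hd. apply PS_unique.
  set (u := fun n => (block al q kap N L d n * z ^ n)%C).
  replace (z ^ N * _)%C with (Csum u (N + 4 * L * d)).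
  { apply has_sum_finite. intros n Hn. unfold u. rewrite block_outside by lia. ring. }
  rewrite Csum_add.
  rewrite (Csum_ext u (fun _ => RtoC 0)), Csum_zero.
  2:{ intros n Hn. unfold u. rewrite block_outside by lia. ring. }
  rewrite Csum_grouped. unfold kernel_poly.
  set (P := Csum (fun j => RtoC (Rpower (INR (j + 1)) al) * q j * z ^ j)%C d).
  rewrite (Csum_ext _ (fun i => (z ^ N * RtoC (Rpower (INR N) (- al)) * P)
                          * (kap i * (z ^ d) ^ i))%C).
  { rewrite Csum_scal. ring. }
  intros i Hi. unfold P.
  replace (z ^ N * RtoC (Rpower (INR N) (- al)) *
      Csum (fun j => RtoC (Rpower (INR (j + 1)) al) * q j * z ^ j) d * (kap i * (z ^ d) ^ i))%C
    with ((z ^ N * RtoC (Rpower (INR N) (- al)) * (kap i * (z ^ d) ^ i)) *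
      Csum (fun j => RtoC (Rpower (INR (j + 1)) al) * q j * z ^ j) d)%C by ring.
  rewrite <- Csum_scal. apply Csum_ext. intros j Hj. unfold u.
  rewrite block_inside by auto. rewrite RtoC_mult, !Cpow_add_r.
  rewrite <- Cpow_mult_r, (Nat.mul_comm d i). ring.
Qed.

Lemma shift_factor_pos al n j : 0 < shift_factor al n j.
Proof. apply Rpower_pos. Qed.

Lemma shift_factor_le al n j M :
  0 <= al -> INR (n + j + 1) <= M -> shift_factor al n j <= Rpower M al.
Proof.
  intros Hal HM. unfold shift_factor.
  assert (H1 : 1 <= INR (j + 1)) by (apply (le_INR 1); lia).
  assert (H2 : 0 < INR (n + j + 1)) by (apply lt_0_INR; lia).
  apply Rle_Rpower_l; [auto|]. split; [apply Rdiv_lt_0_compat; lra|].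
  eapply Rle_trans; [|exact HM]. apply (Rmult_le_reg_r (INR (j + 1))); [lra|].
  unfold Rdiv. rewrite Rmult_assoc, Rinv_l, Rmult_1_r by lra.
  rewrite <- (Rmult_1_r (INR (n + j + 1))) at 1. apply Rmult_le_compat_l; lra.
Qed.

(** Two errors: below [d] the wrong normalization, at most [del] relatively, because the
    window has relative length [del]; from [d] on the later copies of [q] in the same
    block, which come with the small factor [rho ^ d]. *)
Lemma block_shift_close al q kap N L d A rho del i J :
  0 <= al <= 1 -> (1 <= N)%nat -> (1 <= d)%nat -> (forall i, Rabs (kap i) <= 1) ->
  (forall j, INR (j + 1) * Cmod (q j) <= A) -> (forall J, Rsum (fun j => Cmod (q j)) J <= A) ->
  (forall j, (d <= j)%nat -> q j = RtoC 0) -> 0 <= rho < 1 ->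
  0 <= del <= 1 -> INR (4 * L * d) <= del * INR N -> (i < 4 * L)%nat -> kap i = 1 ->
  Rsum (fun j => Cmod (block al q kap N L d (N + i * d + j) * RtoC (shift_factor al (N + i * d) j)
                       - q j)%C * rho ^ j) J
  <= del * A + 2 * A * rho ^ d / (1 - rho).
Proof.
  intros Hal HN Hd Hkap HA HA' Hq Hrho Hdel HL Hi Hki.
  assert (HNR : 1 <= INR N) by (apply (le_INR 1); auto).
  assert (HA0 : 0 <= A).
  { eapply Rle_trans; [|apply (HA' 0%nat)]. simpl; lra. }
  set (x := fun j => if Nat.ltb j d then del * Cmod (q j) else 0).
  set (y := fun j => if Nat.ltb j d then 0 else 2 * A * rho ^ j).
  apply Rle_trans with (Rsum (fun j => x j + y j) J).
  - apply Rsum_le. intros j _. unfold x, y.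
    assert (Hrj : 0 <= rho ^ j <= 1).
    { split; [apply pow_le; lra|]. rewrite <- (pow1 j). apply pow_incr; lra. }
    destruct (Nat.ltb_spec j d) as [Hj|Hj].
    + replace (N + i * d + j)%nat with (N + (i * d + j))%nat by lia.
      rewrite block_inside, Hki by auto.
      assert (Hup : INR (N + i * d + j + 1) <= INR N + del * INR N).
      { apply Rle_trans with (INR (N + 4 * L * d)).
        - apply le_INR. nia.
        - rewrite plus_INR. lra. }
      assert (Hlow : INR N <= INR (N + i * d + j + 1)) by (apply le_INR; lia).
      set (w := INR (N + i * d + j + 1) / INR N).
      assert (Hw : 1 <= w <= 1 + del).
      { unfold w. split; apply (Rmult_le_reg_r (INR N)); try lra;
          unfold Rdiv; rewrite Rmult_assoc, Rinv_l; lra. }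
      assert (E : Rpower (INR N) (- al) * Rpower (INR (j + 1)) al * shift_factor al (N + i * d) j
                  = Rpower w al).
      { assert (0 < INR (j + 1)) by (apply lt_0_INR; lia).
        assert (0 < / INR (j + 1)) by (now apply Rinv_0_lt_compat).
        assert (0 < / INR N) by (apply Rinv_0_lt_compat; lra).
        unfold shift_factor.
        rewrite Rpower_Ropp. unfold w, Rdiv. rewrite <- !Rpower_mult_distr by lra.
        assert (E1 : Rpower (INR (j + 1)) al * Rpower (/ INR (j + 1)) al = 1)
          by (rewrite Rpower_mult_distr, Rinv_r, Rpower_one_base by lra; auto).
        assert (E2 : Rpower (/ INR N) al = / Rpower (INR N) al).
        { pose proof (Rpower_pos (INR N) al).
          apply (Rmult_eq_reg_l (Rpower (INR N) al)); [|lra].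
          rewrite Rpower_mult_distr, !Rinv_r, Rpower_one_base by lra; auto. }
        rewrite E2.
        transitivity (/ Rpower (INR N) al * Rpower (INR (N + i * d + j + 1)) al
           * (Rpower (INR (j + 1)) al * Rpower (/ INR (j + 1)) al)); [ring|].
        rewrite E1. ring. }
      replace (1 * (RtoC (Rpower (INR N) (- al) * Rpower (INR (j + 1)) al) * q j)
         * RtoC (shift_factor al (N + i * d) j) - q j)%C
        with (RtoC (Rpower (INR N) (- al) * Rpower (INR (j + 1)) al
                * shift_factor al (N + i * d) j - 1) * q j)%C
        by (rewrite RtoC_minus, !RtoC_mult; ring).
      rewrite E, Cmod_mult, Cmod_R, Rplus_0_r.
      pose proof (Rpower_le_base w al ltac:(lra) Hal).
      rewrite Rabs_pos_eq by lra.
      pose proof (Cmod_ge_0 (q j)).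
      assert ((Rpower w al - 1) * Cmod (q j) <= del * Cmod (q j))
        by (apply Rmult_le_compat_r; lra).
      assert (0 <= del * Cmod (q j)) by (apply Rmult_le_pos; lra).
      rewrite <- (Rmult_1_r (del * Cmod (q j))).
      apply Rmult_le_compat; [|lra|auto|lra]. apply Rmult_le_pos; lra.
    + rewrite Rplus_0_l, Hq by auto.
      apply Rmult_le_compat_r; [lra|].
      unfold Cminus. rewrite Copp_0, Cplus_0_r.
      rewrite Cmod_mult, Cmod_R, Rabs_pos_eq by (left; apply shift_factor_pos).
      destruct (Nat.lt_ge_cases (N + i * d + j) (N + 4 * L * d)) as [Hin|Hout].
      * assert (HS : shift_factor al (N + i * d) j <= Rpower (2 * INR N) al).
        { apply shift_factor_le; [lra|].
          apply Rle_trans with (INR (N + 4 * L * d)); [apply le_INR; lia|].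
          rewrite plus_INR. assert (del * INR N <= 1 * INR N) by (apply Rmult_le_compat_r; lra).
          lra. }
        pose proof (shift_factor_pos al (N + i * d) j).
        pose proof (Rpower_pos (INR N) (- al)). pose proof (Rpower_pos (INR N) al).
        apply Rle_trans with (Rpower (INR N) (- al) * A * Rpower (2 * INR N) al).
        -- apply Rmult_le_compat; [apply Cmod_ge_0|lra| |auto].
           now apply block_le.
        -- rewrite <- Rpower_mult_distr by lra. rewrite Rpower_Ropp.
           replace (/ Rpower (INR N) al * A * (Rpower 2 al * Rpower (INR N) al))
             with (Rpower 2 al * A) by (field; lra).
           apply Rmult_le_compat_r; [auto|]. apply Rpower_le_base; lra.
      * rewrite block_outside by lia. rewrite Cmod_0. lra.
  - rewrite Rsum_plus. apply Rplus_le_compat.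
    + apply Rle_trans with (Rsum (fun j => del * Cmod (q j)) J).
      * apply Rsum_le. intros j _. unfold x. destruct Nat.ltb; [lra|].
        apply Rmult_le_pos; [lra|apply Cmod_ge_0].
      * rewrite Rsum_scal. apply Rmult_le_compat_l; [lra|auto].
    + apply Rsum_tail_geom; [lra|lra| |]; intros j Hj; unfold y;
        destruct (Nat.ltb_spec j d); lra || lia.
Qed.

Lemma power_of_two_below x : 1 <= x -> exists s, 2 ^ s <= x < 2 * 2 ^ s.
Proof.
  intros Hx. destruct (Pow_x_infinity 2) with (b := x + 1) as [n Hn]; [rewrite Rabs_pos_eq; lra|].
  specialize (Hn n (le_n _)). rewrite Rabs_pos_eq in Hn by (apply pow_le; lra).
  assert (H : forall n, x < 2 ^ n -> exists s, 2 ^ s <= x < 2 * 2 ^ s).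
  { clear n Hn. induction n as [|n IH]; intros H; [simpl in H; lra|].
    destruct (Rlt_le_dec x (2 ^ n)) as [Hlt|Hle]; [now apply IH|].
    exists n. simpl in H. lra. }
  apply (H n). lra.
Qed.

Lemma pow_small q eps : 0 <= q < 1 -> 0 < eps ->
  exists n0, forall n, (n0 <= n)%nat -> q ^ n <= eps.
Proof.
  intros Hq He. destruct (pow_lt_1_zero q) with (y := eps) as [n0 H]; [rewrite Rabs_pos_eq; lra|auto|].
  exists n0. intros n Hn. specialize (H n Hn). rewrite Rabs_pos_eq in H by (apply pow_le; lra). lra.
Qed.

Lemma INR_large x : exists n0, forall n, (n0 <= n)%nat -> x <= INR n.
Proof.
  destruct (INR_unbounded x) as [n0 H]. exists n0. intros n Hn. apply le_INR in Hn. lra.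
Qed.

(** What the superposition has to know of a block: its place, its size, its mean, and
    the times [H] at which its shifts come near the target, half of whose tolerance is
    left for the other blocks. *)
Record good_block (gam al : R) (p : Rbar) (m : nat) (Cst del : R) (N : nat)
    (b : nat -> C) (nend : nat) (H : nat -> Prop) : Prop := {
  gb_support : forall n, (n < N \/ 2 * N <= n)%nat -> b n = RtoC 0;
  gb_size : forall n, Cmod (b n) <= INR n;
  gb_mean : forall r, 0 < r < 1 ->
    mean_le p (fun t => Cmod (PS b (circle_point r t))) (Cst * r ^ N);
  gb_end : (N <= nend)%nat;
  gb_hit_range : forall n, H n -> (N <= n <= 2 * N)%nat;
  gb_hit : forall n, H n -> forall J,
    Rsum (fun j => Cmod (b (n + j)%nat * RtoC (shift_factor al n j) - target_coef m j)%C
                   * target_rad m ^ j) J <= target_eps m / 2;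
  gb_density : forall E : nat -> Prop, (forall n, H n -> E n) ->
    del * beta_sum (beta_weight gam) nend <= beta_sum (beta_weight_on gam E) nend
}.

Arguments gb_support {gam al p m Cst del N b nend H}.
Arguments gb_size {gam al p m Cst del N b nend H}.
Arguments gb_mean {gam al p m Cst del N b nend H}.
Arguments gb_end {gam al p m Cst del N b nend H}.
Arguments gb_hit_range {gam al p m Cst del N b nend H}.
Arguments gb_hit {gam al p m Cst del N b nend H}.
Arguments gb_density {gam al p m Cst del N b nend H}.

(** All constants depend on the target only, while [N] is free.  The length is chosen as
    the largest power of two with [L <= max (1, del' * N ^ (1 - gam))]: then the mean
    [N ^ (- al) * L ^ sig] is at most [1] because [al = (1 - gam) * sig], whereas the
    hits still make up a fixed proportion of the window. *)
Lemma good_block_exists gam sig p m :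
  0 <= gam <= 1 -> Rbar_le 1 p -> 0 <= sig <= 1 / 2 -> kernel_family p sig ->
  exists Cst del N0, 0 < Cst /\ 0 < del /\ forall N, (N0 <= N)%nat ->
    exists b nend H, good_block gam ((1 - gam) * sig) p m Cst del N b nend H.
Proof.
  intros Hgam Hp Hsig (C0 & HC0 & Hker).
  set (al := (1 - gam) * sig).
  assert (Hal : 0 <= al <= 1).
  { unfold al. split; [apply Rmult_le_pos; lra|].
    assert ((1 - gam) * sig <= 1 * sig) by (apply Rmult_le_compat_r; lra). lra. }
  set (q := target_coef m). set (D := target_len m).
  pose proof (target_eps_pos m) as Heps. pose proof (target_rad_range m) as Hrho.
  set (eps := target_eps m) in *. set (rho := target_rad m) in *.
  assert (Hq0 : forall j, (D <= j)%nat -> q j = RtoC 0).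
  { intros j Hj. unfold q, target_coef. fold D. destruct (Nat.ltb_spec j D); [lia|auto]. }
  set (A := 1 + Rsum (fun j => INR (j + 1) * Cmod (q j)) D).
  assert (Hterm : forall j, 0 <= INR (j + 1) * Cmod (q j))
    by (intros; apply Rmult_le_pos; [apply pos_INR|apply Cmod_ge_0]).
  assert (HA1 : 1 <= A).
  { unfold A. pose proof (Rsum_nonneg (fun j => INR (j + 1) * Cmod (q j)) D (fun j _ => Hterm j)). lra. }
  assert (HAs : forall J, Rsum (fun j => INR (j + 1) * Cmod (q j)) J <= A).
  { intros J. apply Rle_trans with (Rsum (fun j => INR (j + 1) * Cmod (q j)) (D + J)).
    - apply Rsum_mono; [auto|lia].
    - rewrite Rsum_add. rewrite (Rsum_ext (fun i => INR (D + i + 1) * _) (fun _ => 0)).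
      + rewrite Rsum_const. unfold A. lra.
      + intros i _. rewrite Hq0, Cmod_0 by lia. ring. }
  assert (HA : forall j, INR (j + 1) * Cmod (q j) <= A).
  { intros j. eapply Rle_trans; [|apply (HAs (S j))].
    apply (Rsum_term (fun j => INR (j + 1) * Cmod (q j))); [auto|lia]. }
  assert (HA' : forall J, Rsum (fun j => Cmod (q j)) J <= A).
  { intros J. eapply Rle_trans; [|apply (HAs J)]. apply Rsum_le. intros j _.
    rewrite <- (Rmult_1_l (Cmod (q j))) at 1. apply Rmult_le_compat_r; [apply Cmod_ge_0|].
    apply (le_INR 1); lia. }
  (* The spacing [d] makes later copies negligible on the disc of radius [rho]. *)
  destruct (pow_small rho (eps / 4 * (1 - rho) / (2 * A))) as [d0 Hd0]; [lra| |].
  { apply Rdiv_lt_0_compat; [apply Rmult_lt_0_compat; lra|lra]. }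
  set (d := (d0 + D + 1)%nat).
  assert (Hd1 : (1 <= d)%nat) by (unfold d; lia).
  assert (HdR : 1 <= INR d) by (apply (le_INR 1); auto).
  assert (Hd : 2 * A * rho ^ d / (1 - rho) <= eps / 4).
  { specialize (Hd0 d ltac:(unfold d; lia)).
    apply (Rmult_le_reg_r (1 - rho)); [lra|].
    unfold Rdiv at 1. rewrite Rmult_assoc, Rinv_l, Rmult_1_r by lra.
    apply (Rmult_le_compat_l (2 * A)) in Hd0; [|lra].
    replace (2 * A * (eps / 4 * (1 - rho) / (2 * A))) with (eps / 4 * (1 - rho)) in Hd0
      by (field; lra). lra. }
  (* [del] bounds the relative length of the window, [del'] the number of copies in it
     relatively to [N ^ (1 - gam)]. *)
  set (del := Rmin 1 (eps / (4 * A))).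
  assert (Hdel : 0 < del <= 1 /\ del * A <= eps / 4).
  { assert (0 < eps / (4 * A)) by (apply Rdiv_lt_0_compat; lra).
    unfold del. split; [split; [apply Rmin_pos; lra|apply Rmin_l]|].
    apply Rle_trans with (eps / (4 * A) * A); [|right; field; lra].
    apply Rmult_le_compat_r; [lra|apply Rmin_r]. }
  set (del' := del / (4 * INR d)).
  assert (Hdel' : 0 < del' <= 1).
  { unfold del'. split; [apply Rdiv_lt_0_compat; lra|].
    apply (Rmult_le_reg_r (4 * INR d)); [lra|].
    unfold Rdiv. rewrite Rmult_assoc, Rinv_l; lra. }
  destruct (beta_sum_window gam (4 * INR d) Hgam ltac:(lra)) as (K & HK & Hwin).
  destruct (INR_large (4 * INR d / del)) as [N1 HN1]. destruct (INR_large A) as [N2 HN2].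
  exists (A * C0), (del' / (4 * K)), (N1 + N2 + 1)%nat.
  split; [apply Rmult_lt_0_compat; lra|]. split; [apply Rdiv_lt_0_compat; lra|].
  intros N HN. specialize (HN1 N ltac:(lia)). specialize (HN2 N ltac:(lia)).
  assert (HNR : 1 <= INR N) by (apply (le_INR 1); lia).
  set (P := Rpower (INR N) (1 - gam)).
  assert (HP : 1 <= P <= INR N) by (apply Rpower_le_base; lra).
  destruct (power_of_two_below (Rmax 1 (del' * P)) (Rmax_l _ _)) as [s Hs].
  assert (Hs0 : 0 < 2 ^ s) by (apply pow_lt; lra).
  assert (Hs1 : 2 ^ s <= P).
  { eapply Rle_trans; [apply Hs|]. apply Rmax_lub; [lra|].
    rewrite <- (Rmult_1_l P) at 2. apply Rmult_le_compat_r; lra. }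
  assert (Hs2 : del' * P <= 2 * 2 ^ s).
  { eapply Rle_trans; [apply Rmax_r|]. left; apply Hs. }
  assert (Hs3 : 4 * 2 ^ s * INR d <= del * INR N).
  { assert (E1 : 4 * 1 * INR d <= del * INR N).
    { apply (Rmult_le_compat_l del) in HN1; [|lra].
      replace (del * (4 * INR d / del)) with (4 * INR d) in HN1 by (field; lra). lra. }
    assert (E2 : 4 * (del' * P) * INR d <= del * INR N).
    { replace (4 * (del' * P) * INR d) with (del * P) by (unfold del'; field; lra).
      apply Rmult_le_compat_l; lra. }
    apply Rle_trans with (4 * Rmax 1 (del' * P) * INR d).
    - apply Rmult_le_compat_r; [lra|]. apply Rmult_le_compat_l; lra.
    - unfold Rmax. destruct Rle_dec; auto. }
  destruct (Hker s d Hd1) as (kap & Hkap & Hhits & Hmean).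
  set (L := (2 ^ s)%nat) in *.
  assert (HLR : INR L = 2 ^ s) by (unfold L; rewrite pow_INR; reflexivity).
  assert (HLd : INR (4 * L * d) <= del * INR N).
  { rewrite !mult_INR, HLR. simpl INR. lra. }
  assert (HLN : (4 * L * d <= N)%nat).
  { apply INR_le. eapply Rle_trans; [exact HLd|].
    rewrite <- (Rmult_1_l (INR N)) at 2. apply Rmult_le_compat_r; lra. }
  set (b := block al q kap N L d).
  pose proof (Rpower_pos (INR N) (- al)) as HNal.
  assert (HNal1 : Rpower (INR N) (- al) <= 1).
  { rewrite <- (Rpower_O (INR N)) by lra. apply Rle_Rpower; lra. }
  exists b, (N + 4 * L * d)%nat, (fun n => exists i, (i < 4 * L)%nat /\ kap i = 1 /\ n = (N + i * d)%nat).
  constructor.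
  - intros n Hn. apply block_outside. lia.
  - intros n. destruct (Nat.lt_ge_cases n N) as [Hn|Hn].
    + unfold b. rewrite block_outside, Cmod_0 by lia. apply pos_INR.
    + apply Rle_trans with (Rpower (INR N) (- al) * A); [apply block_le; auto; lia|].
      apply Rle_trans with (1 * A); [apply Rmult_le_compat_r; lra|].
      apply le_INR in Hn. lra.
  - intros r Hr.
    assert (HPS : forall t, PS b (circle_point r t) =
       (circle_point r t ^ N * (RtoC (Rpower (INR N) (- al)) *
         (kernel_poly kap L (circle_pow r d t) *
          Csum (fun j => RtoC (Rpower (INR (j + 1)) al) * q j * circle_point r t ^ j) d)))%C)
      by (intros t; now apply block_PS).
    assert (Hrn : 0 < r ^ N) by (apply pow_lt; lra).
    pose proof (Rpower_pos (2 ^ s) sig) as HLs.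
    assert (Hc : 0 < r ^ N * (Rpower (INR N) (- al) * A)) by (repeat apply Rmult_lt_0_compat; lra).
    apply mean_le_mono with
      (X := fun t => r ^ N * (Rpower (INR N) (- al) * A) * Cmod (kernel_poly kap L (circle_pow r d t)))
      (B := r ^ N * (Rpower (INR N) (- al) * A) * (C0 * Rpower (2 ^ s) sig)); auto.
    + intros t. apply continuous_ext with (fun t => Cmod
       (circle_point r t ^ N * (RtoC (Rpower (INR N) (- al)) *
         (kernel_poly kap L (circle_pow r d t) *
          Csum (fun j => RtoC (Rpower (INR (j + 1)) al) * q j * circle_point r t ^ j) d)))%C).
      { intros u. now rewrite HPS. }
      revert t. apply ccont_Cmod.
      assert (Hpow : forall n, ccont (fun t => circle_point r t ^ n)%C).
      { intros n. rewrite (functional_extensionality _ _ (fun t => circle_point_pow r t n)).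
        apply ccont_circle_comp. }
      apply ccont_mult; [apply Hpow|]. apply ccont_mult; [apply ccont_const|].
      apply ccont_mult; [apply ccont_kernel_poly|].
      apply (ccont_Csum (fun j t => RtoC (Rpower (INR (j + 1)) al) * q j * circle_point r t ^ j)%C).
      intros j. apply ccont_mult; [apply ccont_const|apply Hpow].
    + intros t. split; [apply Cmod_ge_0|]. rewrite HPS, !Cmod_mult, Cmod_pow, Cmod_R.
      rewrite Cmod_circle_point, Rabs_pos_eq by lra.
      rewrite !Rmult_assoc. apply Rmult_le_compat_l; [lra|]. apply Rmult_le_compat_l; [lra|].
      rewrite (Rmult_comm A). apply Rmult_le_compat_l; [apply Cmod_ge_0|].
      eapply Rle_trans; [apply Cmod_Csum|]. eapply Rle_trans; [|apply (HAs d)].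
      apply Rsum_le. intros j _. rewrite !Cmod_mult, Cmod_R, Cmod_pow, Cmod_circle_point by lra.
      pose proof (Rpower_pos (INR (j + 1)) al). rewrite Rabs_pos_eq by lra.
      assert (Rpower (INR (j + 1)) al <= INR (j + 1))
        by (apply Rpower_le_base; [apply (le_INR 1); lia|auto]).
      assert (0 <= r ^ j <= 1).
      { split; [apply pow_le; lra|]. rewrite <- (pow1 j). apply pow_incr; lra. }
      pose proof (Cmod_ge_0 (q j)).
      rewrite <- (Rmult_1_r (INR (j + 1) * Cmod (q j))).
      apply Rmult_le_compat; [apply Rmult_le_pos; lra|lra| |lra].
      apply Rmult_le_compat_r; lra.
    + assert (E : Rpower (INR N) (- al) * Rpower (2 ^ s) sig <= 1).
      { apply Rle_trans with (Rpower (INR N) (- al) * Rpower P sig).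
        - apply Rmult_le_compat_l; [lra|]. apply Rle_Rpower_l; lra.
        - unfold P. rewrite Rpower_mult. fold al. rewrite <- Rpower_plus.
          rewrite Rplus_opp_l, Rpower_O; lra. }
      replace (r ^ N * (Rpower (INR N) (- al) * A) * (C0 * Rpower (2 ^ s) sig))
        with (A * C0 * r ^ N * (Rpower (INR N) (- al) * Rpower (2 ^ s) sig)) by ring.
      rewrite <- (Rmult_1_r (A * C0 * r ^ N)) at 2.
      apply Rmult_le_compat_l; [|auto]. repeat apply Rmult_le_pos; lra.
    + apply mean_le_scal; auto.
  - lia.
  - intros n (i & Hi & _ & ->). nia.
  - intros n (i & Hi & Hk & ->) J.
    eapply Rle_trans; [apply (block_shift_close al q kap N L d A rho del i J); auto; try lia; try lra|].
    + intros j Hj. apply Hq0. unfold d in Hj. lia.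
    + fold eps. lra.
  - intros E HE.
    apply Rle_trans with (beta_weight gam N * hits kap (4 * L)).
    + assert (HW := Hwin N (N + 4 * L * d)%nat ltac:(lia)).
      assert (HWl : INR (N + 4 * L * d) <= INR N + 4 * INR d * P).
      { rewrite plus_INR, !mult_INR, HLR. simpl INR.
        assert (INR d * 2 ^ s <= INR d * P) by (apply Rmult_le_compat_l; lra). lra. }
      specialize (HW HWl). fold P in HW.
      pose proof (beta_weight_pos gam N).
      apply Rle_trans with (del' / (4 * K) * (K * P * beta_weight gam N)).
      * apply Rmult_le_compat_l; [|auto]. left; apply Rdiv_lt_0_compat; lra.
      * replace (del' / (4 * K) * (K * P * beta_weight gam N))
          with (beta_weight gam N * (del' * P / 4)) by (field; lra).
        apply Rmult_le_compat_l; lra.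
    + eapply Rle_trans; [apply (beta_sum_hits gam E kap N d (4 * L)); try lra; try lia|].
      * intros j Hj Hk. apply HE. eauto.
      * unfold beta_sum. apply Rsum_mono; [intros; apply beta_weight_on_nonneg|lia].
Qed.


(** * Superposition of blocks *)

Lemma Csum_single u n k :
  (k < n)%nat -> (forall j, j <> k -> u j = RtoC 0) -> Csum u n = u k.
Proof.
  intros Hk H. replace n with (k + (1 + (n - k - 1)))%nat by lia. rewrite !Csum_add.
  rewrite (Csum_ext u (fun _ => RtoC 0)) by (intros; apply H; lia).
  rewrite (Csum_ext (fun i => u (k + (1 + i))%nat) (fun _ => RtoC 0)) by (intros; apply H; lia).
  rewrite !Csum_zero. simpl. rewrite Nat.add_0_r. ring.
Qed.

Lemma bounded_at_dominated a e s :
  0 <= s -> (forall n, Cmod (a n) <= Cmod (e n)) -> bounded_at e s -> bounded_at a s.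
Proof.
  intros Hs H (M & HM & HB). exists M. split; [auto|]. intros n.
  eapply Rle_trans; [|apply (HB n)]. apply Rmult_le_compat_r; [now apply pow_le|auto].
Qed.

(** A common majorant: the blocks have coefficients of linear size, at most [n + 1] of
    them meet at index [n], and the shifts bring in one more factor. *)
Definition cubic_coef (n : nat) : C := (INR (S n) * (INR (S n) * (INR (S n) * 1)))%C.

Lemma disc_coef_linear a : disc_coef a -> disc_coef (fun n => INR (S n) * a n)%C.
Proof. intros Ha s Hs. apply bounded_at_linear with ((1 + s) / 2); [apply Ha|]; lra. Qed.

Lemma disc_coef_cubic : disc_coef cubic_coef.
Proof.
  unfold cubic_coef. apply (disc_coef_linear (fun n => INR (S n) * (INR (S n) * 1))%C).
  apply (disc_coef_linear (fun n => INR (S n) * 1)%C). apply (disc_coef_linear (fun _ => RtoC 1)).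
  intros s Hs. exists 1. split; [lra|]. intros n. rewrite Cmod_1, Rmult_1_l.
  rewrite <- (pow1 n). apply pow_incr; lra.
Qed.

Lemma Cmod_cubic n : Cmod (cubic_coef n) = INR (S n) ^ 3.
Proof.
  unfold cubic_coef. rewrite !Cmod_mult, Cmod_1, !Cmod_R.
  rewrite !Rabs_pos_eq by apply pos_INR. ring.
Qed.

(** Closeness is measured on coefficients, in a weighted [l^1] norm. *)
Lemma near_target_coef m c :
  disc_coef c ->
  (forall J, Rsum (fun j => Cmod (c j - target_coef m j)%C * target_rad m ^ j) J <= target_eps m) ->
  near_target m (PS c).
Proof.
  intros Hc H z Hz. pose proof (target_rad_range m) as Hr.
  apply (has_sum_bound (fun n => (c n - target_coef m n) * z ^ n)%C).
  - apply has_sum_ext with (fun n => c n * z ^ n - target_coef m n * z ^ n)%C; [intros; ring|].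
    apply has_sum_minus.
    + apply disc_coef_has_sum; [auto|]. unfold disc; lra.
    + apply has_sum_finite. intros n Hn. unfold target_coef.
      destruct (Nat.ltb_spec n (target_len m)); [lia|ring].
  - intros J. eapply Rle_trans; [|apply (H J)]. apply Rsum_le. intros j _.
    rewrite Cmod_mult, Cmod_pow. apply Rmult_le_compat_l; [apply Cmod_ge_0|].
    apply pow_incr. split; [apply Cmod_ge_0|auto].
Qed.

Section Superposition.

Variables (gam al : R) (p : Rbar).
Hypothesis Hal : 0 <= al <= 1.
Hypothesis Hp : Rbar_le 1 p.

Variables (Cst del : nat -> R) (N nend : nat -> nat) (b : nat -> nat -> C)
  (H : nat -> nat -> Prop).
(* By the pairing, every target is aimed at by infinitely many blocks. *)
Let tgt (k : nat) : nat := fst (of_nat k).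

Hypothesis Hblock : forall k,
  good_block gam al p (tgt k) (Cst (tgt k)) (del (tgt k)) (N k) (b k) (nend k) (H k).
Hypothesis HN : forall k, (k < N k)%nat.
Hypothesis HNS : forall k, (4 * N k < N (S k))%nat.

Lemma positions_lt k k' : (k < k')%nat -> (4 * N k < N k')%nat.
Proof.
  induction k' as [|k' IH]; intros Hk; [lia|].
  destruct (Nat.eq_dec k k') as [->|Hne]; [apply HNS|].
  specialize (IH ltac:(lia)). specialize (HNS k'). lia.
Qed.

(** The sum over all blocks: [N k > k], so blocks beyond number [i] do not reach down to
    the index [i]. *)
Definition sum_coef (i : nat) : C := Csum (fun k => b k i) (S i).

Lemma block_before k i : (i < N k)%nat -> b k i = RtoC 0.
Proof. intros Hi. apply (gb_support (Hblock k)). now left. Qed.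

Lemma block_after k i : (2 * N k <= i)%nat -> b k i = RtoC 0.
Proof. intros Hi. apply (gb_support (Hblock k)). now right. Qed.

Lemma sum_coef_in k i : (N k <= i < N (S k))%nat -> sum_coef i = b k i.
Proof.
  intros Hi. unfold sum_coef. apply (Csum_single (fun k => b k i)).
  - specialize (HN k). lia.
  - intros j Hj. destruct (Nat.lt_ge_cases j k) as [Hlt|Hge].
    + apply block_after. pose proof (positions_lt j k Hlt). lia.
    + apply block_before. destruct (Nat.eq_dec j (S k)) as [->|Hne]; [lia|].
      pose proof (positions_lt (S k) j ltac:(lia)). lia.
Qed.

Lemma Csum_blocks_le i K : Cmod (Csum (fun k => b k i) K) <= INR K * INR i.
Proof.
  eapply Rle_trans; [apply Cmod_Csum|]. rewrite <- Rsum_const. apply Rsum_le.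
  intros k _. apply (gb_size (Hblock k)).
Qed.

Lemma square_le_cube i : INR (S i) * INR i <= INR (S i) ^ 3.
Proof. rewrite S_INR. pose proof (pos_INR i). simpl. nra. Qed.

Lemma sum_coef_disc : disc_coef sum_coef.
Proof.
  intros s Hs. apply bounded_at_dominated with cubic_coef; [lra| |now apply disc_coef_cubic].
  intros i. rewrite Cmod_cubic. eapply Rle_trans; [apply Csum_blocks_le|apply square_le_cube].
Qed.

Lemma block_disc k : disc_coef (b k).
Proof.
  intros s Hs. apply bounded_at_dominated with cubic_coef; [lra| |now apply disc_coef_cubic].
  intros i. rewrite Cmod_cubic.
  eapply Rle_trans; [apply (gb_size (Hblock k))|].
  rewrite S_INR. pose proof (pos_INR i). simpl. nra.
Qed.

(** ** Growth *)

(** The error [1] is enough, and is reached by finitely many blocks on each circle. *)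
Lemma sum_minus_blocks_small r :
  0 < r < 1 -> exists K0, forall K, (K0 <= K)%nat -> forall z, Cmod z <= r ->
    Cmod (PS sum_coef z - Csum (fun k => PS (b k) z) K)%C <= 1.
Proof.
  intros Hr. set (s := (1 + r) / 2).
  destruct (disc_coef_cubic s ltac:(unfold s; lra)) as (M & HM & HB).
  assert (Hq : 0 <= r / s < 1).
  { apply ratio_range with (RtoC r); [rewrite Cmod_R, Rabs_pos_eq; lra|unfold s; lra]. }
  destruct (pow_small (r / s) ((1 - r / s) / (2 * M + 1))) as [K0 HK0]; [auto| |].
  { apply Rdiv_lt_0_compat; lra. }
  exists K0. intros K HK z Hz. specialize (HK0 K HK).
  apply Rle_trans with (2 * M * (r / s) ^ K / (1 - r / s)).
  - apply has_sum_geom_bound with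
      (fun i => (sum_coef i - Csum (fun k => b k i) K) * z ^ i)%C; auto; [lra| | |].
    + apply has_sum_ext with (fun i => sum_coef i * z ^ i - Csum (fun k => b k i * z ^ i) K)%C.
      { intros i. rewrite (Csum_ext (fun k => b k i * z ^ i)%C (fun k => z ^ i * b k i)%C)
          by (intros; ring). rewrite Csum_scal. ring. }
      apply has_sum_minus; [apply disc_coef_has_sum; [apply sum_coef_disc|unfold disc; lra]|].
      apply (has_sum_Csum (fun k i => b k i * z ^ i)%C). intros k _.
      apply disc_coef_has_sum; [apply block_disc|unfold disc; lra].
    + intros i Hi. unfold sum_coef. rewrite (Csum_stable (fun k => b k i) (S i) K); [ring|lia|].
      intros k Hk. apply block_before. specialize (HN k). lia.
    + intros i Hi. replace (2 * M * (r / s) ^ i) with ((2 * M) * (r / s) ^ i) by ring.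
      apply (Cmod_term (fun i => sum_coef i - Csum (fun k => b k i) K)%C s (2 * M) i z r);
        [unfold s; lra| |auto].
      apply Rle_trans with (2 * (Cmod (cubic_coef i) * s ^ i)).
      * rewrite <- Rmult_assoc. apply Rmult_le_compat_r; [apply pow_le; unfold s; lra|].
        rewrite Cmod_cubic. eapply Rle_trans; [apply Cmod_minus_le|].
        pose proof (Csum_blocks_le i (S i)) as B1. pose proof (Csum_blocks_le i K) as B2.
        fold (sum_coef i) in B1.
        assert (INR K * INR i <= INR (S i) * INR i)
          by (apply Rmult_le_compat_r; [apply pos_INR|apply le_INR; lia]).
        pose proof (square_le_cube i). lra.
      * specialize (HB i). lra.
  - set (w := r / s) in *. apply Rle_div_l; [lra|]. rewrite Rmult_1_l.
    apply Rle_trans with ((2 * M + 1) * ((1 - w) / (2 * M + 1))); [|right; field; lra].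
    apply Rmult_le_compat; [lra|apply pow_le; lra|lra|auto].
Qed.

Lemma sum_mean r B :
  0 < r < 1 -> (forall K, Rsum (fun k => Cst (tgt k) * r ^ N k) K <= B) ->
  Rbar_le (integral_mean p (PS sum_coef) r) (B + 1).
Proof.
  intros Hr HB. apply (integral_mean_le p (PS sum_coef) r (B + 1) Hp).
  destruct (sum_minus_blocks_small r Hr) as [K HK]. specialize (HK K (le_n _)).
  apply mean_le_mono with
    (X := fun t => Rsum (fun k => Cmod (PS (b k) (circle_point r t))) K + 1)
    (B := Rsum (fun k => Cst (tgt k) * r ^ N k) K + 1); auto.
  - apply (ccont_Cmod (fun t => PS sum_coef (circle_point r t))).
    apply HD_circle_ccont; [apply HD_PS, sum_coef_disc|auto].
  - intros t. split; [apply Cmod_ge_0|].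
    specialize (HK (circle_point r t) ltac:(rewrite Cmod_circle_point; lra)).
    pose proof (Cmod_Csum (fun k => PS (b k) (circle_point r t)) K).
    set (x := PS sum_coef (circle_point r t)) in *.
    set (y := Csum (fun k => PS (b k) (circle_point r t)) K) in *.
    pose proof (Cmod_triangle (x - y)%C y) as T. replace (x - y + y)%C with x in T by ring. lra.
  - specialize (HB K). lra.
  - apply (mean_le_Rsum p (fun k t => Cmod (PS (b k) (circle_point r t)))); [auto|].
    intros k _. now apply (gb_mean (Hblock k)).
Qed.

(** ** Hypercyclicity *)

(** At a hit of block [k] all earlier blocks have been shifted away, and later ones start
    at an index larger than the shift itself; there, up to a constant, the majorant
    survives the shift. *)
Lemma later_blocks_bound n k j :
  H k n -> 
  Cmod (sum_coef (n + j) - b k (n + j)%nat)%C * shift_factor al n j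
  <= if Nat.ltb j k then 0 else 16 * INR (S j) ^ 3.
Proof.
  intros Hn. pose proof (gb_hit_range (Hblock k) n Hn) as Hrange.
  destruct (Nat.lt_ge_cases (n + j) (N (S k))) as [Hlt|Hge].
  - rewrite (sum_coef_in k) by lia. replace (b k (n + j)%nat - b k (n + j)%nat)%C with (RtoC 0) by ring.
    rewrite Cmod_0, Rmult_0_l. pose proof (pow_le (INR (S j)) 3 (pos_INR _)).
    destruct Nat.ltb; lra.
  - specialize (HNS k). specialize (HN k).
    destruct (Nat.ltb_spec j k); [lia|].
    assert (Hnj : (n <= j)%nat) by lia. set (i := (n + j)%nat) in *.
    assert (Hi : INR (i + 1) <= 2 * INR (S j)).
    { replace 2 with (INR 2) by reflexivity. rewrite <- mult_INR. apply le_INR. lia. }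
    assert (Hs : shift_factor al n j <= INR (i + 1)).
    { eapply Rle_trans; [apply (shift_factor_le al n j (INR (i + 1))); [lra|apply Rle_refl]|].
      apply Rpower_le_base; [apply (le_INR 1); lia|auto]. }
    pose proof (shift_factor_pos al n j).
    assert (Hc : Cmod (sum_coef i - b k i)%C <= 2 * INR (i + 1) ^ 2).
    { eapply Rle_trans; [apply Cmod_minus_le|].
      pose proof (Csum_blocks_le i (S i)) as B1. fold (sum_coef i) in B1.
      pose proof (gb_size (Hblock k) i) as B2.
      rewrite S_INR in B1. rewrite plus_INR. simpl INR. pose proof (pos_INR i). simpl. nra. }
    pose proof (pos_INR (i + 1)).
    apply Rle_trans with (2 * INR (i + 1) ^ 2 * INR (i + 1)).
    + apply Rmult_le_compat; [apply Cmod_ge_0|lra|auto|auto].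
    + replace (2 * INR (i + 1) ^ 2 * INR (i + 1)) with (2 * INR (i + 1) ^ 3) by ring.
      replace (16 * INR (S j) ^ 3) with (2 * (2 * INR (S j)) ^ 3) by ring.
      apply Rmult_le_compat_l; [lra|]. apply pow_incr. lra.
Qed.

Lemma hits_near_target m :
  exists k0, forall k n, (k0 <= k)%nat -> tgt k = m -> H k n ->
    near_target m (PS (iter_shift_coef al n sum_coef)).
Proof.
  pose proof (target_rad_range m) as Hrho. pose proof (target_eps_pos m) as Heps.
  set (rho := target_rad m) in *. set (s := (1 + rho) / 2).
  destruct (disc_coef_cubic s ltac:(unfold s; lra)) as (M & HM & HB).
  assert (Hq : 0 <= rho / s < 1).
  { apply ratio_range with (RtoC rho); [rewrite Cmod_R, Rabs_pos_eq; lra|unfold s; lra]. }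
  destruct (pow_small (rho / s) (target_eps m / 2 * (1 - rho / s) / (16 * M + 1))) as [k0 Hk0]; [auto| |].
  { apply Rdiv_lt_0_compat; [apply Rmult_lt_0_compat|]; lra. }
  exists k0. intros k n Hk Ht Hn. specialize (Hk0 k Hk).
  apply near_target_coef; [now apply disc_coef_iter; [|apply sum_coef_disc]|]. intros J.
  apply Rle_trans with (Rsum (fun j =>
    Cmod (b k (n + j)%nat * RtoC (shift_factor al n j) - target_coef m j)%C * rho ^ j
    + (if Nat.ltb j k then 0 else 16 * INR (S j) ^ 3) * rho ^ j) J).
  - apply Rsum_le. intros j _. fold rho. rewrite <- Rmult_plus_distr_r.
    apply Rmult_le_compat_r; [apply pow_le; lra|].
    rewrite iter_shift_coef_eq. fold (shift_factor al n j).
    eapply Rle_trans; [apply (Cmod_triangle_minus _ (b k (n + j)%nat * RtoC (shift_factor al n j))%C)|].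
    rewrite Rplus_comm. apply Rplus_le_compat_l.
    eapply Rle_trans; [|apply (later_blocks_bound n k j Hn)].
    replace (sum_coef (n + j) * shift_factor al n j - b k (n + j)%nat * shift_factor al n j)%C
      with ((sum_coef (n + j) - b k (n + j)%nat) * shift_factor al n j)%C by ring.
    rewrite Cmod_mult, Cmod_R, Rabs_pos_eq by (left; apply shift_factor_pos). lra.
  - rewrite Rsum_plus. replace (target_eps m) with (target_eps m / 2 + target_eps m / 2) by field.
    apply Rplus_le_compat.
    + pose proof (gb_hit (Hblock k) n Hn J) as G. rewrite Ht in G. exact G.
    + apply Rle_trans with (16 * M * (rho / s) ^ k / (1 - rho / s)).
      * apply Rsum_tail_geom; [auto|lra| |]; intros j Hj; destruct (Nat.ltb_spec j k); try lia; [lra|].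
        specialize (HB j). rewrite Cmod_cubic in HB.
        assert (0 < s ^ j) by (apply pow_lt; unfold s; lra).
        unfold Rdiv. rewrite Rpow_mult_distr, pow_inv.
        apply (Rmult_le_reg_r (s ^ j)); [auto|].
        replace (16 * M * (rho ^ j * / s ^ j) * s ^ j) with (16 * M * rho ^ j) by (field; lra).
        replace (16 * INR (S j) ^ 3 * rho ^ j * s ^ j) with (16 * (INR (S j) ^ 3 * s ^ j) * rho ^ j) by ring.
        apply Rmult_le_compat_r; [apply pow_le; lra|lra].
      * set (w := rho / s) in *. apply Rle_div_l; [lra|].
        apply Rle_trans with ((16 * M + 1) * (target_eps m / 2 * (1 - w) / (16 * M + 1)));
          [|right; field; lra].
        apply Rmult_le_compat; [lra|apply pow_le; lra|lra|auto].
Qed.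

Lemma sum_U_freq_hypercyclic :
  (forall m, 0 < del m) -> U_freq_hypercyclic gam al (PS sum_coef).
Proof.
  intros Hdel U HU HUne. destruct (targets_cover U HU HUne) as [m Hm].
  destruct (hits_near_target m) as [k0 Hk0].
  apply upper_density_pos with (del m); [auto|]. intros n0.
  set (k := to_nat (m, (k0 + n0)%nat)).
  assert (Hk : (k0 + n0 <= k)%nat) by (pose proof (to_nat_non_decreasing m (k0 + n0)); unfold k; lia).
  assert (Ht : tgt k = m) by (unfold tgt, k; now rewrite cancel_of_to).
  pose proof (gb_end (Hblock k)) as Hend. specialize (HN k).
  exists (nend k). split; [lia|]. split; [lia|].
  rewrite <- Ht. apply (gb_density (Hblock k)). intros n Hn.
  exists (PS (iter_shift_coef al n sum_coef)). split.
  - apply taylor_shift_iter_PS; [auto|apply sum_coef_disc].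
  - apply Hm; [apply HD_PS, disc_coef_iter; [auto|apply sum_coef_disc]|].
    apply (Hk0 k n); auto; lia.
Qed.

End Superposition.

Lemma divergence_at_1 phi :
  filterlim phi (at_left 1) (Rbar_locally p_infty) ->
  forall B, exists r0, 0 < r0 < 1 /\ forall r, r0 <= r < 1 -> B <= phi r.
Proof.
  intros Hphi B.
  assert (Hl : at_left 1 (fun r => B < phi r)).
  { apply (Hphi (fun y => B < y)). exists B. auto. }
  destruct Hl as [[e He] Hl]. simpl in Hl.
  pose proof (Rmin_l (/ 2) (e / 2)). pose proof (Rmin_r (/ 2) (e / 2)).
  assert (0 < Rmin (/ 2) (e / 2)) by (apply Rmin_pos; lra).
  exists (1 - Rmin (/ 2) (e / 2)). split; [lra|]. intros r Hr. left. apply Hl; [|lra].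
  change (Rabs (r - 1) < e). apply Rabs_def1; lra.
Qed.

(** At radius [r], the blocks with [rr k <= r] cost at most the sum of their constants, which
    [phi r] pays for; each remaining one is damped to [2 ^ (- k)] by its position.  The
    induction restarts at every block of the first kind, so [rr] need not be monotone. *)
Lemma sparse_growth (phi : R -> R) (c rr : nat -> R) (N : nat -> nat) :
  (forall k, 0 <= c k) -> (forall r, 0 <= r < 1 -> 0 <= phi r) ->
  (forall k r, rr k <= r < 1 -> Rsum c (S k) <= phi r) ->
  (forall k, c k * rr k ^ N k <= (/ 2) ^ k) ->
  forall r K, 0 < r < 1 -> Rsum (fun k => c k * r ^ N k) K <= phi r + 2.
Proof.
  intros Hc Hphi Hrr HN r K Hr.
  assert (Hpart : Rsum (fun k => c k * r ^ N k) K <= phi r + Rsum (fun k => (/ 2) ^ k) K).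
  { induction K as [|K IH]; simpl; [pose proof (Hphi r ltac:(lra)); lra|].
    assert (Hh : 0 <= (/ 2) ^ K) by (apply pow_le; lra).
    destruct (Rle_lt_dec (rr K) r) as [Hle|Hlt].
    - apply Rle_trans with (Rsum c (S K)).
      + apply (Rsum_le (fun k => c k * r ^ N k) c (S K)). intros i _.
        rewrite <- (Rmult_1_r (c i)) at 2. apply Rmult_le_compat_l; [auto|].
        rewrite <- (pow1 (N i)). apply pow_incr; lra.
      + pose proof (Hrr K r ltac:(lra)).
        pose proof (Rsum_nonneg (fun k => (/ 2) ^ k) K (fun k _ => pow_le (/ 2) k ltac:(lra))). lra.
    - assert (c K * r ^ N K <= (/ 2) ^ K).
      { eapply Rle_trans; [|apply HN]. apply Rmult_le_compat_l; [auto|]. apply pow_incr; lra. }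
      lra. }
  pose proof (Rsum_geom (/ 2) K ltac:(lra)). lra.
Qed.

Theorem theorem5p11 :
  forall (gamma : R) (p q : Rbar),
    0 <= gamma <= 1 ->
    Rbar_le 1 p ->
    conjugate_exponents p q ->
    forall phi : R -> R,
      (forall r, 0 <= r < 1 -> 0 <= phi r) ->
      filterlim phi (at_left 1) (Rbar_locally p_infty) ->
      exists (f : C -> C) (K : R),
        HD f /\
        U_freq_hypercyclic gamma (alpha_crit gamma q) f /\
        0 < K /\
        at_left 1 (fun r => Rbar_le (integral_mean p f r) (K * phi r)).
Proof.
  intros gamma p q Hgam Hp Hpq phi Hphi Hlim.
  destruct (kernel_family_conjugate p q Hpq) as [Hker Hsig].
  unfold alpha_crit. set (sig := real (Rbar_inv (Rbar_max 2 q))) in *.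
  set (al := (1 - gamma) * sig).
  assert (Hal : 0 <= al <= 1).
  { unfold al. split; [apply Rmult_le_pos; lra|].
    assert ((1 - gamma) * sig <= 1 * sig) by (apply Rmult_le_compat_r; lra). lra. }
  destruct (functional_choice (fun m (x : R * R * nat) =>
    0 < fst (fst x) /\ 0 < snd (fst x) /\ forall N, (snd x <= N)%nat ->
      exists b nend H, good_block gamma al p m (fst (fst x)) (snd (fst x)) N b nend H))
    as [x Hx].
  { intros m. destruct (good_block_exists gamma sig p m Hgam Hp Hsig Hker)
      as (Cst & del & N0 & H1 & H2 & H3). now exists (Cst, del, N0). }
  set (tgt := fun k => fst (of_nat k)).
  set (c := fun k => fst (fst (x (tgt k)))).
  assert (Hc : forall k, 0 < c k) by (intros k; apply Hx).
  (* From the radius [rr k] on, [phi] pays for the constants of the first [k + 1] blocks;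
     before it, positions from [T k] on damp block [k]. *)
  destruct (functional_choice (fun k r0 => 0 < r0 < 1 /\
     forall r, r0 <= r < 1 -> Rsum c (S k) <= phi r)) as [rr Hrr].
  { intros k. now apply divergence_at_1. }
  destruct (functional_choice (fun k T => forall n, (T <= n)%nat -> c k * rr k ^ n <= (/ 2) ^ k))
    as [T HT].
  { intros k. destruct (Hrr k) as [Hr _]. assert (0 < (/ 2) ^ k) by (apply pow_lt; lra).
    pose proof (Hc k).
    destruct (pow_small (rr k) ((/ 2) ^ k / c k)) as [n0 Hn0]; [lra|now apply Rdiv_lt_0_compat|].
    exists n0. intros n Hn. specialize (Hn0 n Hn).
    apply Rle_trans with (c k * ((/ 2) ^ k / c k)); [apply Rmult_le_compat_l; lra|].
    right; field; lra. }
  (* The factor [4] keeps the windows, of the form [[N, 2 * N]], so far apart that a shift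
     in one window leaves the later blocks at indices above the shift. *)
  set (N := (fix N k := match k with
     | O => T O + snd (x (tgt O)) + 1
     | S k' => T (S k') + snd (x (tgt (S k'))) + 4 * N k' + (S k') + 1 end)%nat).
  assert (HN1 : forall k, (T k <= N k)%nat /\ (snd (x (tgt k)) <= N k)%nat /\ (k < N k)%nat).
  { intros [|k]; simpl; lia. }
  assert (HNS : forall k, (4 * N k < N (S k))%nat) by (intros k; simpl; lia).
  destruct (functional_choice (fun k (y : (nat -> C) * nat * (nat -> Prop)) =>
    good_block gamma al p (tgt k) (fst (fst (x (tgt k)))) (snd (fst (x (tgt k)))) (N k)
      (fst (fst y)) (snd (fst y)) (snd y))) as [y Hy].
  { intros k. destruct (Hx (tgt k)) as (_ & _ & H3).
    destruct (H3 (N k) ltac:(apply HN1)) as (b & nend & H & HG). now exists (b, nend, H). }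
  set (b := fun k => fst (fst (y k))).
  exists (PS (sum_coef b)), 2.
  assert (Hb : forall k, good_block gamma al p (fst (of_nat k)) (fst (fst (x (fst (of_nat k)))))
     (snd (fst (x (fst (of_nat k))))) (N k) (b k) (snd (fst (y k))) (snd (y k))) by exact Hy.
  assert (HNk : forall k, (k < N k)%nat) by (intros; apply HN1).
  split; [|split; [|split; [lra|]]].
  - apply HD_PS. eapply (sum_coef_disc gamma al p (fun m => fst (fst (x m))) (fun m => snd (fst (x m)))
      N (fun k => snd (fst (y k))) b (fun k => snd (y k))); eauto.
  - eapply (sum_U_freq_hypercyclic gamma al p Hal (fun m => fst (fst (x m))) (fun m => snd (fst (x m)))
      N (fun k => snd (fst (y k))) b (fun k => snd (y k))); eauto.
    intros m; apply Hx.
  - destruct (divergence_at_1 phi Hlim 3) as (r0 & Hr0 & H3).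
    assert (P : 0 < 1 - r0) by lra. exists (mkposreal _ P). intros r Hr Hr1.
    change (Rabs (r - 1) < 1 - r0) in Hr. apply Rabs_def2 in Hr.
    assert (Hrange : 0 < r < 1) by lra. specialize (H3 r ltac:(lra)).
    apply Rbar_le_trans with (phi r + 2 + 1).
    + apply (sum_mean gamma al p Hp (fun m => fst (fst (x m))) (fun m => snd (fst (x m)))
        N (fun k => snd (fst (y k))) b (fun k => snd (y k))); auto.
      intros K. apply (sparse_growth phi c rr N); auto.
      * intros k. left; apply Hc.
      * intros k. apply Hrr.
      * intros k. apply HT, HN1.
    + simpl. lra.
Qed.
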